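(* Let $T\in\mathfrak{R}(L^2)$ be an integral operator whose kernel $\boldsymbol{T}$ is a $K^0$-kernel satisfying condition (iv) of the context. Let $\{\beta_n\}_{n=1}^\infty$ be an arbitrary sequence of complex numbers with $\lim_{n\to\infty}\beta_n=0$, and define $\lambda_n(\lambda):=\lambda(1-\beta_n\lambda)^{-1}$ (so that, for each fixed $\lambda\in\mathbb{C}$, $\lambda_n(\lambda)$ is defined for all sufficiently large $n$ and $\lambda_n(\lambda)\to\lambda$ as $n\to\infty$). Then $$\varnothing\neq\nabla_{\mathfrak{s}}(\{\beta_nI+T_n\})\subseteq\nabla_{\mathfrak{s}}(\{\beta_nI+\widetilde{T}_n\})\subseteq\Pi(T),$$ and the following limits hold: (a) for each fixed $\lambda\in\nabla_{\mathfrak{s}}(\{\beta_nI+\widetilde{T}_n\})$, $$\lim_{n\to\infty}\left\|\boldsymbol{t}'_{n\mid\lambda_n(\lambda)}-\boldsymbol{t}'_{\mid\lambda}\right\|_{C(\mathbb{R},L^2)}=0,$$ and for every compact subset $\widetilde{\mathfrak{K}}$ of $\nabla_{\mathfrak{s}}(\{\beta_nI+\widetilde{T}_n\})$ and each fixed $t\in\mathbb{R}$, $$\lim_{n\to\infty}\sup_{\lambda\in\widetilde{\mathfrak{K}}}\left\|\boldsymbol{t}'_{n\mid\lambda_n(\lambda)}(t)-\boldsymbol{t}'_{\mid\lambda}(t)\right\|=0;$$ (b) for each fixed $\lambda\in\nabla_{\mathfrak{s}}(\{\beta_nI+T_n\})$, $$\lim_{n\to\infty}\left\|\boldsymbol{t}_{n\mid\lambda_n(\lambda)}-\boldsymbol{t}_{\mid\lambda}\right\|_{C(\mathbb{R},L^2)}=0,$$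 and for every compact subset $\mathfrak{K}$ of $\nabla_{\mathfrak{s}}(\{\beta_nI+T_n\})$ and each fixed $s\in\mathbb{R}$, $$\lim_{n\to\infty}\sup_{\lambda\in\mathfrak{K}}\left\|\boldsymbol{t}_{n\mid\lambda_n(\lambda)}(s)-\boldsymbol{t}_{\mid\lambda}(s)\right\|=0;$$ (c) for each fixed $\lambda\in\nabla_{\mathfrak{s}}(\{\beta_nI+\widetilde{T}_n\})$, $$\lim_{n\to\infty}\left\|\boldsymbol{T}_{n\mid\lambda_n(\lambda)}-\boldsymbol{T}_{\mid\lambda}\right\|_{C(\mathbb{R}^2,\mathbb{C})}=0,$$ and for every compact subset $\widetilde{\mathfrak{K}}$ of $\nabla_{\mathfrak{s}}(\{\beta_nI+\widetilde{T}_n\})$ and each fixed $(s,t)\in\mathbb{R}^2$, $$\lim_{n\to\infty}\sup_{\lambda\in\widetilde{\mathfrak{K}}}\left|\boldsymbol{T}_{n\mid\lambda_n(\lambda)}(s,t)-\boldsymbol{T}_{\mid\lambda}(s,t)\right|=0.$$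
   Context: $L^2=L^2(\mathbb{R})$ is the complex Hilbert space of square-integrable complex functions on $\mathbb{R}$ (Lebesgue measure); $\mathfrak{R}(L^2)$ is the algebra of bounded linear operators on $L^2$ with operator norm $\|\cdot\|$. A linear operator $T:L^2\to L^2$ is integral with kernel $\boldsymbol{T}$ if $\boldsymbol{T}:\mathbb{R}^2\to\mathbb{C}$ is measurable and $(Tf)(s)=\int_{\mathbb{R}}\boldsymbol{T}(s,t)f(t)\,dt$ for every $f\in L^2$ and almost every $s$. For $S\in\mathfrak{R}(L^2)$, the set of regular values $\Pi(S)$ is the set of $\lambda\in\mathbb{C}$ for which $I-\lambda S$ has an inverse $R_\lambda(S)\in\mathfrak{R}(L^2)$; for $\lambda\in\Pi(S)$ the Fredholm resolvent of $S$ at $\lambda$ is $S_{\mid\lambda}:=SR_\lambda(S)=R_\lambda(S)S$. For a sequence $\{S_n\}$ in $\mathfrak{R}(L^2)$: $\nabla_{\mathfrak{b}}(\{S_n\})$ is the set of all nonzero $\zeta\in\mathbb{C}$ for which there exist positive constants $M(\zeta),N(\zeta)$ such that $\zeta\in\Pi(S_n)$ and $\|S_{n\mid\zeta}\|\le M(\zeta)$ for all $n>N(\zeta)$; $\nabla_{\mathfrak{s}}(\{S_n\})$ is the set of all $\zeta\in\nabla_{\mathfrak{b}}(\{S_n\})$ for which $\lim_{n\to\infty}S_{n\mid\zeta}f$ exists in $L^2$ for every $f\in L^2$. Here $S_{n\mid\zeta}$ is the Fredholm resolvent of $S_n$ at $\zeta$. For a Banach space $B$ and $k\in\mathbb{N}$,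 $C(\mathbb{R}^k,B)$ is the Banach space of continuous functions $f:\mathbb{R}^k\to B$ with $\|f(x)\|_B\to0$ as $|x|\to\infty$, with norm $\sup_x\|f(x)\|_B$. $K^0$-kernel: a function $\boldsymbol{T}:\mathbb{R}^2\to\mathbb{C}$ with $\boldsymbol{T}(s,\cdot),\boldsymbol{T}(\cdot,s)\in L^2$ for every $s$, such that (i) $\boldsymbol{T}\in C(\mathbb{R}^2,\mathbb{C})$; (ii) $s\mapsto\boldsymbol{t}(s)=\overline{\boldsymbol{T}(s,\cdot)}$ is in $C(\mathbb{R},L^2)$; (iii) $s\mapsto\boldsymbol{t}'(s)=\boldsymbol{T}(\cdot,s)$ is in $C(\mathbb{R},L^2)$. Condition (iv): there exist positive reals $\tau_n$ ($n\in\mathbb{N}$) strictly increasing to $+\infty$ (fixed once and for all) such that, with $\chi_n$ the characteristic function of $(-\tau_n,\tau_n)$ and $P_n$ the orthogonal projection $P_nf=\chi_nf$ on $L^2$, for each $n$ the subkernels $\boldsymbol{T}_n(s,t)=\chi_n(s)\boldsymbol{T}(s,t)$ and $\widetilde{\boldsymbol{T}}_n(s,t)=\chi_n(s)\boldsymbol{T}(s,t)\chi_n(t)$ are $K^0$-kernels, and the integral operators they induce, $T_n:=P_nT$ and $\widetilde{T}_n:=P_nTP_n$, are nuclear (trace class). Resolvent kernels: if $S\in\mathfrak{R}(L^2)$ is an integral operator whose kernel $\boldsymbol{S}$ is a $K^0$-kernel and $\lambda\in\Pi(S)$, then the resolvent kernel $\boldsymbol{S}_{\mid\lambda}$ is the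 (unique, existing) $K^0$-kernel that induces the Fredholm resolvent $S_{\mid\lambda}$; equivalently, the $K^0$-kernel satisfying, for all $s,t$, $\boldsymbol{S}_{\mid\lambda}(s,t)-\lambda\int\boldsymbol{S}(s,x)\boldsymbol{S}_{\mid\lambda}(x,t)\,dx=\boldsymbol{S}(s,t)$ and $\boldsymbol{S}_{\mid\lambda}(s,t)-\lambda\int\boldsymbol{S}_{\mid\lambda}(s,x)\boldsymbol{S}(x,t)\,dx=\boldsymbol{S}(s,t)$, and $\int|\int\boldsymbol{S}_{\mid\lambda}(s,t)f(t)\,dt|^2ds<\infty$ for all $f\in L^2$. The resolvent Carleman functions are $\boldsymbol{s}_{\mid\lambda}(s)=\overline{\boldsymbol{S}_{\mid\lambda}(s,\cdot)}$ and $\boldsymbol{s}'_{\mid\lambda}(t)=\boldsymbol{S}_{\mid\lambda}(\cdot,t)$, both in $C(\mathbb{R},L^2)$. For $\boldsymbol{S}=\boldsymbol{T}$ they are written $\boldsymbol{T}_{\mid\lambda},\boldsymbol{t}_{\mid\lambda},\boldsymbol{t}'_{\mid\lambda}$, and for $\boldsymbol{S}=\boldsymbol{T}_n$ they are written $\boldsymbol{T}_{n\mid\lambda},\boldsymbol{t}_{n\mid\lambda},\boldsymbol{t}'_{n\mid\lambda}$. Limits as $n\to\infty$ involve only sufficiently large $n$, for which the objects concerned are defined. *)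

(* Defs.v *)
From HB Require Import structures.
From mathcomp Require Import all_boot all_order all_algebra.
From mathcomp Require Import ring_quotient complex.
From mathcomp Require Import all_classical all_reals all_analysis.
From mathcomp Require Import measurable_realfun hoelder.

Set Implicit Arguments.
Unset Strict Implicit.
Unset Printing Implicit Defensive.

Import Order.TTheory GRing.Theory Num.Theory.
Import numFieldNormedType.Exports.

Local Open Scope classical_set_scope.
Local Open Scope complex_scope.
Local Open Scope ring_scope.

(* The numeric topology and the self-module structure of R[i] are only
   available on the alias R[i]^o. *)
Notation CC R := (R[i]^o)%type.

(* A complex function is measurable, integrable or integrated through its real
   and imaginary parts. *)
Section ComplexFunctions.
Context d (T : measurableType d) (R : realType) (mu : {measure set T -> \bar R}).
Implicit Types f : T -> CC R.

Definition cmeasurable f :=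
  measurable_fun setT (fun x => complex.Re (f x)) /\
  measurable_fun setT (fun x => complex.Im (f x)).

Definition cintegrable f :=
  mu.-integrable setT (fun x => (complex.Re (f x))%:E) /\
  mu.-integrable setT (fun x => (complex.Im (f x))%:E).

Definition cintegral f : CC R :=
  (\int[mu]_x complex.Re (f x)) +i* (\int[mu]_x complex.Im (f x)).

Definition Lnorm2 f : \bar R := Lnorm mu 2%:E (fun x => (Normc.normc (f x))%:E).

Definition square_integrable f := cmeasurable f /\ (Lnorm2 f < +oo)%E.

Lemma cmeasurable_normc f : cmeasurable f ->
  measurable_fun setT (fun x => Normc.normc (f x)).
Proof.
move=> [mr mi].
have -> : (fun x => Normc.normc (f x)) =
    (fun x => Num.sqrt (complex.Re (f x) ^+ 2 + complex.Im (f x) ^+ 2)).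
  by apply/funext => x; case: (f x).
apply: (@measurableT_comp _ _ _ _ _ _ (@Num.sqrt R)).
  by apply: continuous_measurable_fun; exact: sqrt_continuous.
by apply: measurable_funD; exact: measurable_funX.
Qed.

Lemma normc_ge0 (z : R[i]) : 0 <= Normc.normc z.
Proof. by case: z => a b; exact: sqrtr_ge0. Qed.

Lemma cmeasurableD f g : cmeasurable f -> cmeasurable g -> cmeasurable (f + g).
Proof.
move=> [mr mi] [nr ni]; split.
- rewrite (_ : (fun _ => _) = (fun x => complex.Re (f x) + complex.Re (g x))).
    exact: measurable_funD.
  by apply/funext => x; rewrite /GRing.add/=; case: (f x); case: (g x).
- rewrite (_ : (fun _ => _) = (fun x => complex.Im (f x) + complex.Im (g x))).
    exact: measurable_funD.
  by apply/funext => x; rewrite /GRing.add/=; case: (f x); case: (g x).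
Qed.

Lemma cmeasurableZ (a : R[i]) f : cmeasurable f -> cmeasurable (a *: f).
Proof.
move=> [mr mi]; case: a => a b; split.
- rewrite (_ : (fun _ => _) = (fun x => a * complex.Re (f x) - b * complex.Im (f x))).
    by apply: measurable_funB; exact: measurable_funM.
  by apply/funext => x; rewrite fctE /GRing.scale/=; case: (f x).
- rewrite (_ : (fun _ => _) = (fun x => a * complex.Im (f x) + b * complex.Re (f x))).
    by apply: measurable_funD; exact: measurable_funM.
  by apply/funext => x; rewrite fctE /GRing.scale/=; case: (f x).
Qed.

Lemma Lnorm2_ge0 f : (0 <= Lnorm2 f)%E.
Proof. exact: Lnorm_ge0. Qed.

Lemma mpow (h : T -> R) : measurable_fun setT h ->
  measurable_fun setT (fun x => `|(h x)%:E| `^ 2)%E.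
Proof.
move=> mh; apply: (measurableT_comp (measurable_poweR _)).
by apply: measurableT_comp => //; exact/measurable_EFinP.
Qed.

Lemma Lnorm2D f g : cmeasurable f -> cmeasurable g ->
  (Lnorm2 (f + g)%R <= Lnorm2 f + Lnorm2 g)%E.
Proof.
move=> mf mg; have mf' := cmeasurable_normc mf; have mg' := cmeasurable_normc mg.
apply: le_trans (eminkowski mu mf' mg' _); last by rewrite lee_fin ler1n.
rewrite /Lnorm2 unlock /Lnorm.
have ge0 (x : \bar R) (r : R) : (x `^ r)%E \in `[0%E, +oo%E].
  by rewrite in_itv/= leey poweR_ge0.
have ige0 h : (\int[mu]_x (h x `^ 2))%E \in `[0%E, +oo%E].
  by rewrite in_itv/= leey integral_ge0// => x _; exact: poweR_ge0.
apply: gt0_ler_poweR; rewrite ?invr_ge0//.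
apply: ge0_le_integral => //.
- by move=> x _; exact: poweR_ge0.
- exact: mpow (cmeasurable_normc (cmeasurableD mf mg)).
- exact: mpow (measurable_funD mf' mg').
- move=> x _; apply: gt0_ler_poweR => //; rewrite ?in_itv/= ?leey ?andbT ?lee_fin//.
  rewrite !ger0_norm ?addr_ge0 ?normc_ge0//.
  exact: le_normcD.
Qed.

Lemma Lnorm2Z (a : R[i]) f : cmeasurable f ->
  Lnorm2 (a *: f) = ((Normc.normc a)%:E * Lnorm2 f)%E.
Proof.
move=> mf; rewrite /Lnorm2 unlock /Lnorm.
have a0 := normc_ge0 a.
under eq_integral => x _.
  rewrite [(a *: f) x]/(a * f x) Normc.normcM EFinM abseM poweRM ?abse_ge0//.
  over.
rewrite ge0_integralZl ?poweR_ge0//; last 2 first.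
- exact: mpow (cmeasurable_normc mf).
- by move=> x _; exact: poweR_ge0.
rewrite poweRM ?poweR_ge0 ?integral_ge0//; last by move=> x _; exact: poweR_ge0.
congr (_ * _)%E.
by rewrite poweR_EFin -powRrM mulfV// powRr1 ger0_norm.
Qed.

Lemma Lnorm2_eq0 f : cmeasurable f -> Lnorm2 f = 0%E ->
  {ae mu, forall x, f x = 0}.
Proof.
move=> mf f0; have mf' := cmeasurable_normc mf.
have /measurable_EFinP mf'' := mf'.
have := Lnorm_eq0_eq0 mf'' _ f0; rewrite lte_fin => /(_ (ltr0Sn _ 1)).
by apply: filterS => x /(_ I) [] /Normc.eq0_normc.
Qed.

Lemma eq_ae_Lnorm2 f g : cmeasurable f -> cmeasurable g ->
  {ae mu, forall x, f x = g x} -> Lnorm2 f = Lnorm2 g.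
Proof.
move=> mf mg fg; rewrite /Lnorm2 unlock /Lnorm; congr (_ `^ _)%E.
apply: ae_eq_integral => //.
- exact: mpow (cmeasurable_normc mf).
- exact: mpow (cmeasurable_normc mg).
- by apply: filterS fg => x fgx _; rewrite fgx.
Qed.

Lemma cmeasurable0 : cmeasurable (0 : T -> CC R).
Proof. by split; exact: measurable_cst. Qed.

Lemma Lnorm2_0 : Lnorm2 0 = 0%E.
Proof.
rewrite /Lnorm2 (_ : (fun _ => _) = cst 0%E); first by rewrite Lnorm0// eqe pnatr_eq0.
by apply/funext => x; rewrite Normc.normc0.
Qed.

End ComplexFunctions.

(* L2 mu is the space of complex square integrable functions modulo equality
   almost everywhere, made into a normed module over R[i]. *)
Section L2space.
Context d (T : measurableType d) (R : realType) (mu : {measure set T -> \bar R}).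

Definition L2fun_pred : {pred T -> CC R} :=
  fun f => `[< square_integrable mu f >].

Lemma L2fun_submod_closed : submod_closed L2fun_pred.
Proof.
split.
  by apply/asboolP; split; [exact: cmeasurable0|rewrite Lnorm2_0].
move=> a f g /asboolP[mf lf] /asboolP[mg lg]; apply/asboolP.
have maf := cmeasurableZ a mf.
split; first exact: cmeasurableD.
apply: le_lt_trans (Lnorm2D mu maf mg) _.
by rewrite lte_add_pinfty// Lnorm2Z// lte_mul_pinfty ?lee_fin ?normc_ge0.
Qed.

HB.instance Definition _ := GRing.isSubmodClosed.Build R[i] (T -> CC R)
  L2fun_pred L2fun_submod_closed.

Record L2fun := MkL2fun {
  L2fun_val :> T -> CC R ;
  L2fun_valP : L2fun_val \in L2fun_pred }.

HB.instance Definition _ := [isSub for L2fun_val].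
HB.instance Definition _ := [Choice of L2fun by <:].
HB.instance Definition _ := [SubChoice_isSubLmodule of L2fun by <:].

Definition ae0_pred : {pred L2fun} :=
  fun f => `[< {ae mu, forall x, f x = 0} >].

Lemma ae0_zmod_closed : zmod_closed ae0_pred.
Proof.
split; first by apply/asboolP/nearW.
move=> f g /asboolP f0 /asboolP g0; apply/asboolP.
by apply: filterS2 f0 g0 => x /= f0 g0; rewrite -[LHS]/(f x - g x) f0 g0 subr0.
Qed.

HB.instance Definition _ := GRing.isZmodClosed.Build L2fun ae0_pred ae0_zmod_closed.

Definition L2 : Type := Quotient.quot ae0_pred.
HB.instance Definition _ := Choice.on L2.
HB.instance Definition _ := GRing.Zmodule.on L2.
HB.instance Definition _ := EqQuotient.on L2.

Local Open Scope quotient_scope.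

Implicit Types f g h : L2fun.
Implicit Types u v : L2.

Lemma L2fun_square_integrable f : square_integrable mu f.
Proof. by case: f => f /= /asboolP. Qed.

Lemma L2fun_cmeasurable f : cmeasurable f.
Proof. by case: (L2fun_square_integrable f). Qed.

Lemma L2eqP f g : (\pi_L2 f = \pi_L2 g) <-> {ae mu, forall x, f x = g x}.
Proof.
split=> [/eqP|fg].
  rewrite -Quotient.idealrBE => /asboolP; apply: filterS => x.
  by move=> fgx; apply/eqP; rewrite -subr_eq0; apply/eqP; exact: fgx.
apply/eqP; rewrite -Quotient.idealrBE; apply/asboolP; apply: filterS fg => x fgx.
by have -> : (f - g : L2fun) x = f x - g x by []; rewrite fgx subrr.
Qed.

Lemma L2_repr_pi f : {ae mu, forall x, (repr (\pi_L2 f) : L2fun) x = f x}.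
Proof. by apply/L2eqP; rewrite reprK. Qed.

Definition L2_scale (a : R[i]) u : L2 := \pi_L2 (a *: (repr u : L2fun)).

Lemma L2_scale_pi a f : L2_scale a (\pi_L2 f) = \pi_L2 (a *: f).
Proof.
apply/L2eqP; apply: filterS (L2_repr_pi f) => x fx.
by rewrite -[LHS]/(a *: (repr (\pi_L2 f) : L2fun) x) fx.
Qed.

Lemma L2_scaleA a b u : L2_scale a (L2_scale b u) = L2_scale (a * b) u.
Proof. by elim/quotW: u => f; rewrite (L2_scale_pi b f) !L2_scale_pi scalerA. Qed.

Lemma L2_scale1 : left_id 1 L2_scale.
Proof. by elim/quotW => f; rewrite L2_scale_pi scale1r. Qed.

Lemma L2_piD f g : \pi_L2 (f + g) = \pi_L2 f + \pi_L2 g :> L2.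
Proof. exact: Quotient.pi_add. Qed.

Lemma L2_scaleDr : right_distributive L2_scale +%R.
Proof.
move=> a; elim/quotW => f; elim/quotW => g.
by rewrite -L2_piD !L2_scale_pi -L2_piD scalerDr.
Qed.

Lemma L2_scaleDl u : {morph L2_scale^~ u : a b / a + b}.
Proof.
by move=> a b; elim/quotW: u => f; rewrite !L2_scale_pi -L2_piD scalerDl.
Qed.

HB.instance Definition _ := GRing.Zmodule_isLmodule.Build R[i] L2
  L2_scaleA L2_scale1 L2_scaleDr L2_scaleDl.

Definition L2_norm u : R := fine (Lnorm2 mu (repr u : L2fun)).

Lemma L2_normE f : (L2_norm (\pi_L2 f))%:E = Lnorm2 mu f.
Proof.
rewrite /L2_norm (eq_ae_Lnorm2 (L2fun_cmeasurable _) (L2fun_cmeasurable f) (L2_repr_pi f)).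
by rewrite fineK// ge0_fin_numE ?Lnorm2_ge0//; case: (L2fun_square_integrable f).
Qed.

Lemma L2_normD u v : (L2_norm (u + v))%:C <= (L2_norm u)%:C + (L2_norm v)%:C :> R[i].
Proof.
elim/quotW: u => f; elim/quotW: v => g.
rewrite -rmorphD lecR -lee_fin -L2_piD EFinD !L2_normE.
exact: (Lnorm2D mu (L2fun_cmeasurable _) (L2fun_cmeasurable _)).
Qed.

Lemma L2_normZ (a : R[i]) u : (L2_norm (a *: u))%:C = `|a| * (L2_norm u)%:C.
Proof.
elim/quotW: u => f; rewrite -[a *: _]/(L2_scale a _) L2_scale_pi.
rewrite -[`|a|]/((Normc.normc a)%:C) -rmorphM; congr (_%:C).
apply: EFin_inj; rewrite EFinM !L2_normE.
exact: (Lnorm2Z mu a (L2fun_cmeasurable _)).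
Qed.

Lemma L2_norm0_eq0 u : (L2_norm u)%:C = 0 :> R[i] -> u = 0.
Proof.
move=> [u0]; have : Lnorm2 mu (repr u : L2fun) = 0%E by rewrite -L2_normE reprK u0.
move=> /(Lnorm2_eq0 (L2fun_cmeasurable _)) ru0.
have -> : 0 = \pi_L2 0 :> L2 by rewrite /= !piE.
by rewrite -[u]reprK; apply/L2eqP.
Qed.

HB.instance Definition _ := @Lmodule_isNormed.Build R[i] L2
  (fun u => (L2_norm u)%:C) L2_normD L2_normZ L2_norm0_eq0.

End L2space.
(* The norm of a normed module over R[i] is R[i]-valued (with zero imaginary
   part); rnorm is the same norm with values in R. *)
Definition rnorm (R : realType) (V : normedModType R[i]) (v : V) : R :=
  complex.Re `|v|.

(* Supremum of a family of nonnegative reals; adjoining 0 only makes the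
   supremum over the empty set equal to 0. *)
Definition esup (R : realType) (X : Type) (A : set X) (g : X -> R) : \bar R :=
  ereal_sup (0%E |` [set (g x)%:E | x in A]).

Section C0.
Context (R : realType) (V : normedModType R) (B : normedModType R[i]).
Implicit Types f : V -> B.

Definition C0 f := continuous f /\
  forall e : R, 0 < e -> exists A : R, forall x, A < `|x| -> rnorm (f x) < e.

Definition C0norm f : \bar R := esup setT (fun x => rnorm (f x)).

End C0.

Notation L2R R := (L2 (@lebesgue_measure R)).

Section Operators.
Context (R : realType).
Local Notation mu := (@lebesgue_measure R).
Local Open Scope quotient_scope.
Implicit Types (S : L2R R -> L2R R) (K : R * R -> CC R) (l : R[i]).

(* A representative of the class u. *)
Definition L2_fun (u : L2R R) : R -> CC R := (repr u : L2fun mu).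

(* The class of f when f is square integrable, and 0 otherwise. *)
Definition toL2 (f : R -> CC R) : L2R R := \pi_(L2R R) (insubd (0 : L2fun mu) f).

Definition L2_inner (u v : L2R R) : R[i] :=
  cintegral mu (fun x => L2_fun u x * conjc (L2_fun v x)).

Definition bounded_operator S :=
  linear S /\ exists M : R, forall f, rnorm (S f) <= M * rnorm f.

Definition opnorm S : \bar R := esup [set f | rnorm f <= 1] (fun f => rnorm (S f)).

(* S is an absolutely convergent series of rank one operators. *)
Definition nuclear S := exists u v : nat -> L2R R,
  (\sum_(0 <= k <oo) (rnorm (u k) * rnorm (v k))%:E < +oo)%E /\
  forall f, series (fun k => L2_inner f (u k) *: v k) @ \oo --> S f.

Definition integral_operator S K := cmeasurable K /\
  forall f, {ae mu, forall s,
    cintegrable mu (fun t => K (s, t) * L2_fun f t) /\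
    L2_fun (S f) s = cintegral mu (fun t => K (s, t) * L2_fun f t)}.

Definition inverse_of_id_sub S l (Q : L2R R -> L2R R) := bounded_operator Q /\
  forall f, Q (f - l *: S f) = f /\ Q f - l *: S (Q f) = f.

Definition regular_values S : set (CC R) :=
  [set l | exists Q, inverse_of_id_sub S l Q].

(* The value is meaningful for l in regular_values S only. *)
Definition resolvent S l : L2R R -> L2R R := xget (id : L2R R -> L2R R) [set Q | inverse_of_id_sub S l Q].

Definition fredholm_resolvent S l : L2R R -> L2R R := S \o resolvent S l.

Definition nabla_b (S_ : nat -> L2R R -> L2R R) : set (CC R) :=
  [set z | z != 0 /\ exists M N : R, [/\ 0 < M, 0 < N &
    forall n : nat, N < n%:R -> regular_values (S_ n) z /\
      (opnorm (fredholm_resolvent (S_ n) z) <= M%:E)%E]].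

Definition nabla_s (S_ : nat -> L2R R -> L2R R) : set (CC R) :=
  [set z | nabla_b S_ z /\
    forall f, cvg (fredholm_resolvent (S_ n) z f @[n --> \oo])].

Definition carleman K (s : R) : L2R R := toL2 (fun t => conjc (K (s, t))).

Definition carleman' K (t : R) : L2R R := toL2 (fun s => K (s, t)).

Definition K0_kernel K := [/\
  forall s, square_integrable mu (fun t => K (s, t)) /\
            square_integrable mu (fun t => K (t, s)),
  C0 K, C0 (carleman K) & C0 (carleman' K)].

(* Well defined: a continuous kernel is determined by the operator that it
   induces.  The value is meaningful for l in regular_values S only. *)
Definition resolvent_kernel S l : R * R -> CC R :=
  xget (0 : R * R -> CC R)
    [set K | K0_kernel K /\ integral_operator (fredholm_resolvent S l) K].

(* The characteristic function of the interval (-a, a). *)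
Definition cutoff (a : R) : R -> CC R := fun x => (\1_(`]- a, a[%classic) x)%:C.

Definition cutoff_proj (a : R) (f : L2R R) : L2R R :=
  toL2 (fun x => cutoff a x * L2_fun f x).

Definition T_trunc (tau : nat -> R) (T : L2R R -> L2R R) n :=
  cutoff_proj (tau n) \o T.

Definition T_trunc2 (tau : nat -> R) (T : L2R R -> L2R R) n :=
  cutoff_proj (tau n) \o T \o cutoff_proj (tau n).

Definition nuclear_truncations (tau : nat -> R) (T : L2R R -> L2R R) K := [/\
  forall n, 0 < tau n,
  {homo tau : m n / (m < n)%N >-> m < n},
  tau n @[n --> \oo] --> +oo &
  forall n,
    [/\ K0_kernel (fun p => cutoff (tau n) p.1 * K p),
        K0_kernel (fun p => cutoff (tau n) p.1 * K p * cutoff (tau n) p.2),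
        nuclear (T_trunc tau T n) & nuclear (T_trunc2 tau T n)]].

Definition perturbed (beta : nat -> CC R) (S_ : nat -> L2R R -> L2R R) n :=
  fun f => beta n *: f + S_ n f.

(* Meaningful when 1 - beta n * l != 0, i.e. for all large n when beta tends
   to 0. *)
Definition lambda_ (beta : nat -> CC R) n (l : CC R) : CC R := l / (1 - beta n * l).

End Operators.

(* Main.v *)
Require Import Defs.
From HB Require Import structures.
From mathcomp Require Import all_boot all_order all_algebra.
From mathcomp Require Import ring_quotient complex.
From mathcomp Require Import all_classical all_reals all_analysis.
From mathcomp Require Import measurable_realfun.
From mathcomp Require Import ring lra.
Set Implicit Arguments.
Unset Strict Implicit.
Unset Printing Implicit Defensive.
Import Order.TTheory GRing.Theory Num.Theory.
Import numFieldNormedType.Exports.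
Local Open Scope classical_set_scope.
Local Open Scope complex_scope.
Local Open Scope ring_scope.

(** Write P_n for the cutoff to ]- tau n, tau n[, T_n = P_n T, T~_n = P_n T P_n
    and l_n = l / (1 - beta_n l).

    For large n the equation I - l (beta_n I + S_n) = (1 - beta_n l) (I - l_n S_n)
    turns a statement on beta_n I + S_n at l into one on S_n at l_n: a nonzero l
    lies in nabla_s exactly when the operators I - l_n S_n have inverses Q_n that
    are uniformly bounded and converge strongly ([nabla_sP]).  If A and B are
    bounded, then (I - l B A)^-1 = I + l B (I - l A B)^-1 A; as T_n = P_n T_n and
    T~_n = T_n P_n, the two sequences of the theorem have the same nabla_s
    ([nabla_s_swap], [nabla_s_trunc2]).  Small nonzero l belong to it, by
    iteration ([nabla_s_nonempty]).  As T_n tends strongly to T, the strong limit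
    of Q_n inverts I - l T, so l is a regular value of T ([inverse_limit]).

    If S has the kernel K and Q inverts I - l S, the resolvent kernel is
    K(s, t) + l <Q k'(t), k(s)>, where k and k' are the Carleman functions of K;
    its own Carleman functions are s |-> Q' k(s), with Q' the adjoint of Q, and
    t |-> Q k'(t) ([Rkernel], [carleman_Rkernel], [carleman'_Rkernel]).  This
    needs adjoints, hence the Riesz theorem ([riesz]) and the completeness of L2
    ([L2_geometric_cvg]), and the fact that the adjoint of S acts by the
    conjugate transpose of K, which is Fubini's theorem ([adjoint_kernel]).  A
    kernel with continuous Carleman functions is determined by its operator
    ([K0_uniq]), so this formula is the resolvent kernel of the statement.

    All limits come from one identity: if z = l S z + y, then
    Q_n y_n - z = Q_n (y_n - (z - l_n S_n z)), where the argument of Q_n tends to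
    0 when S_n z tends to S z, l_n to l and y_n to y ([inverse_cvg]).  It applies
    to Q_n and, since the adjoint of T_n is T' P_n, to the adjoint of Q_n.  Used
    along a filter on which n, the spectral parameter and the points s, t vary
    together, it gives locally uniform limits ([carleman'_cvg0],
    [carleman_cvg0], [kernel_cvg0]).  These are uniform on compact sets of
    parameters; for a fixed parameter they are uniform in s and t because the
    Carleman functions and K vanish at infinity ([esup_compact_cvg0],
    [esup_space_cvg0]). *)

(** * Real-valued norms and limits in complex normed modules *)

Section RealNorm.
Context (R : realType).

Section Module.
Context (V : normedModType R[i]).
Implicit Types u v w : V.

Lemma rnormE v : `|v| = (rnorm v)%:C.
Proof. by rewrite /rnorm; have := normr_ge0 v; case: (`|v|) => a b; rewrite lecE/= => /andP[/eqP -> _]. Qed.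

Lemma rnorm_ge0 v : 0 <= rnorm v.
Proof. by have := normr_ge0 v; rewrite rnormE lecR. Qed.

Lemma rnorm0 : rnorm (0 : V) = 0.
Proof. by rewrite /rnorm normr0. Qed.

Lemma rnorm0_eq0 v : rnorm v = 0 -> v = 0.
Proof. by move=> v0; apply/normr0_eq0; rewrite rnormE v0. Qed.

Lemma rnormD u v : rnorm (u + v) <= rnorm u + rnorm v.
Proof. by have := ler_normD u v; rewrite !rnormE -rmorphD lecR. Qed.

Lemma rnormN v : rnorm (- v) = rnorm v.
Proof. by rewrite /rnorm normrN. Qed.

Lemma rnormB u v : rnorm (u - v) = rnorm (v - u).
Proof. by rewrite -rnormN opprB. Qed.

Lemma rnorm_sub u v : rnorm (u - v) <= rnorm u + rnorm v.
Proof. by rewrite -(rnormN v) rnormD. Qed.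

Lemma rnorm_dist u v w : rnorm (u - v) <= rnorm (u - w) + rnorm (w - v).
Proof. by rewrite (_ : u - v = (u - w) + (w - v)) ?rnormD// addrA subrK. Qed.

Lemma rnormcE (z : CC R) : rnorm z = Normc.normc z.
Proof. by []. Qed.

Lemma rnormZ (a : CC R) v : rnorm (a *: v) = rnorm a * rnorm v.
Proof.
apply: (@complexI R).
by rewrite rmorphM/= -!rnormE normrZ.
Qed.

Section Cvg.
Context (I : Type) (F : set_system I) {FF : Filter F}.

Lemma rcvgP (u : I -> V) v : (u i @[i --> F] --> v) <->
  (forall e : R, 0 < e -> \forall i \near F, rnorm (u i - v) < e).
Proof.
split=> [/cvgrPdist_lt h e e0|h].
  have /h : 0 < e%:C by rewrite ltcR.
  by apply: filterS => i; rewrite rnormE ltcR rnormB.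
apply/cvgrPdist_lt => e; rewrite ltcE/= => /andP[/eqP ei er].
apply: filterS (h _ er) => i; rewrite rnormB rnormE => hi.
by rewrite ltcE/= ei eqxx.
Qed.

Lemma rcvg0P (u : I -> V) v : (u i @[i --> F] --> v) <->
  (rnorm (u i - v) @[i --> F] --> (0 : R)).
Proof.
rewrite rcvgP; split => [h|/cvgrPdist_lt h e e0].
  apply/cvgrPdist_lt => e e0; apply: filterS (h e e0) => i.
  by rewrite sub0r normrN ger0_norm ?rnorm_ge0.
by apply: filterS (h _ e0) => i; rewrite sub0r normrN ger0_norm ?rnorm_ge0.
Qed.

Lemma rcvg_squeeze (u : I -> V) v (g : I -> R) :
  (\forall i \near F, rnorm (u i - v) <= g i) -> g i @[i --> F] --> (0 : R) ->
  u i @[i --> F] --> v.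
Proof.
move=> ug g0; apply/rcvg0P; apply: (squeeze_cvgr _ (cvg_cst 0) g0).
by apply: filterS ug => i ->; rewrite rnorm_ge0.
Qed.

Lemma dist_cvg0 (u v : I -> V) (w : V) :
  u i @[i --> F] --> w -> v i @[i --> F] --> w ->
  rnorm (u i - v i) @[i --> F] --> (0 : R).
Proof.
move=> /rcvg0P uw /rcvg0P vw.
have h : rnorm (u i - w) + rnorm (v i - w) @[i --> F] --> (0 : R).
  by rewrite -[X in _ --> X](addr0 0); exact: cvgD.
apply: (squeeze_cvgr _ (cvg_cst 0) h); apply: nearW => i.
by rewrite rnorm_ge0/= (rnormB (v i)); exact: rnorm_dist.
Qed.

Lemma near_cvg (u v : I -> V) (w : V) :
  u i @[i --> F] --> w -> (\forall i \near F, v i = u i) -> v i @[i --> F] --> w.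
Proof.
move=> uw uv; apply: cvg_trans uw; apply: near_eq_cvg.
by apply: filterS uv => i ->.
Qed.

End Cvg.
End Module.

Lemma rcvg_unique (V : normedModType R[i]) (I : Type) (F : set_system I) {FF : ProperFilter F}
  (u : I -> V) (a b : V) : u i @[i --> F] --> a -> u i @[i --> F] --> b -> a = b.
Proof. exact: norm_cvg_unique. Qed.

Lemma rcvgZ (V : normedModType R[i]) (I : Type) (F : set_system I) {FF : Filter F}
    (c_ : I -> CC R) (c : CC R) (v_ : I -> V) (v : V) : c_ i @[i --> F] --> c ->
  v_ i @[i --> F] --> v -> c_ i *: v_ i @[i --> F] --> c *: v.
Proof.
move=> /rcvg0P cc /rcvg0P vv.
apply: (rcvg_squeeze (g := fun i => rnorm (c_ i - c) * (rnorm (v_ i - v) + rnorm v) +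
   rnorm c * rnorm (v_ i - v))); last first.
  rewrite (_ : 0 = 0 * (0 + rnorm v) + rnorm c * 0); last by rewrite mul0r mulr0 addr0.
  apply: cvgD; apply: cvgM => //; try exact: cvg_cst.
  by apply: cvgD => //; exact: cvg_cst.
apply: nearW => i.
have -> : c_ i *: v_ i - c *: v = (c_ i - c) *: v_ i + c *: (v_ i - v).
  by rewrite scalerBl scalerBr addrA subrK.
apply: le_trans (rnormD _ _) _; rewrite !rnormZ lerD2r ler_wpM2l ?rnorm_ge0//.
by apply: le_trans (rnormD _ _); rewrite subrK.
Qed.

Lemma rnormM (a b : CC R) : rnorm (a * b : CC R) = rnorm a * rnorm b.
Proof. by rewrite !rnormcE; exact: Normc.normcM. Qed.

Lemma rcvgM (I : Type) (F : set_system I) {FF : Filter F}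
    (c_ z_ : I -> CC R) (c z : CC R) : c_ i @[i --> F] --> c ->
  z_ i @[i --> F] --> z -> (c_ i * z_ i : CC R) @[i --> F] --> (c * z : CC R).
Proof.
move=> /rcvg0P cc /rcvg0P vv.
apply: (rcvg_squeeze (g := fun i => rnorm (c_ i - c) * (rnorm (z_ i - z) + rnorm z) +
   rnorm c * rnorm (z_ i - z))); last first.
  rewrite (_ : 0 = 0 * (0 + rnorm z) + rnorm c * 0); last by rewrite mul0r mulr0 addr0.
  apply: cvgD; apply: cvgM => //; try exact: cvg_cst.
  by apply: cvgD => //; exact: cvg_cst.
apply: nearW => i.
have -> : c_ i * z_ i - c * z = (c_ i - c) * z_ i + c * (z_ i - z) by ring.
apply: le_trans (rnormD _ _) _; rewrite !rnormM lerD2r ler_wpM2l ?rnorm_ge0//.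
by apply: le_trans (rnormD _ _); rewrite subrK.
Qed.

(** |1 / c - 1| is at most 2 |c - 1| as soon as |c - 1| < 1 / 2. *)
Lemma rcvgV1 (I : Type) (F : set_system I) {FF : Filter F} (c_ : I -> CC R) :
  c_ i @[i --> F] --> (1 : CC R) -> ((c_ i)^-1 : CC R) @[i --> F] --> (1 : CC R).
Proof.
move=> c1; have h2 : 0 < 2^-1 :> R by lra.
apply: (rcvg_squeeze (g := fun i => 2 * rnorm (c_ i - 1))); last first.
  by rewrite -(mulr0 2); apply: cvgM; [exact: cvg_cst|exact/rcvg0P].
apply: filterS ((rcvgP _ _).1 c1 _ h2) => i hi.
have n1 : rnorm (1 : CC R) = 1 by rewrite rnormcE Normc.normc1.
have ci : 2^-1 <= rnorm (c_ i).
  by have := rnormD (1 - c_ i : CC R) (c_ i); rewrite subrK n1 (rnormB (1 : CC R)); lra.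
have ci0 : c_ i != 0 by apply: contraTneq ci => ->; rewrite rnorm0 -ltNge; lra.
have -> : (c_ i)^-1 - 1 = (c_ i)^-1 * (1 - c_ i) by rewrite mulrBr mulr1 mulVf.
rewrite rnormM (rnormB (1 : CC R)) ler_wpM2r ?rnorm_ge0//.
have p0 : 0 < rnorm (c_ i) by lra.
rewrite -(ler_pM2r p0) -rnormM mulVf// n1; lra.
Qed.

End RealNorm.

(** * Integrals of complex functions *)

Section ComplexIntegral.
Context d (T : measurableType d) (R : realType) (mu : {measure set T -> \bar R}).
Implicit Types (f g : T -> CC R) (a z w : R[i]).

Lemma aeS (P Q : T -> Prop) : (forall x, P x -> Q x) ->
  {ae mu, forall x, P x} -> {ae mu, forall x, Q x}.
Proof. by move=> PQ; apply: filterS. Qed.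

Lemma aeS2 (P Q S : T -> Prop) : (forall x, P x -> Q x -> S x) ->
  {ae mu, forall x, P x} -> {ae mu, forall x, Q x} -> {ae mu, forall x, S x}.
Proof. by move=> PQ; apply: filterS2. Qed.

Lemma cReD z w : complex.Re (z + w) = complex.Re z + complex.Re w.
Proof. by case: z; case: w. Qed.

Lemma cImD z w : complex.Im (z + w) = complex.Im z + complex.Im w.
Proof. by case: z; case: w. Qed.

Lemma cReM z w : complex.Re (z * w) =
  complex.Re z * complex.Re w - complex.Im z * complex.Im w.
Proof. by case: z; case: w. Qed.

Lemma cImM z w : complex.Im (z * w) =
  complex.Re z * complex.Im w + complex.Im z * complex.Re w.
Proof. by case: z; case: w. Qed.

Lemma rcD (x y : R) : (x + y)%:C = x%:C + y%:C :> R[i].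
Proof. exact: (rmorphD (real_complex R)). Qed.

Lemma rcM (x y : R) : (x * y)%:C = x%:C * y%:C :> R[i].
Proof. exact: (rmorphM (real_complex R)). Qed.

Lemma conjcM z w : conjc (z * w) = conjc z * conjc w.
Proof. exact: rmorphM. Qed.

Lemma conjcD z w : conjc (z + w) = conjc z + conjc w.
Proof. exact: rmorphD. Qed.

Lemma conjcN z : conjc (- z) = - conjc z.
Proof. exact: rmorphN. Qed.

Lemma complexP z w : complex.Re z = complex.Re w -> complex.Im z = complex.Im w ->
  z = w.
Proof. by case: z; case: w => ? ? ? ? /= -> ->. Qed.

Lemma cintegrableD f g : cintegrable mu f -> cintegrable mu g ->
  cintegrable mu (fun x => f x + g x).
Proof.
move=> [fr fi] [gr gi]; split.
- apply: eq_integrable (integrableD _ fr gr) => // x _ /=; by rewrite -EFinD cReD.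
- apply: eq_integrable (integrableD _ fi gi) => // x _ /=; by rewrite -EFinD cImD.
Qed.

Lemma cintegralD f g : cintegrable mu f -> cintegrable mu g ->
  cintegral mu (fun x => f x + g x) = cintegral mu f + cintegral mu g.
Proof.
move=> [fr fi] [gr gi]; apply: complexP; rewrite ?cReD ?cImD /=.
- by rewrite -RintegralD//; apply: eq_Rintegral => x _; rewrite cReD.
- by rewrite -RintegralD//; apply: eq_Rintegral => x _; rewrite cImD.
Qed.

Lemma cintegrableZ a f : cintegrable mu f -> cintegrable mu (fun x => a * f x).
Proof.
move=> [fr fi]; split.
- apply: eq_integrable (integrableB _ (integrableZl _ (complex.Re a) fr)
    (integrableZl _ (complex.Im a) fi)) => // x _ /=.
  by rewrite cReM EFinB !EFinM.
- apply: eq_integrable (integrableD _ (integrableZl _ (complex.Re a) fi)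
    (integrableZl _ (complex.Im a) fr)) => // x _ /=.
  by rewrite cImM EFinD !EFinM.
Qed.

Lemma cintegralZ a f : cintegrable mu f ->
  cintegral mu (fun x => a * f x) = a * cintegral mu f.
Proof.
move=> [fr fi]; apply: complexP; rewrite ?cReM ?cImM /=.
- rewrite -!RintegralZl// -RintegralB//; last 2 first.
  + exact: (integrableZl _ (complex.Re a) fr).
  + exact: (integrableZl _ (complex.Im a) fi).
  by apply: eq_Rintegral => x _; rewrite cReM.
- rewrite -!RintegralZl// -RintegralD//; last 2 first.
  + exact: (integrableZl _ (complex.Re a) fi).
  + exact: (integrableZl _ (complex.Im a) fr).
  by apply: eq_Rintegral => x _; rewrite cImM.
Qed.

Lemma cintegral_conj f : cintegrable mu f ->
  cintegral mu (fun x => conjc (f x)) = conjc (cintegral mu f).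
Proof.
move=> [fr fi]; apply: complexP => /=.
- by apply: eq_Rintegral => x _; case: (f x).
- rewrite -mulN1r -RintegralZl//; apply: eq_Rintegral => x _.
  by case: (f x) => a b /=; rewrite mulN1r.
Qed.

Lemma ae_eq_cintegral f g : cmeasurable f -> cmeasurable g ->
  {ae mu, forall x, f x = g x} -> cintegral mu f = cintegral mu g.
Proof.
move=> [fr fi] [gr gi] fg; apply: complexP => /=; congr fine;
  (apply: ae_eq_integral => //; [exact/measurable_EFinP|exact/measurable_EFinP|by apply: filterS fg => x ->]).
Qed.

Lemma cmeasurableM f g : cmeasurable f -> cmeasurable g ->
  cmeasurable (fun x => f x * g x).
Proof.
move=> [fr fi] [gr gi]; split.
- rewrite (_ : (fun _ => _) = (fun x => complex.Re (f x) * complex.Re (g x) -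
     complex.Im (f x) * complex.Im (g x))).
    by apply: measurable_funB; exact: measurable_funM.
  by apply/funext => x; rewrite cReM.
- rewrite (_ : (fun _ => _) = (fun x => complex.Re (f x) * complex.Im (g x) +
     complex.Im (f x) * complex.Re (g x))).
    by apply: measurable_funD; exact: measurable_funM.
  by apply/funext => x; rewrite cImM.
Qed.

Lemma cmeasurable_conj f : cmeasurable f -> cmeasurable (fun x => conjc (f x)).
Proof.
move=> [fr fi]; split.
- by rewrite (_ : (fun _ => _) = (fun x => complex.Re (f x)))//; apply/funext => x; case: (f x).
- rewrite (_ : (fun _ => _) = (fun x => - complex.Im (f x))); first exact: measurableT_comp.
  by apply/funext => x; case: (f x).
Qed.

Lemma normc_sqr z : Normc.normc z ^+ 2 = complex.Re z ^+ 2 + complex.Im z ^+ 2.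
Proof. by case: z => a b /=; rewrite sqr_sqrtr// addr_ge0// sqr_ge0. Qed.

Lemma normc_Re z : `|complex.Re z| <= Normc.normc z.
Proof. by have := normc_ge_Re z; rewrite /Num.norm/= lecR. Qed.

Lemma normc_Im z : `|complex.Im z| <= Normc.normc z.
Proof.
case: z => a b /=; rewrite -sqrtr_sqr ler_sqrt ?addr_ge0 ?sqr_ge0//.
by rewrite lerDr sqr_ge0.
Qed.

Lemma normc_conj z : Normc.normc (conjc z) = Normc.normc z.
Proof. by case: z => a b /=; rewrite sqrrN. Qed.

Lemma square_integrableP f : square_integrable mu f <->
  cmeasurable f /\ mu.-integrable setT (fun x => (Normc.normc (f x) ^+ 2)%:E).
Proof.
have Lf : (Lnorm2 mu f `^ 2 = \int[mu]_x (Normc.normc (f x) ^+ 2)%:E)%E.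
  rewrite /Lnorm2 poweR_Lnorm//; apply: eq_integral => x _.
  by rewrite /= ger0_norm ?normc_ge0// powR_mulrn// normc_ge0.
have i0 : (0 <= \int[mu]_x (Normc.normc (f x) ^+ 2)%:E)%E.
  by apply: integral_ge0 => x _; rewrite lee_fin sqr_ge0.
split=> -[mf fin]; split=> //.
- apply/integrableP; split.
    by apply/measurable_EFinP/measurable_funX; exact: cmeasurable_normc.
  under eq_integral do rewrite gee0_abs ?lee_fin ?sqr_ge0//.
  by rewrite -Lf poweR_lty.
- move/integrableP : fin => [_].
  under eq_integral do rewrite gee0_abs ?lee_fin ?sqr_ge0//.
  rewrite -Lf; case: (Lnorm2 mu f) (Lnorm2_ge0 mu f) => [r||]/=.
  - by move=> _ _; rewrite ltry.
  - by move=> _; rewrite pnatr_eq0 ltxx.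
  - by [].
Qed.

Lemma Lnorm2_sqr f : square_integrable mu f ->
  fine (Lnorm2 mu f) ^+ 2 = \int[mu]_x (Normc.normc (f x) ^+ 2).
Proof.
move=> sf; have [mf lf] := sf.
have Lf : (Lnorm2 mu f `^ 2 = \int[mu]_x (Normc.normc (f x) ^+ 2)%:E)%E.
  rewrite /Lnorm2 poweR_Lnorm//; apply: eq_integral => x _.
  by rewrite /= ger0_norm ?normc_ge0// powR_mulrn// normc_ge0.
rewrite /Rintegral -Lf -powR_mulrn; last by rewrite fine_ge0// Lnorm2_ge0.
by case: (Lnorm2 mu f) (Lnorm2_ge0 mu f) lf.
Qed.

(** The product is dominated by |f|^2 + |g|^2. *)
Lemma square_integrableM f g : square_integrable mu f -> square_integrable mu g ->
  cintegrable mu (fun x => f x * g x).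
Proof.
move=> /square_integrableP[mf sf] /square_integrableP[mg sg].
have [mr mi] := cmeasurableM mf mg.
have sfg := integrableD measurableT sf sg.
have bnd x : Normc.normc (f x * g x) <= Normc.normc (f x) ^+ 2 + Normc.normc (g x) ^+ 2.
  rewrite Normc.normcM; have := normc_ge0 (f x); have := normc_ge0 (g x).
  move: (Normc.normc (f x)) (Normc.normc (g x)) => a b b0 a0.
  by nra.
split; apply: le_integrable sfg => //; try exact/measurable_EFinP.
- move=> x _; rewrite -EFinD !abse_EFin lee_fin (le_trans (normc_Re _))// (le_trans (bnd x))//.
  exact: ler_norm.
- move=> x _; rewrite -EFinD !abse_EFin lee_fin (le_trans (normc_Im _))// (le_trans (bnd x))//.
  exact: ler_norm.
Qed.

End ComplexIntegral.

(** * The inner product of L2 *)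

(* Simplification would otherwise replace an inner product by its pair of real
   integrals. *)
Arguments L2_inner : simpl never.

Section InnerProduct.
Context (R : realType).
Local Notation mu := (@lebesgue_measure R).
Local Notation H := (L2R R).
Local Open Scope quotient_scope.
Implicit Types (u v w : H) (a : R[i]) (f g : R -> CC R).

Lemma L2_fun_sq u : square_integrable mu (L2_fun u).
Proof. exact: L2fun_square_integrable. Qed.

Lemma L2_fun_cmeasurable u : cmeasurable (L2_fun u).
Proof. by case: (L2_fun_sq u). Qed.

Lemma L2_funP u v : u = v <-> {ae mu, forall x, L2_fun u x = L2_fun v x}.
Proof. by rewrite -{1}[u]reprK -{1}[v]reprK; exact: L2eqP. Qed.

(** A representative is chosen in each class, so that the algebra of L2 holds for
    representatives only almost everywhere. *)
Lemma L2_fun_toL2 f : square_integrable mu f ->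
  {ae mu, forall x, L2_fun (toL2 f) x = f x}.
Proof.
move=> sf; have pf : f \in @L2fun_pred _ _ R mu by apply/asboolP.
have -> : toL2 f = \pi_H (MkL2fun pf).
  rewrite /toL2; congr (\pi_H _); apply: val_inj => /=.
  exact: (insubdK (0 : L2fun mu) pf).
exact: L2_repr_pi.
Qed.

Lemma toL2P f u : square_integrable mu f ->
  {ae mu, forall x, f x = L2_fun u x} -> toL2 f = u.
Proof.
move=> sf fu; apply/L2_funP; apply: aeS2 (L2_fun_toL2 sf) fu => x -> //.
Qed.

Lemma ae_eq_sq f g : square_integrable mu f -> cmeasurable g ->
  {ae mu, forall x, f x = g x} -> square_integrable mu g.
Proof.
by move=> [mf lf] mg fg; split => //; rewrite -(eq_ae_Lnorm2 mf mg fg).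
Qed.

Lemma L2_fun_lin a u v :
  {ae mu, forall x, L2_fun (a *: u + v) x = a * L2_fun u x + L2_fun v x}.
Proof.
have -> : a *: u + v = \pi_H (a *: (repr u : L2fun mu) + (repr v : L2fun mu)).
  by rewrite L2_piD reprK -[a *: u]/(L2_scale a u).
exact: L2_repr_pi.
Qed.

Lemma L2_fun0 : {ae mu, forall x, L2_fun (0 : H) x = 0}.
Proof.
have := L2_fun_lin (-1) (0 : H) 0; rewrite scaleN1r addrC subr0.
by apply: aeS => x; rewrite mulN1r addNr.
Qed.

Lemma L2_funD u v : {ae mu, forall x, L2_fun (u + v) x = L2_fun u x + L2_fun v x}.
Proof. by have := L2_fun_lin 1 u v; apply: aeS => x; rewrite scale1r mul1r. Qed.

Lemma L2_funZ a u : {ae mu, forall x, L2_fun (a *: u) x = a * L2_fun u x}.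
Proof.
by have := L2_fun_lin a u 0; apply: aeS2 L2_fun0 => x h0; rewrite addr0 h0 addr0.
Qed.

Lemma rnorm_sqr u : rnorm u ^+ 2 = \int[mu]_x (Normc.normc (L2_fun u x) ^+ 2).
Proof. by rewrite -Lnorm2_sqr//; exact: L2_fun_sq. Qed.

Lemma sq_conj f : square_integrable mu f ->
  square_integrable mu (fun x => conjc (f x)).
Proof.
move=> /square_integrableP[mf sf]; apply/square_integrableP.
split; first exact: cmeasurable_conj.
by apply: eq_integrable sf => // x _; rewrite normc_conj.
Qed.

Lemma inner_cintegrable u v :
  cintegrable mu (fun x => L2_fun u x * conjc (L2_fun v x)).
Proof. by apply: square_integrableM; [|apply: sq_conj]; exact: L2_fun_sq. Qed.

Lemma innerDl u v w : L2_inner (u + v) w = L2_inner u w + L2_inner v w.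
Proof.
rewrite /L2_inner -cintegralD; [|exact: inner_cintegrable..].
have mw := cmeasurable_conj (L2_fun_cmeasurable w).
apply: ae_eq_cintegral.
- exact/cmeasurableM/mw/L2_fun_cmeasurable.
- by apply: cmeasurableD; exact/cmeasurableM/mw/L2_fun_cmeasurable.
- by apply: aeS (L2_funD u v) => x ->; rewrite mulrDl.
Qed.

Lemma innerZl a u w : L2_inner (a *: u) w = a * L2_inner u w.
Proof.
rewrite /L2_inner -cintegralZ; [|exact: inner_cintegrable..].
have mw := cmeasurable_conj (L2_fun_cmeasurable w).
apply: ae_eq_cintegral.
- exact/cmeasurableM/mw/L2_fun_cmeasurable.
- by apply: cmeasurableZ; exact/cmeasurableM/mw/L2_fun_cmeasurable.
- by apply: aeS (L2_funZ a u) => x ->; rewrite mulrA.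
Qed.

Lemma innerC u v : L2_inner v u = conjc (L2_inner u v).
Proof.
rewrite /L2_inner -cintegral_conj; last exact: inner_cintegrable.
by congr cintegral; apply/funext => x; rewrite conjcM conjcK mulrC.
Qed.

Lemma innerDr u v w : L2_inner w (u + v) = L2_inner w u + L2_inner w v.
Proof. by rewrite innerC innerDl conjcD -!innerC. Qed.

Lemma innerZr a u w : L2_inner w (a *: u) = conjc a * L2_inner w u.
Proof. by rewrite innerC innerZl conjcM -!innerC. Qed.

Lemma innerNl u w : L2_inner (- u) w = - L2_inner u w.
Proof. by rewrite -scaleN1r innerZl mulN1r. Qed.

Lemma innerNr u w : L2_inner w (- u) = - L2_inner w u.
Proof. by rewrite innerC innerNl conjcN -innerC. Qed.

Lemma innerBl u v w : L2_inner (u - v) w = L2_inner u w - L2_inner v w.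
Proof. by rewrite innerDl innerNl. Qed.

Lemma innerBr u v w : L2_inner w (u - v) = L2_inner w u - L2_inner w v.
Proof. by rewrite innerDr innerNr. Qed.

Lemma inner0l w : L2_inner 0 w = 0.
Proof. by rewrite -(scale0r (0 : H)) innerZl mul0r. Qed.

Lemma inner0r w : L2_inner w 0 = 0.
Proof. by rewrite innerC inner0l conjc0. Qed.

Lemma inner_norm u : L2_inner u u = (rnorm u ^+ 2)%:C.
Proof.
rewrite rnorm_sqr; apply: complexP => /=.
- by apply: eq_Rintegral => x _; rewrite normc_sqr cReM; case: (L2_fun u x) => a b /=; rewrite mulrN opprK.
- rewrite (_ : (fun _ => _) = (fun=> 0)) ?Rintegral0 //.
    by rewrite /Rintegral integral0.
  by apply/funext => x; rewrite cImM; case: (L2_fun u x) => a b /=; rewrite mulrN mulrC addNr.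
Qed.

Lemma normc_sqrE z : (Normc.normc z ^+ 2)%:C = z * conjc z :> R[i].
Proof. by rewrite -sqr_normc rmorphXn. Qed.

(** Expand the square of the norm of |v|^2 u - <u, v> v. *)
Lemma cauchy_schwarz u v : Normc.normc (L2_inner u v) <= rnorm u * rnorm v.
Proof.
set c := L2_inner u v; set U := rnorm u; set W := rnorm v.
have U0 : 0 <= U by exact: rnorm_ge0.
have W0 : 0 <= W by exact: rnorm_ge0.
have C0 := normc_ge0 c.
have [W00|Wn0] := eqVneq W 0.
  have v0 : v = 0 by exact: rnorm0_eq0.
  by rewrite /c v0 inner0r Normc.normc0 mulr_ge0.
have WW : 0 < W ^+ 2 by rewrite exprn_gt0// lt0r Wn0.
pose w := (W ^+ 2)%:C *: u - c *: v.
have : 0 <= rnorm w ^+ 2 by rewrite sqr_ge0.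
have -> : rnorm w ^+ 2 = W ^+ 2 * ((U * W) ^+ 2 - Normc.normc c ^+ 2).
  apply: (@complexI R); rewrite -inner_norm /w innerBl !innerBr !innerZl !innerZr.
  rewrite (innerC u v) -/c !inner_norm -/U -/W conjc_real.
  have -> : (W ^+ 2 * ((U * W) ^+ 2 - Normc.normc c ^+ 2))%:C =
      (W ^+ 2)%:C * ((U ^+ 2)%:C * (W ^+ 2)%:C - c * conjc c).
    by rewrite -normc_sqrE -rmorphM -rmorphB -rmorphM exprMn.
  by ring.
rewrite pmulr_rge0// subr_ge0.
by rewrite ler_sqr ?nnegrE// mulr_ge0.
Qed.

Lemma inner_ext u v : (forall w, L2_inner w u = L2_inner w v) -> u = v.
Proof.
move=> h; apply/eqP; rewrite -subr_eq0; apply/eqP/rnorm0_eq0.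
have := inner_norm (u - v); rewrite {1}innerBr h subrr => -[] /esym/eqP.
by rewrite sqrf_eq0 => /eqP.
Qed.

Lemma parallelogram u v :
  rnorm (u + v) ^+ 2 + rnorm (u - v) ^+ 2 = 2 * rnorm u ^+ 2 + 2 * rnorm v ^+ 2.
Proof.
apply: (@complexI R).
have -> : (2 * rnorm u ^+ 2 + 2 * rnorm v ^+ 2)%:C =
    2 * (rnorm u ^+ 2)%:C + 2 * (rnorm v ^+ 2)%:C :> R[i].
  by rewrite -(rmorph_nat (real_complex R)) -!rmorphM -rmorphD.
rewrite rcD -!inner_norm innerBl !innerBr innerDl !innerDr.
by ring.
Qed.

End InnerProduct.

(** * Completeness of L2 *)

Section Completeness.
Context (R : realType).
Local Notation mu := (@lebesgue_measure R).
Local Notation H := (L2R R).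

(** Used pointwise for the real and imaginary parts of the representatives. *)
Lemma geometric_cvgn (a : nat -> R) (B q : R) : 0 < q < 1 ->
  (forall k, `|a k.+1 - a k| <= B * q ^+ k) -> cvgn a.
Proof.
move=> /andP[q0 q1] ha.
have B0 : 0 <= B by have := ha 0%N; rewrite expr0 mulr1; exact: le_trans.
have st : cvgn (series (telescope a)).
  apply: normed_cvg; apply: (@series_le_cvg _ _ (geometric B q)).
  - by move=> n; exact: normr_ge0.
  - by move=> n; rewrite /geometric/= mulr_ge0// exprn_ge0// ltW.
  - by move=> n; exact: ha.
  - by apply: is_cvg_geometric_series; rewrite gtr0_norm.
have -> : a = (fun n => a 0%N + series (telescope a) n).
  by apply/funext => n; rewrite -eq_sum_telescope.
by apply: is_cvgD => //; exact: is_cvg_cst.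
Qed.

Lemma sq_funB (u v : H) : square_integrable mu (fun x => L2_fun u x - L2_fun v x).
Proof.
have mu' := L2_fun_cmeasurable u; have mv := L2_fun_cmeasurable v.
have suv := L2_fun_sq (u - v).
have muv : cmeasurable (fun x => L2_fun u x - L2_fun v x).
  have := cmeasurableD mu' (cmeasurableZ (-1) mv).
  by rewrite (_ : _ + _ = (fun x => L2_fun u x - L2_fun v x))//; apply/funext => x /=;
    rewrite fctE scaleN1r.
split=> //; rewrite -(@eq_ae_Lnorm2 _ _ _ mu (L2_fun (u - v)))//; first by case: suv.
  by case: suv.
have := L2_fun_lin (-1) v u; apply: aeS => x.
by rewrite scaleN1r addrC => ->; rewrite mulN1r addrC.
Qed.

Lemma rnormB_sqr (u v : H) :
  rnorm (u - v) ^+ 2 = \int[mu]_x (Normc.normc (L2_fun u x - L2_fun v x) ^+ 2).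
Proof.
rewrite -(Lnorm2_sqr (sq_funB u v)) -[rnorm _]/(fine (Lnorm2 mu (L2_fun (u - v)))).
congr (fine _ ^+ 2); apply: eq_ae_Lnorm2.
- exact: L2_fun_cmeasurable.
- by case: (sq_funB u v).
have := L2_fun_lin (-1) v u; apply: aeS => x.
by rewrite scaleN1r addrC => ->; rewrite mulN1r addrC.
Qed.

Variables (u : nat -> H) (C : R).
Hypothesis uC : forall k, rnorm (u k.+1 - u k) <= C * 2^-1 ^+ k.

Let D k x := Normc.normc (L2_fun (u k.+1) x - L2_fun (u k) x).

Let mD k : measurable_fun setT (D k).
Proof. by apply: cmeasurable_normc; case: (sq_funB (u k.+1) (u k)). Qed.

(* The weights (9 / 4)^k grow fast enough to make the increments O((2 / 3)^k) where
   the series is finite, and slowly enough for the series to be integrable, as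
   (9 / 4) * (1 / 2)^2 < 1. *)
Let S x := (\sum_(0 <= k <oo) ((9 / 4) ^+ k * D k x ^+ 2)%:E)%E.

Let t0 k x : (0 <= ((9 / 4) ^+ k * D k x ^+ 2)%:E)%E.
Proof. by rewrite lee_fin mulr_ge0// ?sqr_ge0// exprn_ge0// divr_ge0. Qed.

Let mt k : measurable_fun setT (fun x => ((9 / 4) ^+ k * D k x ^+ 2)%:E).
Proof. by apply/measurable_EFinP/measurable_funM => //; exact: measurable_funX. Qed.

Let mD2 k : measurable_fun setT (fun x => (D k x ^+ 2)%:E).
Proof. by apply/measurable_EFinP; exact: measurable_funX. Qed.

Let mS : measurable_fun setT S.
Proof.
by apply: ge0_emeasurable_sum => // k _.
Qed.

Lemma weighted_increments_finite : {ae mu, forall x, S x \is a fin_num}.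
Proof.
have S0 x : (0 <= S x)%E by apply: nneseries_ge0 => k _ _; exact: t0.
have iS : mu.-integrable setT S.
  apply/integrableP; split => //.
  under eq_integral do rewrite gee0_abs//.
  rewrite /S integral_nneseries//.
  apply: (@le_lt_trans _ _ (\sum_(0 <= k <oo) (geometric (C ^+ 2) (9 / 16) k)%:E)%E).
    apply: lee_nneseries => [k _ _|k _]; first by apply: integral_ge0 => x _; exact: t0.
    under eq_integral do rewrite EFinM.
    rewrite ge0_integralZl//; last 2 first.
    - exact: mD2.
    - by move=> x _; rewrite lee_fin sqr_ge0.
    have /square_integrableP[_ iD] := sq_funB (u k.+1) (u k).
    have <- : (\int[mu]_x (D k x ^+ 2))%:E = (\int[mu]_x (D k x ^+ 2)%:E)%E.
      by rewrite fineK//; exact: integrable_fin_num.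
    rewrite -EFinM lee_fin -rnormB_sqr /geometric/=.
    have -> : (9 / 16) ^+ k = (9 / 4) ^+ k * (2^-1 ^+ k) ^+ 2 :> R.
      by rewrite -exprM mulnC exprM -exprMn; congr (_ ^+ _); field.
    rewrite [leRHS]mulrCA; apply: ler_wpM2l; first by rewrite exprn_ge0// divr_ge0.
    by rewrite -exprMn lerXn2r ?nnegrE ?rnorm_ge0// (le_trans _ (uC k))// rnorm_ge0.
  have g : `|9 / 16 : R| < 1 by rewrite gtr0_norm; lra.
  rewrite (_ : limn _ = (C ^+ 2 * (1 - 9 / 16)^-1)%:E) ?ltry//.
  apply/cvg_lim => //.
  rewrite (_ : (fun _ => _) = EFin \o series (geometric (C ^+ 2) (9 / 16))).
    by apply: cvg_EFin; [exact: nearW|exact: cvg_geometric_series].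
  by apply/funext => n /=; rewrite sumEFin.
have := integrable_ae measurableT iS.
by apply: aeS => x; exact.
Qed.

(* The representatives are set to 0 off the set A of the points where the
   weighted series of squared increments is finite: there they converge. *)
Let A := [set x | S x \is a fin_num].

Let mA : measurable A.
Proof. by rewrite -[A]setTI; exact: emeasurable_fin_num. Qed.

Let g k x : CC R := (\1_A x)%:C * L2_fun (u k) x.

Let mg k : cmeasurable (g k).
Proof.
apply: cmeasurableM; last exact: L2_fun_cmeasurable.
by split; [exact: measurable_indic|exact: measurable_cst].
Qed.

Let g_in k x : A x -> g k x = L2_fun (u k) x.
Proof. by move=> Ax; rewrite /g indicE mem_set//; exact: mul1r. Qed.

Let g_out k x : ~ A x -> g k x = 0.
Proof. by move=> Ax; rewrite /g indicE memNset//; exact: mul0r. Qed.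

Let gE k : {ae mu, forall x, g k x = L2_fun (u k) x}.
Proof.
by apply: aeS weighted_increments_finite => x; exact: g_in.
Qed.

Let g_incr x : exists B, forall k, Normc.normc (g k.+1 x - g k x) <= B * (2 / 3) ^+ k.
Proof.
have [Ax|nAx] := pselect (A x); last first.
  by exists 0 => k; rewrite !g_out// subrr Normc.normc0 mul0r.
exists (Num.sqrt (fine (S x))) => k; rewrite !g_in// -/(D k x).
have : (((9 / 4) ^+ k * D k x ^+ 2)%:E <= S x)%E.
  apply: le_trans (nneseries_lim_ge k.+1 _); last by move=> *; exact: t0.
  by rewrite big_nat_recr//= leeDr// sume_ge0// => i _; exact: t0.
have S0 : (0 <= S x)%E by apply: nneseries_ge0 => j _ _; exact: t0.
rewrite -[S x]fineK// lee_fin => h.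
have q0 : 0 < (2 / 3 : R) ^+ k by rewrite exprn_gt0.
rewrite -ler_pdivrMr//.
have -> : D k x / (2 / 3) ^+ k = Num.sqrt ((9 / 4) ^+ k * D k x ^+ 2).
  rewrite -[LHS]ger0_norm; last by rewrite divr_ge0 ?normc_ge0// ltW.
  rewrite -sqrtr_sqr exprMn mulrC -exprVn -exprM mulnC exprM.
  by congr (Num.sqrt (_ ^+ _ * _)); field.
exact: ler_wsqrtr.
Qed.

Let gl x : CC R := limn (fun k => complex.Re (g k x)) +i* limn (fun k => complex.Im (g k x)).

Let g_cvg x : (complex.Re (g k x) @[k --> \oo] --> complex.Re (gl x)) /\
  (complex.Im (g k x) @[k --> \oo] --> complex.Im (gl x)).
Proof.
have [B hB] := g_incr x.
have cRI (f : R[i] -> R) : (forall z w, f (z - w) = f z - f w) ->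
    (forall z, `|f z| <= Normc.normc z) -> cvgn (fun k => f (g k x)).
  move=> fB fn; apply: (@geometric_cvgn _ B (2 / 3)); first lra.
  by move=> k; rewrite -fB (le_trans (fn _)).
split; apply: cRI.
- by case=> a b [c e].
- exact: normc_Re.
- by case=> a b [c e].
- exact: normc_Im.
Qed.

Let mgl : cmeasurable gl.
Proof.
split.
- apply: (measurable_fun_cvg (h := fun k x => complex.Re (g k x))) => [k|x _].
    by case: (mg k).
  by case: (g_cvg x).
- apply: (measurable_fun_cvg (h := fun k x => complex.Im (g k x))) => [k|x _].
    by case: (mg k).
  by case: (g_cvg x).
Qed.

Let u_tail m k : rnorm (u (m + k)%N - u m) <= 2 * C * 2^-1 ^+ m.
Proof.
have C0 : 0 <= C by have := uC 0; rewrite expr0 mulr1; apply: le_trans; exact: rnorm_ge0.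
suff : rnorm (u (m + k)%N - u m) <= 2 * C * 2^-1 ^+ m * (1 - 2^-1 ^+ k).
  move/le_trans; apply; apply: ler_piMr; first by rewrite !mulr_ge0// exprn_ge0.
  by rewrite gerBl exprn_ge0.
elim: k => [|k ih]; first by rewrite addn0 subrr rnorm0 expr0 subrr mulr0.
rewrite addnS; apply: le_trans (rnorm_dist _ _ (u (m + k)%N)) _.
apply: le_trans (lerD (uC _) ih) _.
rewrite exprD exprS; set p := _ ^+ m; set q := _ ^+ k.
by rewrite le_eqVlt; apply/orP; left; apply/eqP; field.
Qed.

Let fatou_tail m : (\int[mu]_x (Normc.normc (gl x - g m x) ^+ 2)%:E <=
  ((2 * C * 2^-1 ^+ m) ^+ 2)%:E)%E.
Proof.
pose F k x := (Normc.normc (g (m + k)%N x - g m x) ^+ 2)%:E.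
have -> : (fun x => (Normc.normc (gl x - g m x) ^+ 2)%:E) = (fun x => limn_einf (F ^~ x)).
  apply/funext => x; apply/esym/(cvg_limn_einf_sup _).1.
  apply: cvg_EFin; first exact: nearW.
  rewrite normc_sqr.
  rewrite (_ : _ \o _ = fun k => (complex.Re (g (m + k)%N x) - complex.Re (g m x)) ^+ 2 +
     (complex.Im (g (m + k)%N x) - complex.Im (g m x)) ^+ 2); last first.
    by apply/funext => k /=; rewrite normc_sqr; case: (g _ x) => a b; case: (g m x).
  have [cr ci] := g_cvg x.
  have -> : gl x - g m x = (complex.Re (gl x) - complex.Re (g m x)) +i*
     (complex.Im (gl x) - complex.Im (g m x)).
    by case: (gl x) => a b; case: (g m x).
  have sq (a : nat -> R) l c : a n @[n --> \oo] --> l ->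
      (a (m + k)%N - c) ^+ 2 @[k --> \oo] --> (l - c) ^+ 2.
    move=> al; have h : a (m + k)%N - c @[k --> \oo] --> l - c.
      apply: cvgB; last exact: cvg_cst.
      by apply: (cvg_comp _ _ (cvg_addnl m) al).
    by rewrite expr2; under eq_fun do rewrite expr2; exact: cvgM.
  exact: cvgD (sq _ _ _ cr) (sq _ _ _ ci).
have mF k : measurable_fun setT (F k).
  apply/measurable_EFinP/measurable_funX; apply: cmeasurable_normc.
  have := cmeasurableD (mg (m + k)%N) (cmeasurableZ (-1) (mg m)).
  by congr cmeasurable; apply/funext => x; rewrite fctE/= scaleN1r.
apply: le_trans (fatou mu measurableT mF _) _.
  by move=> k x _; rewrite lee_fin sqr_ge0.
rewrite limn_einf_lim; apply: lime_le; first exact: is_cvg_einfs.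
apply: nearW => k.
apply: le_trans (ereal_inf_lbound (_ : _ (\int[mu]_x F k x)%E)) _; first by exists k => /=.
have /square_integrableP[_ iD] := sq_funB (u (m + k)%N) (u m).
have -> : (\int[mu]_x F k x = (rnorm (u (m + k)%N - u m) ^+ 2)%:E)%E.
  rewrite rnormB_sqr fineK; last exact: integrable_fin_num.
  apply: ae_eq_integral => //.
  - exact: mF.
  - by case/integrableP: iD.
  - by apply: aeS2 (gE (m + k)%N) (gE m) => x e1 e2 _; rewrite /F e1 e2.
by rewrite lee_fin lerXn2r ?nnegrE ?rnorm_ge0// (le_trans _ (u_tail m k))// rnorm_ge0.
Qed.

Let sq_tail m : square_integrable mu (fun x => gl x - g m x).
Proof.
have mB : cmeasurable (fun x => gl x - g m x).
  have := cmeasurableD mgl (cmeasurableZ (-1) (mg m)).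
  by congr cmeasurable; apply/funext => x; rewrite fctE/= scaleN1r.
apply/square_integrableP; split => //; apply/integrableP; split.
  by apply/measurable_EFinP/measurable_funX; exact: cmeasurable_normc.
under eq_integral do rewrite gee0_abs ?lee_fin ?sqr_ge0//.
by apply: le_lt_trans (fatou_tail m) _; rewrite ltry.
Qed.

(** The completeness of L2, for sequences with geometric increments; iterations and
    minimizing sequences can be given such increments.  The representatives
    converge almost everywhere, and Fatou's lemma bounds the distance of their
    limit to each term. *)
Lemma L2_geometric_cvg : exists v : H, u k @[k --> \oo] --> v.
Proof.
have sgl : square_integrable mu gl.
  split; first exact: mgl.
  have sg0 : square_integrable mu (g 0%N).
    by apply: (ae_eq_sq (L2_fun_sq (u 0%N)) (mg 0%N)); apply: aeS (gE 0%N) => x ->.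
  have -> : gl = (fun x => gl x - g 0%N x) + g 0%N.
    by apply/funext => x; rewrite fctE subrK.
  have [m1 l1] := sq_tail 0%N; have [m2 l2] := sg0.
  by apply: le_lt_trans (Lnorm2D mu m1 m2) _; rewrite lte_add_pinfty.
exists (toL2 gl); apply: (rcvg_squeeze (g := fun m => 2 * C * 2^-1 ^+ m)).
  apply: nearW => m.
  have C0 : 0 <= C by have := uC 0; rewrite expr0 mulr1; apply: le_trans; exact: rnorm_ge0.
  rewrite -ler_sqr ?nnegrE ?rnorm_ge0// ?mulr_ge0// ?exprn_ge0//.
  rewrite rnormB rnormB_sqr -lee_fin; apply: le_trans (fatou_tail m).
  have [_ i1] := (square_integrableP mu _).1 (sq_funB (toL2 gl) (u m)).
  have [_ i2] := (square_integrableP mu _).1 (sq_tail m).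
  rewrite fineK; last exact: integrable_fin_num.
  rewrite le_eqVlt; apply/orP; left; apply/eqP; apply: ae_eq_integral => //.
  - by case/integrableP: i1.
  - by case/integrableP: i2.
  - by apply: aeS2 (gE m) (L2_fun_toL2 sgl) => x e1 e2 _; rewrite e1 e2.
by apply: (@cvg_geometric R (2 * C)); rewrite gtr0_norm; lra.
Qed.

End Completeness.

(** * The Riesz representation theorem *)

Section LinearMaps.
Context (R : realType) (U V : lmodType R[i]) (S : U -> V).
Hypothesis lS : linear S.

Lemma lin0 : S 0 = 0.
Proof.
by have := lS (-1) 0 0; rewrite scaler0 addr0 scaleN1r addNr.
Qed.

Lemma linD u v : S (u + v) = S u + S v.
Proof. by have := lS 1 u v; rewrite !scale1r. Qed.

Lemma linZ a u : S (a *: u) = a *: S u.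
Proof. by have := lS a u 0; rewrite !addr0 lin0 addr0. Qed.

Lemma linN u : S (- u) = - S u.
Proof. by rewrite -scaleN1r linZ scaleN1r. Qed.

Lemma linB u v : S (u - v) = S u - S v.
Proof. by rewrite linD linN. Qed.

End LinearMaps.

Section HilbertOperators.
Context (R : realType).
Local Notation H := (L2R R).
Implicit Types (S Q : H -> H) (M : R) (l : CC R) (f g h x y : H).

Section Riesz.
Variables (phi : H -> CC R) (M : R).
Hypothesis lphi : linear phi.
Hypothesis phiM : forall v, Normc.normc (phi v) <= M * rnorm v.

Let J v := rnorm v ^+ 2 - 2 * complex.Re (phi v).

Let J_lb v : - M ^+ 2 <= J v.
Proof.
have h : complex.Re (phi v) <= M * rnorm v.
  by apply: le_trans (phiM v); apply: le_trans (normc_Re _); exact: ler_norm.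
have := sqr_ge0 (rnorm v - M); rewrite /J; nra.
Qed.

Let infJ := inf (range J).

Let inf_le v : infJ <= J v.
Proof. by apply: ge_inf; [exists (- M ^+ 2) => _ [w _ <-]|exists v]. Qed.

Let minimizing n : exists v, J v <= infJ + (2^-1 ^+ n) ^+ 2.
Proof.
have e0 : 0 < ((2^-1 : R) ^+ n) ^+ 2 by rewrite !exprn_gt0.
have hi : has_inf (range J).
  by split; [exists (J 0), 0|exists (- M ^+ 2) => _ [w _ <-]].
by have [_ [v _ <-] /ltW] := inf_adherent e0 hi; exists v.
Qed.

Let rnormD_sqr (v w : H) : rnorm (v + w) ^+ 2 =
  rnorm v ^+ 2 + rnorm w ^+ 2 + 2 * complex.Re (L2_inner w v).
Proof.
have -> : rnorm (v + w) ^+ 2 = complex.Re (L2_inner (v + w) (v + w)).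
  by rewrite inner_norm.
rewrite innerDl !innerDr !inner_norm !cReD (innerC w v).
by case: (L2_inner w v) => a b /=; ring.
Qed.

(** A minimizing sequence of |v|^2 - 2 Re (phi v) is Cauchy by the
    parallelogram identity, and its limit is a critical point. *)
Lemma riesz : exists h : H, forall v : H, phi v = L2_inner v h.
Proof.
have [v_ hv] := choice minimizing.
have J2 v w : rnorm (v - w) ^+ 2 = 2 * (J v + J w) - 4 * J (2^-1%:C *: (v + w)).
  have := parallelogram v w; rewrite /J (linZ lphi) (linD lphi) rnormZ rnormcE.
  have -> : Normc.normc (2^-1%:C : R[i]) = 2^-1.
    by rewrite /= expr0n addr0 sqrtr_sqr ger0_norm.
  have -> : complex.Re (2^-1%:C *: (phi v + phi w)) =
      2^-1 * (complex.Re (phi v) + complex.Re (phi w)).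
    by rewrite cReM/= mul0r subr0 cReD.
  rewrite exprMn; move: (rnorm (v + w) ^+ 2) => a ha.
  rewrite (_ : _ ^+ 2 = 2 * rnorm v ^+ 2 + 2 * rnorm w ^+ 2 - a); last lra.
  by field.
have [k|h vh] := @L2_geometric_cvg R v_ 2.
  (* J at the midpoint is at least inf J, hence |v_(k+1) - v_k|^2 <= 4 * 4^-k. *)
  have p0 : 0 <= (2^-1 : R) ^+ k by rewrite exprn_ge0.
  rewrite -ler_sqr ?nnegrE ?rnorm_ge0// ?mulr_ge0// J2.
  have := hv k; have := hv k.+1; have := inf_le (2^-1%:C *: (v_ k.+1 + v_ k)).
  rewrite exprMn (exprS _ k) (exprMn _ 2^-1) expr2; set p := _ ^+ k; nra.
have vh0 : rnorm (v_ n - h) @[n --> \oo] --> (0 : R) by exact/rcvg0P.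
have crit w : complex.Re (phi w) = complex.Re (L2_inner w h).
  apply/eqP; rewrite -subr_eq0 -normr_le0.
  have g0 : 2^-1 ^+ n * (1 + rnorm w ^+ 2) + rnorm w * rnorm (v_ n - h) @[n --> \oo] --> (0 : R).
    rewrite (_ : 0 = 0 * (1 + rnorm w ^+ 2) + rnorm w * 0); last by rewrite mul0r mulr0 addr0.
    apply: cvgD; first apply: cvgM; last 2 first.
    - exact: cvg_cst.
    - by apply: cvgM => //; exact: cvg_cst.
    have := @cvg_geometric R 1 2^-1; rewrite gtr0_norm ?invr_gt0// => /(_ _).
    by rewrite -exprn_geometric; apply; lra.
  rewrite -(cvg_lim _ g0)//; apply: limr_ge; first by apply/cvg_ex; exists 0.
  apply: nearW => n.
  have -> : complex.Re (phi w) - complex.Re (L2_inner w h) =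
    (complex.Re (phi w) - complex.Re (L2_inner w (v_ n))) + complex.Re (L2_inner w (v_ n - h)).
    by rewrite innerBr cReD; case: (L2_inner w h) => a b /=; ring.
  apply: le_trans (ler_normD _ _) _; apply: lerD; last first.
    by apply: le_trans (normc_Re _) _; exact: cauchy_schwarz.
  set p := 2^-1 ^+ n; have p0 : 0 < p by rewrite exprn_gt0.
  (* v_n minimizes J up to p^2, also along the line v_n + t w; the choice t = p and
     t = - p bounds the derivative of J at v_n in the direction w. *)
  have var (t : R) : 0 <= p ^+ 2 + t ^+ 2 * rnorm w ^+ 2 +
      2 * t * (complex.Re (L2_inner w (v_ n)) - complex.Re (phi w)).
    have := le_trans (hv n) (lerD (inf_le (v_ n + t%:C *: w)) (lexx _)).
    rewrite -/p /J rnormD_sqr (linD lphi) (linZ lphi) rnormZ innerZl rnormcE cReD !cReM/=.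
    rewrite expr0n addr0 sqrtr_sqr.
    rewrite exprMn real_normK ?num_real//; nra.
  have := var p; have := var (- p).
  move: (rnorm w ^+ 2) (sqr_ge0 (rnorm w)) => W W0.
  set a := complex.Re (L2_inner w (v_ n)); set b := complex.Re (phi w) => h1 h2.
  rewrite ler_norml; apply/andP; split.
  - rewrite -(ler_pM2l p0); nra.
  - rewrite -(ler_pM2l p0); nra.
exists h => v; apply: complexP; first exact: crit.
(* The imaginary part of phi v is minus the real part of phi (i v). *)
have := crit ('i *: v); rewrite (linZ lphi) innerZl !cReM /= !mul0r !sub0r !mul1r.
exact: oppr_inj.
Qed.

End Riesz.

End HilbertOperators.

(** * Bounded operators, adjoints and inverses *)

Section BoundedOperators.
Context (R : realType).
Local Notation H := (L2R R).
Implicit Types (S Q : H -> H) (M : R) (l : CC R) (f g h x y : H).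

(** The bound is kept as an argument, because uniform bounds of families of
    operators matter everywhere below. *)
Definition opbound M S := [/\ linear S, 0 <= M & forall f, rnorm (S f) <= M * rnorm f].

Lemma bounded_operatorP S : bounded_operator S <-> exists M, opbound M S.
Proof.
split=> [[lS [M hM]]|[M [lS _ hM]]]; last by split => //; exists M.
exists (Num.max M 0); split => //; first by rewrite le_max lexx orbT.
by move=> f; apply: le_trans (hM f) _; rewrite ler_wpM2r ?rnorm_ge0// le_max lexx.
Qed.

Lemma opbound_comp M1 M2 S1 S2 : opbound M1 S1 -> opbound M2 S2 ->
  opbound (M1 * M2) (S1 \o S2).
Proof.
move=> [l1 p1 h1] [l2 p2 h2]; split; last first.
- move=> f /=; apply: le_trans (h1 _) _; rewrite -mulrA ler_wpM2l//.
- by rewrite mulr_ge0.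
- by move=> a u v /=; rewrite l2 l1.
Qed.

Lemma opbound_cvg M S (I : Type) (F : set_system I) {FF : Filter F} (u : I -> H) v :
  opbound M S -> u i @[i --> F] --> v -> S (u i) @[i --> F] --> S v.
Proof.
move=> [lS M0 hS] /rcvg0P uv; apply: (rcvg_squeeze (g := fun i => M * rnorm (u i - v))).
  by apply: nearW => i; rewrite -(linB lS).
by rewrite -(mulr0 M); apply: cvgM => //; exact: cvg_cst.
Qed.

Definition adjoint S S' := forall f g, L2_inner (S f) g = L2_inner f (S' g).

(** The Riesz theorem represents the functionals f |-> <S f, g>. *)
Lemma adjoint_exists M S : opbound M S -> exists S', adjoint S S' /\ opbound M S'.
Proof.
move=> [lS M0 hS].
have ex g : exists h : H, forall f : H, L2_inner (S f) g = L2_inner f h.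
  apply: (@riesz _ (fun f => L2_inner (S f) g) (M * rnorm g)).
  - by move=> a u v; rewrite lS innerDl innerZl.
  - move=> v; apply: le_trans (cauchy_schwarz _ _) _.
    by rewrite mulrAC ler_wpM2r ?rnorm_ge0.
have [S' hS'] := choice ex; exists S'; split; first by move=> f g; exact: hS'.
split => //.
  by move=> a u v; apply: inner_ext => w; rewrite -hS' !innerDr !innerZr -!hS'.
move=> g; have [->|n0] := eqVneq (rnorm (S' g)) 0; first by rewrite mulr_ge0 ?rnorm_ge0.
have p0 : 0 < rnorm (S' g) by rewrite lt0r n0 rnorm_ge0.
rewrite -(ler_pM2l p0) -expr2.
have -> : rnorm (S' g) ^+ 2 = Normc.normc (L2_inner (S (S' g)) g).
  by rewrite hS' inner_norm /= expr0n addr0 sqrtr_sqr ger0_norm// sqr_ge0.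
apply: le_trans (cauchy_schwarz _ _) _.
by rewrite mulrA [_ * M]mulrC ler_wpM2r ?rnorm_ge0.
Qed.

Definition bounded_inverse M S l Q := opbound M Q /\
  forall f, Q (f - l *: S f) = f /\ Q f - l *: S (Q f) = f.

Lemma bounded_inverseP S l Q : inverse_of_id_sub S l Q <-> exists M, bounded_inverse M S l Q.
Proof.
split=> [[/bounded_operatorP[M hM] h]|[M [hM h]]]; first by exists M.
by split => //; apply/bounded_operatorP; exists M.
Qed.

Lemma inverse_unique S l Q1 Q2 : inverse_of_id_sub S l Q1 ->
  inverse_of_id_sub S l Q2 -> Q1 = Q2.
Proof.
move=> [_ h1] [_ h2]; apply/funext => f.
by rewrite -{1}(h2 f).2 (h1 _).1.
Qed.

Lemma resolventE S l Q : inverse_of_id_sub S l Q -> resolvent S l = Q.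
Proof.
move=> h; rewrite /resolvent; case: xgetP => [Q' _ h'|/(_ Q)//].
exact: inverse_unique h' h.
Qed.

(** Taking adjoints reverses the order of a product, and I - l S commutes with its
    inverse. *)
Lemma adjoint_inverse M S l Q S' Q' : bounded_inverse M S l Q -> adjoint S S' ->
  adjoint Q Q' -> opbound M Q' -> bounded_inverse M S' (conjc l) Q'.
Proof.
move=> [[lQ _ _] h] aS aQ bQ; split=> // f; split; apply: inner_ext => w.
- by rewrite -aQ innerBr innerZr conjcK -aS -innerZl -innerBl (h w).2.
- rewrite innerBr innerZr conjcK -aS -!aQ -innerZl -innerBl.
  by rewrite -(linZ lQ) -(linB lQ) (h w).1.
Qed.

(** The Banach fixed point argument for x = f + E x. *)
Lemma contraction_solve E : linear E -> (forall x, rnorm (E x) <= 2^-1 * rnorm x) ->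
  forall f, exists x, x - E x = f.
Proof.
move=> lE hE f; pose x_ k := iter k (fun x => f + E x) f.
have E_bd : opbound 2^-1 E by split.
have [k|x xE] := @L2_geometric_cvg R x_ (rnorm (x_ 1%N - x_ 0%N)).
  elim: k => [|k ih]; first by rewrite expr0 mulr1.
  have -> : x_ k.+2 - x_ k.+1 = E (x_ k.+1 - x_ k).
    by rewrite (linB lE) /= opprD addrACA subrr add0r.
  by apply: le_trans (hE _) _; rewrite exprS mulrCA ler_wpM2l// invr_ge0.
exists x; apply/eqP; rewrite subr_eq; apply/eqP.
have h1 : x_ k.+1 @[k --> \oo] --> x by apply: (cvg_comp (addn 1) x_ (cvg_addnl 1) xE).
have h2 : x_ k.+1 @[k --> \oo] --> f + E x.
  by apply: cvgD; [exact: cvg_cst|exact: opbound_cvg E_bd xE].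
exact: (cvg_unique _ h1 h2).
Qed.

(** The lower bound gives injectivity, hence the linearity of the inverse, and it is
    also the bound of the inverse. *)
Lemma inverse_exists M S l : linear S -> 0 <= M ->
  (forall f, exists x, x - l *: S x = f) ->
  (forall x, rnorm x <= M * rnorm (x - l *: S x)) -> exists Q, bounded_inverse M S l Q.
Proof.
move=> lS M0 surj lb; have [Q hQ] := choice surj.
have lA (a : R[i]) u v : (a *: u + v) - l *: S (a *: u + v) =
    a *: (u - l *: S u) + (v - l *: S v).
  by rewrite lS scalerDr scalerBr opprD addrACA !scalerA mulrC.
have inj x y : x - l *: S x = y - l *: S y -> x = y.
  move=> xy; apply/eqP; rewrite -subr_eq0; apply/eqP/rnorm0_eq0/eqP.
  rewrite eq_le rnorm_ge0 andbT; apply: le_trans (lb _) _.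
  rewrite (_ : _ - _ = 0) ?rnorm0 ?mulr0//.
  by rewrite -(scaleN1r y) (addrC x) lA scaleN1r xy addNr.
exists Q; split; last by move=> f; split => //; exact: inj.
split=> //; first by move=> a u v; apply: inj; rewrite lA !hQ.
by move=> f; apply: le_trans (lb _) _; rewrite hQ.
Qed.

(** Stability of invertibility: I - l S = (I - E Q0)(I - l0 S0) with
    E = l S - l0 S0, and I - E Q0 is inverted by iteration. *)
Lemma inverse_perturb M c S0 l0 Q0 S l : bounded_inverse M S0 l0 Q0 -> linear S0 -> linear S ->
  0 <= c -> (forall x, rnorm (l *: S x - l0 *: S0 x) <= c * rnorm x) -> c * M <= 2^-1 ->
  exists Q, bounded_inverse (2 * M) S l Q.
Proof.
move=> [[lQ M0 hQ] iQ] lS0 lS c0 hc cM.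
pose E x := l *: S x - l0 *: S0 x.
have lE : linear E.
  move=> a u v; rewrite /E lS lS0 !scalerDr !scalerN !scalerA.
  by rewrite (mulrC l) (mulrC l0) opprD addrACA.
have split_ x : x - l *: S x = (x - l0 *: S0 x) - E x.
  by rewrite /E opprB addrA subrK.
apply: inverse_exists => //; first by rewrite mulr_ge0.
- move=> f; have [||y yE] := @contraction_solve (E \o Q0) _ _ f.
  + by move=> a u v /=; rewrite lQ lE.
  + move=> x /=; apply: le_trans (hc _) _.
    apply: (@le_trans _ _ (c * (M * rnorm x))); first by rewrite ler_wpM2l.
    by rewrite mulrA ler_wpM2r ?rnorm_ge0.
  by exists (Q0 y); rewrite split_ (iQ _).2.
- move=> x.
  have h1 : rnorm x <= M * rnorm (x - l *: S x) + (c * M) * rnorm x.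
    rewrite -{1}(iQ x).1; apply: le_trans (hQ _) _.
    rewrite (mulrC c) -mulrA -mulrDr ler_wpM2l//.
    have -> : x - l0 *: S0 x = (x - l *: S x) + E x by rewrite split_ subrK.
    by apply: le_trans (rnormD _ _) _; rewrite lerD2l; exact: hc.
  have h2 : (c * M) * rnorm x <= 2^-1 * rnorm x by rewrite ler_wpM2r ?rnorm_ge0.
  by lra.
Qed.

(** Both products of I - l B A with I + l B Q A reduce to I, because
    Q - l A B Q = I = Q - l Q A B. *)
Lemma inverse_swap a b M A B l Q : opbound a A -> opbound b B -> bounded_inverse M (A \o B) l Q ->
  bounded_inverse (1 + rnorm l * (b * M * a)) (B \o A) l (fun f => f + l *: B (Q (A f))).
Proof.
move=> [lA a0 hA] [lB b0 hB] [[lQ M0 hQ] iQ]; split; last first.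
  move=> f; split => /=.
  - rewrite (linB lA) (linZ lA) (iQ (A f)).1.
    by rewrite subrK.
  - rewrite (linD lA) (linZ lA) (linD lB) (linZ lB) scalerDr.
    have -> : B (A f) = B (Q (A f)) - l *: B (A (B (Q (A f)))).
      by rewrite -(linZ lB) -(linB lB) (iQ (A f)).2.
    rewrite scalerBr subrK.
    by rewrite addrK.
split; last first.
- move=> f; apply: le_trans (rnormD _ _) _; rewrite mulrDl mul1r lerD2l.
  rewrite rnormZ -!mulrA ler_wpM2l ?rnorm_ge0//.
  apply: le_trans (hB _) _; rewrite ler_wpM2l//.
  by apply: le_trans (hQ _) _; rewrite ler_wpM2l.
- by rewrite addr_ge0// !mulr_ge0// rnorm_ge0.
- move=> c u v; rewrite lA lQ lB scalerDr scalerDr addrACA !scalerA mulrC.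
  by [].
Qed.

(** The resolvent identity Q_i y_i - z = Q_i (y_i - (z - l_i S_i z)) with
    z = Q y: a uniform bound on Q_i turns convergence of the equations into
    convergence of the solutions. *)
Lemma inverse_cvg (I : Type) (F : set_system I) {FF : Filter F}
    (S_ : I -> H -> H) (l_ : I -> CC R) (Q_ : I -> H -> H) (y_ : I -> H) M S l z y :
  (\forall i \near F, bounded_inverse M (S_ i) (l_ i) (Q_ i)) ->
  z - l *: S z = y -> l_ i *: S_ i z @[i --> F] --> l *: S z ->
  y_ i @[i --> F] --> y -> Q_ i (y_ i) @[i --> F] --> z.
Proof.
move=> hQ zy lz yy.
apply: (rcvg_squeeze (g := fun i => M * rnorm (y_ i - (z - l_ i *: S_ i z)))).
  apply: filterS hQ => i [[lQ _ bQ] iQ].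
  by rewrite -{1}(iQ z).1 -(linB lQ).
rewrite -(mulr0 M); apply: cvgM; first exact: cvg_cst.
have : y_ i - (z - l_ i *: S_ i z) @[i --> F] --> (0 : H).
  rewrite -(subrr y) -{2}zy; apply: cvgB => //; apply: cvgB => //; exact: cvg_cst.
move/rcvg0P; under eq_fun do rewrite subr0.
by [].
Qed.

End BoundedOperators.

(** * Fubini's theorem for complex functions *)

Section ComplexFubini.
Context d1 d2 (T1 : measurableType d1) (T2 : measurableType d2) (R : realType).
Variable m1 : {sigma_finite_measure set T1 -> \bar R}.
Variable m2 : {sigma_finite_measure set T2 -> \bar R}.

(* The inner integrals of Fubini's theorem are finite only almost everywhere. *)
Lemma integral_fine d (T : measurableType d) (m : {measure set T -> \bar R})
    (F : T -> \bar R) : measurable_fun setT F -> {ae m, forall x, F x \is a fin_num} ->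
  (\int[m]_x (fine (F x))%:E)%E = (\int[m]_x F x)%E.
Proof.
move=> mF fF; apply: ae_eq_integral => //.
  by apply/measurable_EFinP; exact: measurableT_comp.
by apply: aeS fF => x Fx _; rewrite fineK.
Qed.

Lemma Rfubini (f : T1 * T2 -> R) : (m1 \x m2)%E.-integrable setT (EFin \o f) ->
  \int[m1]_x (\int[m2]_y f (x, y)) = \int[m2]_y (\int[m1]_x f (x, y)).
Proof.
move=> fi; rewrite /Rintegral [in LHS]integral_fine.
- rewrite [in RHS]integral_fine; first by rewrite (Fubini fi).
  + exact: (measurable_fubini_G fi).
  + have := ae_integrable2 fi; apply: aeS => y h; by apply: integrable_fin_num h => //.
- exact: (measurable_fubini_F fi).
- have := ae_integrable1 fi; apply: aeS => y h; by apply: integrable_fin_num h => //.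
Qed.

Lemma cfubini (F : T1 * T2 -> CC R) : cintegrable (m1 \x m2)%E F ->
  cintegral m1 (fun x => cintegral m2 (fun y => F (x, y))) =
  cintegral m2 (fun y => cintegral m1 (fun x => F (x, y))).
Proof. by move=> [Fr Fi]; apply: complexP; [exact: (Rfubini Fr)|exact: (Rfubini Fi)]. Qed.

End ComplexFubini.

(** * Vanishing curves and operators with a kernel *)

Section ContinuityMeasurability.
Context (R : realType).
Local Notation mu := (@lebesgue_measure R).
Local Notation H := (L2R R).

Lemma inner_cvg (I : Type) (F : set_system I) {FF : Filter F} (u_ v_ : I -> H) u v :
  u_ i @[i --> F] --> u -> v_ i @[i --> F] --> v ->
  (L2_inner (u_ i) (v_ i) : CC R) @[i --> F] --> (L2_inner u v : CC R).
Proof.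
move=> /rcvg0P uu /rcvg0P vv.
apply: (rcvg_squeeze (g := fun i => rnorm (u_ i - u) * (rnorm (v_ i - v) + rnorm v) +
   rnorm u * rnorm (v_ i - v))); last first.
  rewrite (_ : 0 = 0 * (0 + rnorm v) + rnorm u * 0); last by rewrite mul0r mulr0 addr0.
  apply: cvgD; apply: cvgM => //; try exact: cvg_cst.
  by apply: cvgD => //; exact: cvg_cst.
apply: nearW => i; rewrite rnormcE.
have -> : L2_inner (u_ i) (v_ i) - L2_inner u v =
    L2_inner (u_ i - u) (v_ i) + L2_inner u (v_ i - v).
  by rewrite innerBl innerBr addrA subrK.
apply: le_trans (le_normcD _ _) _; apply: lerD; last exact: cauchy_schwarz.
apply: le_trans (cauchy_schwarz _ _) _; rewrite ler_wpM2l ?rnorm_ge0//.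
by apply: le_trans (rnormD _ _); rewrite subrK.
Qed.

Lemma Re_cvg (I : Type) (F : set_system I) {FF : Filter F} (z_ : I -> CC R) (z : CC R) :
  z_ i @[i --> F] --> z -> complex.Re (z_ i) @[i --> F] --> complex.Re z.
Proof.
move=> /rcvgP h; apply/cvgrPdist_lt => e e0; apply: filterS (h e e0) => i.
rewrite rnormB; apply: le_lt_trans.
by have := normc_Re (z - z_ i); case: z {h}; case: (z_ i).
Qed.

Lemma Im_cvg (I : Type) (F : set_system I) {FF : Filter F} (z_ : I -> CC R) (z : CC R) :
  z_ i @[i --> F] --> z -> complex.Im (z_ i) @[i --> F] --> complex.Im z.
Proof.
move=> /rcvgP h; apply/cvgrPdist_lt => e e0; apply: filterS (h e e0) => i.
rewrite rnormB; apply: le_lt_trans.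
by have := normc_Im (z - z_ i); case: z {h}; case: (z_ i).
Qed.

Lemma continuous_cmeasurable (h : R -> CC R) : continuous h -> cmeasurable h.
Proof.
move=> ch; split; apply: continuous_measurable_fun => x.
- by apply: Re_cvg; exact: ch.
- by apply: Im_cvg; exact: ch.
Qed.

(** h is the pointwise limit of the functions that freeze the first variable on
    the cells of a countable partition of the line. *)
Lemma separately_continuous_measurable (h : R * R -> R) :
  (forall t, continuous (fun s => h (s, t))) ->
  (forall s, measurable_fun setT (fun t => h (s, t))) -> measurable_fun setT h.
Proof.
move=> hc hm.
pose q n (s : R) : R := (Num.floor (s * n.+1%:R))%:~R / n.+1%:R.
apply: (measurable_fun_cvg (h := fun n p => h (q n p.1, p.2))); last first.
  move=> [s t] _ /=.
  apply: (@cvg_comp _ _ _ (q^~ s) (fun s => h (s, t)) _ (nbhs s)); last exact: hc.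
  apply/cvgrPdist_lt => e e0; near=> n.
  have n0 : 0 < n.+1%:R :> R by rewrite ltr0n.
  have /andP[f1 f2] := floor_itv (s * n.+1%:R).
  rewrite (_ : s - q n s = (s * n.+1%:R - (Num.floor (s * n.+1%:R))%:~R) / n.+1%:R); last first.
    by rewrite /q mulrBl mulfK// gt_eqF.
  rewrite normrM (ger0_norm (_ : 0 <= _ - _)) ?subr_ge0//.
  rewrite (gtr0_norm (_ : 0 < _^-1)) ?invr_gt0//.
  apply: (@le_lt_trans _ _ n.+1%:R^-1).
    rewrite ler_piMl ?invr_ge0 ?ler0n// lerBlDl ltW//.
    by move: f2; rewrite intrD.
  by near: n; exact: (near_infty_natSinv_lt (PosNum e0)).
move=> n _ B mB; rewrite setTI.
rewrite (_ : _ @^-1` _ = \bigcup_(z : int) ((fun s => Num.floor (s * n.+1%:R)) @^-1` [set z] `*`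
   ((fun t => h (z%:~R / n.+1%:R, t)) @^-1` B))); last first.
  apply/seteqP; split => [[s t] /= Bh|[s t] [z _ [/= <-]]//].
  by exists (Num.floor (s * n.+1%:R)).
apply: countable_bigcupT_measurable => [|z]; first exact: countableP.
apply: measurableX; last by rewrite -[_ @^-1` _]setTI; exact: hm.
rewrite (_ : _ @^-1` _ = `[z%:~R / n.+1%:R, (z + 1)%:~R / n.+1%:R[%classic).
  exact: measurable_itv.
have n0 : 0 < n.+1%:R :> R by rewrite ltr0n.
apply/seteqP; split => s /=.
- by move=> <-; rewrite in_itv/= ler_pdivrMr// ltr_pdivlMr// floor_itv.
- rewrite in_itv/= ler_pdivrMr// ltr_pdivlMr// => h1.
  exact: floor_def.
Unshelve. all: by end_near. Qed.

(** Continuity bounds the curve on a segment, and it is small elsewhere. *)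
Lemma C0_bounded (B : normedModType R[i]) (f : R -> B) : C0 f ->
  exists2 C, 0 <= C & forall x, rnorm (f x) <= C.
Proof.
move=> [cf vf]; have [A hA] := vf 1 ltr01.
have /compact_near_coveringP := @segment_compact R (- A) A.
move=> /(_ _ \oo (fun n x => rnorm (f x) < n%:R)) /= [].
  move=> x _; have cfx : f y @[y --> x] --> f x by exact: cf.
  exists ([set y | rnorm (f y - f x) < 1], [set n | rnorm (f x) + 1 < n%:R]).
    by split; [exact: (rcvgP _ _).1 cfx 1 ltr01|exact: nbhs_infty_gtr].
  move=> [y n] /= [h1 h2].
  by have := rnormD (f y - f x) (f x); rewrite subrK; lra.
move=> N _ hN; exists (N%:R + 1) => [|x]; first by rewrite addr_ge0.
have [Ax|xA] := ltP A `|x|; first by rewrite (le_trans (ltW (hA _ Ax)))// lerDr.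
have := hN N (leqnn N) x; rewrite /= in_itv/= -ler_norml => /(_ xA) h.
by apply: le_trans (ltW h) _; rewrite lerDl.
Qed.

End ContinuityMeasurability.

Section IntegralOperator.
Context (R : realType).
Local Notation mu := (@lebesgue_measure R).
Local Notation H := (L2R R).
Variables (S : H -> H) (K : R * R -> CC R).
Hypotheses (SK : integral_operator S K) (KK : K0_kernel K).

Let row_sq s : square_integrable mu (fun t => K (s, t)).
Proof. by case: KK => + _ _ _ => /(_ s)[]. Qed.

Let col_sq t : square_integrable mu (fun s => K (s, t)).
Proof. by case: KK => + _ _ _ => /(_ t)[]. Qed.

Lemma carlemanE s : {ae mu, forall t, L2_fun (carleman K s) t = conjc (K (s, t))}.
Proof. exact: L2_fun_toL2 (sq_conj (row_sq s)). Qed.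

Lemma carleman'E t : {ae mu, forall s, L2_fun (carleman' K t) s = K (s, t)}.
Proof. exact: L2_fun_toL2 (col_sq t). Qed.

Lemma row_inner s (f : H) :
  cintegral mu (fun t => K (s, t) * L2_fun f t) = L2_inner f (carleman K s).
Proof.
apply: ae_eq_cintegral.
- by apply: cmeasurableM; [case: (row_sq s)|exact: L2_fun_cmeasurable].
- by apply: cmeasurableM; [|apply: cmeasurable_conj]; exact: L2_fun_cmeasurable.
- by apply: aeS (carlemanE s) => t ->; rewrite conjcK mulrC.
Qed.

Lemma col_inner t (g : H) :
  cintegral mu (fun s => K (s, t) * conjc (L2_fun g s)) = L2_inner (carleman' K t) g.
Proof.
apply: ae_eq_cintegral.
- apply: cmeasurableM; first by case: (col_sq t).
  by apply: cmeasurable_conj; exact: L2_fun_cmeasurable.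
- by apply: cmeasurableM; [|apply: cmeasurable_conj]; exact: L2_fun_cmeasurable.
- by apply: aeS (carleman'E t) => s ->.
Qed.

Lemma integral_operatorE f :
  {ae mu, forall s, L2_fun (S f) s = L2_inner f (carleman K s)}.
Proof. by have := SK.2 f; apply: aeS => s [_ ->]; exact: row_inner. Qed.

Lemma col_norm t : rnorm (carleman' K t) ^+ 2 = \int[mu]_s (Normc.normc (K (s, t)) ^+ 2).
Proof.
rewrite -(Lnorm2_sqr (col_sq t)) -[rnorm _]/(fine (Lnorm2 mu (L2_fun (carleman' K t)))).
congr (fine _ ^+ 2); apply: eq_ae_Lnorm2; last exact: carleman'E.
- exact: L2_fun_cmeasurable.
- by case: (col_sq t).
Qed.

(** Absolute integrability holds as soon as one factor is integrable: the
    columns of K are bounded in L2. *)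
Lemma kernel_cintegrable (f : R -> CC R) (g : H) : cmeasurable f ->
  mu.-integrable setT (fun t => (Normc.normc (f t))%:E) ->
  cintegrable (mu \x mu)%E (fun p => conjc (L2_fun g p.1) * (K p * f p.2)).
Proof.
move=> mf fi.
have [C C0 hC] : exists2 C, 0 <= C & forall t, rnorm (carleman' K t) <= C.
  by apply: C0_bounded; case: KK.
have mF : cmeasurable (fun p => conjc (L2_fun g p.1) * (K p * f p.2)).
  have [fr fim] := mf; have [gr gi] := cmeasurable_conj (L2_fun_cmeasurable g).
  apply: cmeasurableM.
    by split; [exact: (measurableT_comp gr)|exact: (measurableT_comp gi)].
  apply: cmeasurableM; first exact: SK.1.
  by split; [exact: (measurableT_comp fr)|exact: (measurableT_comp fim)].
have bnd t : (\int[mu]_s (Normc.normc (conjc (L2_fun g s) * (K (s, t) * f t)))%:E <=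
    ((C ^+ 2 + rnorm g ^+ 2) * Normc.normc (f t))%:E)%E.
  have [mK iK] := (square_integrableP mu _).1 (col_sq t).
  have [mg ig] := (square_integrableP mu _).1 (L2_fun_sq g).
  have iKg := integrableD measurableT iK ig.
  apply: (@le_trans _ _ (\int[mu]_s ((Normc.normc (f t))%:E *
      ((Normc.normc (K (s, t)) ^+ 2)%:E + (Normc.normc (L2_fun g s) ^+ 2)%:E)))%E).
    apply: ge0_le_integral => //.
    - by move=> s _; rewrite lee_fin normc_ge0.
    - apply/measurable_EFinP/cmeasurable_normc/cmeasurableM.
        exact: cmeasurable_conj.
      by have := cmeasurableZ (f t) mK; congr cmeasurable; apply/funext => s;
        rewrite mulrC.
    - exact: measurable_int (integrableZl measurableT _ iKg).
    - move=> s _; rewrite -EFinD -EFinM lee_fin !Normc.normcM normc_conj.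
      rewrite mulrA [leLHS]mulrC ler_wpM2l ?normc_ge0//.
      have := normc_ge0 (L2_fun g s); have := normc_ge0 (K (s, t)).
      by move: (Normc.normc _) (Normc.normc _) => a b; nra.
  rewrite (integralZl _ iKg)//= (integralD _ iK ig)//.
  rewrite [in leRHS]mulrC EFinM; apply: lee_wpmul2l; first by rewrite lee_fin normc_ge0.
  rewrite EFinD; apply: leeD.
    rewrite -[X in (X <= _)%E]fineK; last exact: integrable_fin_num iK.
    by rewrite lee_fin -[fine _]/(\int[mu]_s _) -col_norm lerXn2r ?nnegrE ?rnorm_ge0.
  by rewrite -[X in (X <= _)%E]fineK ?rnorm_sqr//; exact: integrable_fin_num ig.
have bnd2 : (\int[mu]_t \int[mu]_s
    (Normc.normc (conjc (L2_fun g s) * (K (s, t) * f t)))%:E < +oo)%E.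
  apply: (@le_lt_trans _ _ (\int[mu]_t (((C ^+ 2 + rnorm g ^+ 2))%:E *
     (Normc.normc (f t))%:E))%E).
    apply: ge0_le_integral => //.
    - by move=> t _; apply: integral_ge0 => s _; rewrite lee_fin normc_ge0.
    - apply: (@measurable_fun_fubini_tonelli_G _ _ _ _ _ mu
        (fun p => (Normc.normc (conjc (L2_fun g p.1) * (K p * f p.2)))%:E)).
        by apply/measurable_EFinP; exact: cmeasurable_normc.
      by move=> p; rewrite lee_fin normc_ge0.
    - exact: measurable_int (integrableZl measurableT _ fi).
  rewrite (integralZl _ fi)//; apply: lte_mul_pinfty => //.
    by rewrite lee_fin addr_ge0 ?sqr_ge0.
  exact: integrable_lty fi.
have red (r : R[i] -> R) : (forall z, `|r z| <= Normc.normc z) ->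
    measurable_fun setT (fun p => r (conjc (L2_fun g p.1) * (K p * f p.2))) ->
    (mu \x mu)%E.-integrable setT
      (fun p => (r (conjc (L2_fun g p.1) * (K p * f p.2)))%:E).
  move=> rn mr; apply/integrable21ltyP; first exact/measurable_EFinP.
  apply: le_lt_trans bnd2; apply: ge0_le_integral => //.
  - by move=> t _; apply: integral_ge0 => s _; rewrite abse_ge0.
  - apply: (@measurable_fun_fubini_tonelli_G _ _ _ _ _ mu
      (fun p => `|(r (conjc (L2_fun g p.1) * (K p * f p.2)))%:E|)%E) => //.
    by apply: measurableT_comp => //; exact/measurable_EFinP.
  - apply: (@measurable_fun_fubini_tonelli_G _ _ _ _ _ mu
      (fun p => (Normc.normc (conjc (L2_fun g p.1) * (K p * f p.2)))%:E)).
      by apply/measurable_EFinP; exact: cmeasurable_normc.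
    by move=> p; rewrite lee_fin normc_ge0.
  - move=> t _; apply: ge0_le_integral => //.
    + by apply: measurableT_comp => //; apply/measurable_EFinP;
        exact: (measurableT_comp mr (measurable_pair2 t)).
    + have := cmeasurable_normc mF => mn.
      by apply/measurable_EFinP; exact: (measurableT_comp mn (measurable_pair2 t)).
    + by move=> s _; rewrite abse_EFin lee_fin.
have [mr mi] := mF.
by split; apply: red => //; [exact: normc_Re|exact: normc_Im].
Qed.

End IntegralOperator.

(** * The kernel of the adjoint *)

Section AdjointKernel.
Context (R : realType).
Local Notation mu := (@lebesgue_measure R).
Local Notation H := (L2R R).
Variables (S S' : H -> H) (K : R * R -> CC R).
Hypotheses (SK : integral_operator S K) (KK : K0_kernel K) (aS : adjoint S S').

Lemma carleman_continuous : continuous (carleman K).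
Proof. by case: KK => _ _ [+ _] _. Qed.

Lemma carleman'_continuous : continuous (carleman' K).
Proof. by case: KK => _ _ _ [+ _]. Qed.

Lemma row_inner_continuous (f : H) : continuous (fun s => L2_inner f (carleman K s) : CC R).
Proof. by move=> s; apply: inner_cvg; [exact: cvg_cst|exact: carleman_continuous]. Qed.

Lemma col_inner_continuous (g : H) : continuous (fun t => L2_inner g (carleman' K t) : CC R).
Proof. by move=> s; apply: inner_cvg; [exact: cvg_cst|exact: carleman'_continuous]. Qed.

(** Fubini's theorem is used against the difference D of the two sides of
    [adjoint_kernel], restricted to a window so as to be integrable. *)
Section Window.
Variables (g : H) (n : nat).

Let I : set R := `]- n%:R, n%:R[%classic.
Let G t : CC R := L2_inner g (carleman' K t).
Let chi t : R := \1_I t.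
Let D t : CC R := (chi t)%:C * (L2_fun (S' g) t - G t).

Let mchi : measurable_fun setT chi.
Proof. by apply: measurable_indic; exact: measurable_itv. Qed.

Let chi_int : mu.-integrable setT (EFin \o chi).
Proof. exact: (integrable_indic_itv (- n%:R) n%:R false true). Qed.

Let mD : cmeasurable D.
Proof.
have mG : cmeasurable G by apply: continuous_cmeasurable; exact: col_inner_continuous.
apply: cmeasurableM; first by split; [exact: mchi|exact: measurable_cst].
have := cmeasurableD (L2_fun_cmeasurable (S' g)) (cmeasurableZ (-1) mG).
by congr cmeasurable; apply/funext => x; rewrite fctE/= scaleN1r.
Qed.

Let chi2 t : chi t * chi t = chi t.
Proof. by rewrite /chi indicE; case: (_ \in _); rewrite ?mulr1 ?mulr0. Qed.

Let normc_chi t : Normc.normc ((chi t)%:C : R[i]) = chi t.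
Proof. by rewrite /= expr0n addr0 sqrtr_sqr ger0_norm. Qed.

Let chi01 t : 0 <= chi t <= 1.
Proof. by rewrite /chi indicE; case: (_ \in _); rewrite ?lexx ?ler01. Qed.

(* |D|^2 is at most 2 |S' g|^2 + 2 |G|^2 on the window, and G is bounded by the
   Cauchy-Schwarz inequality. *)
Let sqD : square_integrable mu D.
Proof.
have [C C0 hC] : exists2 C, 0 <= C & forall t, rnorm (carleman' K t) <= C.
  by apply: C0_bounded; case: KK.
apply/square_integrableP; split=> //.
have [_ iS] := (square_integrableP mu _).1 (L2_fun_sq (S' g)).
have := integrableD measurableT (integrableZl measurableT 2 iS)
  (integrableZl measurableT (2 * (rnorm g * C) ^+ 2) chi_int).
apply: le_integrable => //.
  by apply/measurable_EFinP/measurable_funX; exact: cmeasurable_normc.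
move=> t _ /=; rewrite lee_fin ger0_norm ?sqr_ge0//; apply: le_trans (ler_norm _).
rewrite /D Normc.normcM normc_chi exprMn expr2 chi2.
have hG : Normc.normc (G t) <= rnorm g * C.
  by apply: le_trans (cauchy_schwarz _ _) _; rewrite ler_wpM2l ?rnorm_ge0.
have h1 := le_normcD (L2_fun (S' g) t) (- G t); rewrite normcN in h1.
have /andP[c0 c1] := chi01 t.
have a0 := normc_ge0 (L2_fun (S' g) t - G t).
move: (Normc.normc (_ - _)) a0 h1 => a a0 h1.
move: (Normc.normc (L2_fun _ _)) (normc_ge0 (L2_fun (S' g) t)) h1 => b b0 h1.
have G0 := normc_ge0 (G t).
move: (Normc.normc _) G0 h1 hG => c G0 h1 hG.
apply: (@le_trans _ _ (chi t * (2 * b ^+ 2 + 2 * (rnorm g * C) ^+ 2))).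
  rewrite ler_wpM2l//; set m := rnorm g * C in hG *.
  have a2 : a ^+ 2 <= (b + c) ^+ 2 by rewrite lerXn2r ?nnegrE ?addr_ge0.
  have c2 : c ^+ 2 <= m ^+ 2 by rewrite lerXn2r ?nnegrE// (le_trans G0).
  by have := sqr_ge0 (b - c); nra.
have : 0 <= b ^+ 2 by rewrite sqr_ge0.
nra.
Qed.

Let D_int : mu.-integrable setT (fun t => (Normc.normc (D t))%:E).
Proof.
have [_ iD] := (square_integrableP mu _).1 sqD.
apply: le_integrable (integrableD measurableT iD chi_int) => //.
  by apply/measurable_EFinP; exact: cmeasurable_normc.
move=> t _ /=; rewrite lee_fin ger0_norm ?normc_ge0//; apply: le_trans (ler_norm _).
have : Normc.normc (D t) = chi t * Normc.normc (D t).
  by rewrite /D Normc.normcM normc_chi mulrA chi2.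
have /andP[c0 c1] := chi01 t; have := normc_ge0 (D t).
move: (Normc.normc (D t)) => a a0 aE.
have : chi t * (a - chi t) ^+ 2 >= 0 by rewrite mulr_ge0// sqr_ge0.
have := chi2 t; nra.
Qed.

Let f : H := toL2 D.

Let fE : {ae mu, forall t, L2_fun f t = D t}.
Proof. exact: L2_fun_toL2. Qed.

Let inner_f (h : R -> CC R) : cmeasurable h ->
  cintegral mu (fun t => D t * h t) = cintegral mu (fun t => L2_fun f t * h t).
Proof.
move=> mh; apply: ae_eq_cintegral.
- exact: cmeasurableM.
- by apply: cmeasurableM => //; exact: L2_fun_cmeasurable.
- by apply: aeS fE => t ->.
Qed.

Let mrow s : cmeasurable (fun t => K (s, t)).
Proof. by case: KK => + _ _ _ => /(_ s)[[]]. Qed.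

Let sq_row s : square_integrable mu (fun t => K (s, t)).
Proof. by case: KK => + _ _ _ => /(_ s)[]. Qed.

Let sq_col t : square_integrable mu (fun s => K (s, t)).
Proof. by case: KK => + _ _ _ => /(_ t)[]. Qed.

Let rowD s : cintegral mu (fun t => K (s, t) * D t) = L2_inner f (carleman K s).
Proof.
rewrite -(row_inner KK); under eq_fun do rewrite mulrC.
by rewrite inner_f//; congr cintegral; apply/funext => t; rewrite mulrC.
Qed.

(* Fubini's theorem; D is integrable because it vanishes off the window. *)
Let Sfg : L2_inner (S f) g = cintegral mu (fun t => D t * conjc (G t)).
Proof.
have mg := cmeasurable_conj (L2_fun_cmeasurable g).
transitivity (cintegral mu (fun s => cintegral mu (fun t =>
    conjc (L2_fun g s) * (K (s, t) * D t)))).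
  rewrite [X in _ = cintegral _ X](_ : _ =
      fun s => conjc (L2_fun g s) * L2_inner f (carleman K s)); last first.
    by apply/funext => s; rewrite cintegralZ ?rowD//; exact: square_integrableM.
  apply: ae_eq_cintegral.
  - exact: (cmeasurableM (L2_fun_cmeasurable _) mg).
  - apply: (cmeasurableM mg); apply: continuous_cmeasurable; exact: row_inner_continuous.
  - by apply: aeS (integral_operatorE SK KK f) => s ->; rewrite mulrC.
rewrite (cfubini (kernel_cintegrable SK KK g mD D_int)) /=.
congr cintegral; apply/funext => t.
rewrite [RHS](_ : _ = D t * cintegral mu (fun s => K (s, t) * conjc (L2_fun g s))); last first.
  by rewrite (col_inner KK) (innerC g).
rewrite -cintegralZ; last by apply: square_integrableM => //; exact/sq_conj/L2_fun_sq.
by congr cintegral; apply/funext => s; ring.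
Qed.

(* By the previous equation <f, S' g> is also the integral of D times the conjugate
   of G; the difference of the two sides is the integral of |D|^2. *)
Let f0 : f = 0.
Proof.
apply: rnorm0_eq0; apply/eqP; rewrite -sqrf_eq0; apply/eqP/(@complexI R).
have mG : cmeasurable G by apply: continuous_cmeasurable; exact: col_inner_continuous.
have iDS : cintegrable mu (fun t => D t * conjc (L2_fun (S' g) t)).
  by apply: square_integrableM => //; exact/sq_conj/L2_fun_sq.
have iDD : cintegrable mu (fun t => D t * conjc (D t)).
  by apply: square_integrableM => //; exact: sq_conj.
have DDE t : D t * conjc (D t) = D t * conjc (L2_fun (S' g) t) + (-1) * (D t * conjc (G t)).
  have -> : D t * conjc (D t) = D t * conjc (L2_fun (S' g) t - G t).
    by rewrite /D conjcM conjc_real mulrACA -rcM chi2 mulrA.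
  by rewrite conjcD conjcN; ring.
have iDG : cintegrable mu (fun t => D t * conjc (G t)).
  have := cintegrableD iDS (cintegrableZ (-1) iDD); congr cintegrable.
  by apply/funext => t; rewrite DDE; ring.
have -> : (rnorm f ^+ 2)%:C = cintegral mu (fun t => D t * conjc (D t)).
  rewrite -inner_norm inner_f.
  apply: ae_eq_cintegral.
  - by apply: cmeasurableM; [|apply: cmeasurable_conj]; exact: L2_fun_cmeasurable.
  - by apply: cmeasurableM; [exact: L2_fun_cmeasurable|exact: cmeasurable_conj].
  - by apply: aeS fE => t ->.
  exact: cmeasurable_conj.
under eq_fun do rewrite DDE.
rewrite cintegralD//; last exact: cintegrableZ.
rewrite cintegralZ// -Sfg aS mulN1r inner_f; last exact/cmeasurable_conj/L2_fun_cmeasurable.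
by rewrite subrr.
Qed.

Lemma adjoint_kernel_window :
  {ae mu, forall t, - n%:R < t < n%:R -> L2_fun (S' g) t = L2_inner g (carleman' K t)}.
Proof.
have h0 : {ae mu, forall t, L2_fun f t = 0} by rewrite f0; exact: L2_fun0.
apply: aeS2 h0 fE => t -> /esym D0 tn; apply/eqP; rewrite -subr_eq0; apply/eqP.
by rewrite -D0 /D /chi indicE mem_set ?mul1r.
Qed.

End Window.

(** The windows exhaust the line, and a countable union of null sets is null. *)
Lemma adjoint_kernel (g : H) :
  {ae mu, forall t, L2_fun (S' g) t = L2_inner g (carleman' K t)}.
Proof.
have := ae_foralln (adjoint_kernel_window g).
apply: aeS => t ht; apply: (ht (Num.trunc `|t|).+1).
rewrite -ltr_norml.
exact: truncnS_gt.
Qed.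

End AdjointKernel.

(** * The resolvent kernel *)

Section ResolventKernel.
Context (R : realType).
Local Notation mu := (@lebesgue_measure R).
Local Notation H := (L2R R).
Implicit Types (S Q : H -> H) (K : R * R -> CC R) (l : CC R).

(** A nonempty open interval has positive measure. *)
Lemma ae_dense (P : R -> Prop) (x : R) (U : set R) :
  {ae mu, forall y, P y} -> nbhs x U -> exists2 y, U y & P y.
Proof.
move=> [N [mN N0 PN]] /nbhs_ballP[d /= d0 xU].
pose J : set R := `]x - d, x + d[%classic.
have [y yd yN] : exists2 y, J y & ~ N y.
  apply: contrapT => h.
  have sub : J `<=` N.
    by move=> y yd; apply: contrapT => yN; apply: h; exists y.
  have mJ : measurable J by exact: measurable_itv.
  have := le_measure mu _ _ sub; rewrite !inE => /(_ mJ mN).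
  move=> le_JN; have : (lebesgue_measure J <= 0)%E by rewrite -N0; exact: le_JN.
  rewrite /J lebesgue_measure_itv/= lte_fin ltrBlDr -addrA ltrDl addr_gt0//.
  by rewrite -EFinB lee_fin; lra.
exists y; last by apply: contrapT => yP; exact/yN/PN.
apply: xU; rewrite /ball/= ltr_norml; move: yd; rewrite /J /= in_itv/= => /andP[]; lra.
Qed.

Lemma ae_eq_continuous (f g : R -> CC R) : continuous f -> continuous g ->
  {ae mu, forall x, f x = g x} -> f = g.
Proof.
move=> cf cg fg; apply/funext => x; apply/eqP; rewrite -subr_eq0; apply/eqP/rnorm0_eq0.
apply/eqP; rewrite eq_le rnorm_ge0 andbT; apply/ler_addgt0Pr => e e0; rewrite add0r.
have e2 : 0 < e / 2 by rewrite divr_gt0.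
have cfx : f y @[y --> x] --> f x by exact: cf.
have cgx : g y @[y --> x] --> g x by exact: cg.
have h1 : \forall y \near x, rnorm (f y - f x) < e / 2 by exact: (rcvgP _ _).1 cfx _ e2.
have h2 : \forall y \near x, rnorm (g y - g x) < e / 2 by exact: (rcvgP _ _).1 cgx _ e2.
have [y [y1 y2] fy] := ae_dense fg (filterI h1 h2).
apply: le_trans (rnorm_dist _ _ (f y)) _.
rewrite {2}fy (rnormB (f x)); lra.
Qed.

Lemma row_continuous K s : continuous K -> continuous (fun t => K (s, t)).
Proof.
move=> cK t.
have h : (s, t') @[t' --> t] --> (s, t).
  by apply: (@cvg_pair _ _ _ (nbhs t) (nbhs s) (nbhs t)); [exact: cvg_cst|exact: cvg_id].
exact: (cvg_comp _ _ h (cK (s, t))).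
Qed.

Lemma col_continuous K t : continuous K -> continuous (fun s => K (s, t)).
Proof.
move=> cK s.
have h : (s', t) @[s' --> s] --> (s, t).
  by apply: (@cvg_pair _ _ _ (nbhs s) (nbhs s) (nbhs t)); [exact: cvg_id|exact: cvg_cst].
exact: (cvg_comp _ _ h (cK (s, t))).
Qed.

(** For each f the inner products of f with the two Carleman functions are continuous
    and agree almost everywhere, hence everywhere. *)
Lemma K0_uniq S K1 K2 : K0_kernel K1 -> K0_kernel K2 -> integral_operator S K1 ->
  integral_operator S K2 -> K1 = K2.
Proof.
move=> k1 k2 i1 i2.
have ck s : carleman K1 s = carleman K2 s.
  apply: inner_ext => f.
  have h : (fun s => L2_inner f (carleman K1 s) : CC R) =
      (fun s => L2_inner f (carleman K2 s) : CC R).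
    apply: ae_eq_continuous; [exact: row_inner_continuous..|].
    by apply: aeS2 (integral_operatorE i1 k1 f) (integral_operatorE i2 k2 f) => t -> ->.
  by have := congr1 (fun h => h s) h.
apply/funext => -[s t].
have sec K : K0_kernel K -> continuous (fun t => K (s, t)).
  by move=> [_ [cK _] _ _]; exact: row_continuous.
have h : (fun t => K1 (s, t)) = (fun t => K2 (s, t)).
  apply: ae_eq_continuous; [exact: sec|exact: sec|].
  apply: aeS2 (carlemanE k1 s) (carlemanE k2 s) => t'; rewrite ck => ->.
  exact: (inv_inj (@conjcK R)).
by have := congr1 (fun h => h t) h.
Qed.

Lemma C0_opbound M Q (f : R -> H) : opbound M Q -> C0 f -> C0 (Q \o f).
Proof.
move=> bQ [cf vf]; split.
  by move=> x; apply: (opbound_cvg bQ); exact: cf.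
move=> e e0; have [lQ M0 hQ] := bQ.
have M1 : 0 < M + 1 by rewrite ltr_pwDr.
have [A hA] := vf (e / (M + 1)) (divr_gt0 e0 M1).
exists A => x /hA; rewrite ltr_pdivlMr// => h; apply: le_lt_trans (hQ _) _ => /=.
by apply: le_lt_trans h; rewrite mulrC ler_wpM2l ?rnorm_ge0// lerDl.
Qed.

(** Bounded factors that vanish at infinity make a product that vanishes as soon
    as one of the two variables goes to infinity. *)
Lemma C0_norm_prod (f g : R -> H) (e : R) : C0 f -> C0 g -> 0 < e ->
  exists A : R, forall p : R * R, A < `|p| -> rnorm (f p.2) * rnorm (g p.1) < e.
Proof.
move=> Cf Cg e0; have [F F0 hF] := C0_bounded Cf; have [G G0 hG] := C0_bounded Cg.
move: Cf Cg => [_ vf] [_ vg].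
have F1 : 0 < F + 1 by rewrite ltr_pwDr.
have G1 : 0 < G + 1 by rewrite ltr_pwDr.
have [A hA] := vf (e / (G + 1)) (divr_gt0 e0 G1).
have [B hB] := vg (e / (F + 1)) (divr_gt0 e0 F1).
exists (Num.max A B) => -[s t]; rewrite [ `|_| ]prod_normE /= => h.
have := rnorm_ge0 (f t); have := rnorm_ge0 (g s); have := hF t; have := hG s.
have : A < `|t| \/ B < `|s|.
  by move: h; rewrite lt_max => /orP[]; rewrite gt_max => /andP[]; auto.
case=> [/hA|/hB]; rewrite ltr_pdivlMr// => h' h1 h2 h3 h4.
- by apply: le_lt_trans h'; rewrite ler_wpM2l//; lra.
- by rewrite mulrC; apply: le_lt_trans h'; rewrite ler_wpM2l//; lra.
Qed.

Lemma C0_inner (f g : R -> H) : C0 f -> C0 g ->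
  C0 (fun p : R * R => L2_inner (f p.2) (g p.1) : CC R).
Proof.
move=> Cf Cg; split.
  move: Cf Cg => [cf _] [cg _] p; apply: inner_cvg.
  - have h : q.2 @[q --> p] --> p.2 by case: p => a b; exact: cvg_snd.
    exact: (cvg_comp (fun q : R * R => q.2) f h (cf p.2)).
  - have h : q.1 @[q --> p] --> p.1 by case: p => a b; exact: cvg_fst.
    exact: (cvg_comp (fun q : R * R => q.1) g h (cg p.1)).
move=> e e0; have [A hA] := C0_norm_prod Cf Cg e0.
by exists A => p /hA; apply: le_lt_trans; rewrite rnormcE; exact: cauchy_schwarz.
Qed.

Section Kernel.
Variables (S Q S' Q' : H -> H) (K : R * R -> CC R) (M : R) (l : CC R).
Hypotheses (SK : integral_operator S K) (KK : K0_kernel K).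
Hypotheses (iQ : bounded_inverse M S l Q) (aS : adjoint S S') (aQ : adjoint Q Q').
Hypothesis bQ' : opbound M Q'.

(** The kernel of S + l S Q S, which is the Fredholm resolvent S Q. *)
Definition Rkernel : R * R -> CC R :=
  fun p => K p + l * L2_inner (Q (carleman' K p.2)) (carleman K p.1).

Let bQ : opbound M Q. Proof. by case: iQ. Qed.

Let KC0 : C0 K. Proof. by case: KK. Qed.

Lemma Rkernel_C0 : C0 Rkernel.
Proof.
have Ci : C0 (fun p : R * R => L2_inner (Q (carleman' K p.2)) (carleman K p.1) : CC R).
  by apply: (@C0_inner (Q \o carleman' K)); [apply: (C0_opbound bQ)|]; case: KK.
split.
  move=> p; rewrite /Rkernel; apply: (@cvgD _ _ _ (nbhs p)).
    by case: KC0 => + _; apply.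
  apply: (@cvgM _ _ (nbhs p)); first exact: cvg_cst.
  by case: Ci => + _; apply.
move=> e e0; case: KC0 => _ vK; case: Ci => _ vi.
have l1 : 0 < rnorm l + 1 by rewrite ltr_pwDr ?rnorm_ge0.
have [A1 h1] := vK (e / 2) (divr_gt0 e0 (ltr0Sn _ 1)).
have [A2 h2] := vi (e / 2 / (rnorm l + 1)) (divr_gt0 (divr_gt0 e0 (ltr0Sn _ 1)) l1).
exists (Num.max A1 A2) => p; rewrite gt_max => /andP[/h1 k1 /h2 k2].
apply: le_lt_trans (rnormD _ _) _.
move: k1 k2; move: (L2_inner _ _) => z k1 k2.
have : rnorm (l * z : CC R) <= e / 2.
  rewrite rnormcE Normc.normcM -!rnormcE; apply: ltW.
  apply: (@le_lt_trans _ _ ((rnorm l + 1) * rnorm (z : CC R))).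
    by rewrite ler_wpM2r ?rnorm_ge0// lerDl.
  by rewrite mulrC -ltr_pdivlMr.
by lra.
Qed.

Lemma Rkernel_cmeasurable : cmeasurable Rkernel.
Proof.
have [cR _] := Rkernel_C0.
have [h1 h2] : (forall t, continuous (fun s => Rkernel (s, t))) /\
    (forall s, continuous (fun t => Rkernel (s, t))).
  by split=> x; [exact: col_continuous|exact: row_continuous].
split.
- apply: (@separately_continuous_measurable R (fun p => complex.Re (Rkernel p))) => [t s|s].
    by apply: Re_cvg; exact: h1.
  by case: (continuous_cmeasurable (h2 s)).
- apply: (@separately_continuous_measurable R (fun p => complex.Im (Rkernel p))) => [t s|s].
    by apply: Im_cvg; exact: h1.
  by case: (continuous_cmeasurable (h2 s)).
Qed.

Let row_meas s : cmeasurable (fun t => Rkernel (s, t)).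
Proof. by apply: continuous_cmeasurable; apply: row_continuous; case: Rkernel_C0. Qed.

Let col_meas t : cmeasurable (fun s => Rkernel (s, t)).
Proof. by apply: continuous_cmeasurable; apply: col_continuous; case: Rkernel_C0. Qed.

(* Q k'(t) = k'(t) + l S (Q k'(t)), where S acts by its kernel. *)
Let colE t : {ae mu, forall s, L2_fun (Q (carleman' K t)) s = Rkernel (s, t)}.
Proof.
set q := Q _.
have qE : q = l *: S q + carleman' K t.
  by have [_ /(_ (carleman' K t))[_ /eqP]] := iQ; rewrite subr_eq addrC => /eqP.
have h1 := L2_fun_lin l (S q) (carleman' K t); rewrite -qE in h1.
have h2 := integral_operatorE SK KK q.
apply: aeS2 h1 (aeS2 (fun x => @conj _ _) h2 (carleman'E KK t)) => s -> [-> ->].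
by rewrite /Rkernel/= addrC.
Qed.

(* The same for the adjoints, where S' acts by the conjugate transpose of K. *)
Let rowE s : {ae mu, forall t, L2_fun (Q' (carleman K s)) t = conjc (Rkernel (s, t))}.
Proof.
have [_ iQ'] := adjoint_inverse iQ aS aQ bQ'.
set q := Q' _.
have qE : q = conjc l *: S' q + carleman K s.
  by have [_ /eqP] := iQ' (carleman K s); rewrite subr_eq addrC => /eqP.
have h1 := L2_fun_lin (conjc l) (S' q) (carleman K s); rewrite -qE in h1.
have h2 := adjoint_kernel SK KK aS q.
apply: aeS2 h1 (aeS2 (fun x => @conj _ _) h2 (carlemanE KK s)) => t -> [-> ->].
by rewrite /Rkernel/= conjcD conjcM addrC aQ -innerC.
Qed.

Let col_sq t : square_integrable mu (fun s => Rkernel (s, t)).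
Proof. exact: ae_eq_sq (L2_fun_sq _) (col_meas t) (colE t). Qed.

Let row_sq s : square_integrable mu (fun t => Rkernel (s, t)).
Proof.
have := sq_conj (L2_fun_sq (Q' (carleman K s))) => h.
apply: ae_eq_sq h (row_meas s) _.
by apply: aeS (rowE s) => t ->; rewrite conjcK.
Qed.

Lemma carleman'_Rkernel t : carleman' Rkernel t = Q (carleman' K t).
Proof. by apply: toL2P => //; apply: aeS (colE t) => s ->. Qed.

Lemma carleman_Rkernel s : carleman Rkernel s = Q' (carleman K s).
Proof. by apply: toL2P; [exact: sq_conj|apply: aeS (rowE s) => t ->]. Qed.

Lemma Rkernel_K0 : K0_kernel Rkernel.
Proof.
split; first by [].
- exact: Rkernel_C0.
- rewrite (_ : carleman Rkernel = Q' \o carleman K).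
    by apply: (C0_opbound bQ'); case: KK.
  by apply/funext => s; exact: carleman_Rkernel.
- rewrite (_ : carleman' Rkernel = Q \o carleman' K).
    by apply: (C0_opbound bQ); case: KK.
  by apply/funext => s; exact: carleman'_Rkernel.
Qed.

Lemma resolvent_kernelE : resolvent_kernel S l = Rkernel.
Proof.
have fE : fredholm_resolvent S l = S \o Q.
  by rewrite /fredholm_resolvent (resolventE (Q := Q))//; apply/bounded_inverseP; exists M.
have iR : integral_operator (fredholm_resolvent S l) Rkernel.
  split; first exact: Rkernel_cmeasurable.
  move=> f; apply: aeS (integral_operatorE SK KK (Q f)) => s h; split.
    by apply: square_integrableM => //; exact: L2_fun_sq.
  by rewrite (row_inner Rkernel_K0) carleman_Rkernel -aQ fE.
rewrite /resolvent_kernel; case: xgetP => [K' _ [k1 k2]|/(_ Rkernel)[]].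
  exact: K0_uniq k1 Rkernel_K0 k2 iR.
by split=> //; exact: Rkernel_K0.
Qed.

End Kernel.

End ResolventKernel.

(** * Cutting off a function *)

Section Cutoff.
Context (R : realType).
Local Notation mu := (@lebesgue_measure R).
Local Notation H := (L2R R).
Implicit Types (a : R) (f g : H).

Lemma cutoff_in a x : `|x| < a -> cutoff a x = 1.
Proof. by rewrite /cutoff indicE => xa; rewrite mem_set//= in_itv/= -ltr_norml. Qed.

Lemma cutoff_out a x : a <= `|x| -> cutoff a x = 0.
Proof.
rewrite /cutoff indicE => xa; rewrite memNset//= in_itv/= -ltr_norml.
by apply/negP; rewrite -leNgt.
Qed.

Lemma cutoff01 a x : cutoff a x = 0 \/ cutoff a x = 1.
Proof. by have [/cutoff_in|/cutoff_out] := ltP `|x| a; [right|left]. Qed.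

Lemma cutoff_conj a x : conjc (cutoff a x) = cutoff a x.
Proof. by rewrite /cutoff conjc_real. Qed.

Lemma cutoff_norm a x : Normc.normc (cutoff a x) <= 1.
Proof. by case: (cutoff01 a x) => ->; rewrite ?Normc.normc0 ?Normc.normc1. Qed.

Lemma cutoff_cmeasurable a : cmeasurable (cutoff a : R -> CC R).
Proof. by split; [apply: measurable_indic; exact: measurable_itv|exact: measurable_cst]. Qed.

Lemma cutoff_cmeasurableM a (h : R -> CC R) : cmeasurable h ->
  cmeasurable (fun x => cutoff a x * h x).
Proof. by apply: cmeasurableM; exact: cutoff_cmeasurable. Qed.

Lemma cutoff_sq a (h : R -> CC R) : square_integrable mu h ->
  square_integrable mu (fun x => cutoff a x * h x).
Proof.
move=> /square_integrableP[mh ih]; have mch := cutoff_cmeasurableM a mh.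
apply/square_integrableP; split => //; apply: le_integrable ih => //.
  by apply/measurable_EFinP/measurable_funX; exact: cmeasurable_normc.
move=> x _ /=; rewrite lee_fin !ger0_norm ?sqr_ge0// Normc.normcM exprMn.
by rewrite ler_piMl ?sqr_ge0// expr_le1// ?normc_ge0// cutoff_norm.
Qed.

Lemma cutoff_projE a f :
  {ae mu, forall x, L2_fun (cutoff_proj a f) x = cutoff a x * L2_fun f x}.
Proof. by apply: L2_fun_toL2; apply: cutoff_sq; exact: L2_fun_sq. Qed.

Lemma cutoff_proj_sqr a f :
  rnorm (cutoff_proj a f - f) ^+ 2 =
  \int[mu]_x (Normc.normc (cutoff a x * L2_fun f x - L2_fun f x) ^+ 2).
Proof.
rewrite rnormB_sqr.
have [m1 i1] := (square_integrableP mu _).1 (sq_funB (cutoff_proj a f) f).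
have mB : cmeasurable (fun x => cutoff a x * L2_fun f x - L2_fun f x).
  have := cmeasurableD (cutoff_cmeasurableM a (L2_fun_cmeasurable f))
    (cmeasurableZ (-1) (L2_fun_cmeasurable f)).
  by congr cmeasurable; apply/funext => x; rewrite fctE/= scaleN1r.
congr fine; apply: ae_eq_integral => //.
- by case/integrableP: i1.
- by apply/measurable_EFinP/measurable_funX; exact: cmeasurable_normc.
- by apply: aeS (cutoff_projE a f) => x -> _.
Qed.

Lemma cutoff_proj_linear a : linear (cutoff_proj a : H -> H).
Proof.
move=> c f g; apply/L2_funP.
have h1 := aeS2 (fun x => @conj _ _) (cutoff_projE a (c *: f + g)) (L2_fun_lin c f g).
have h2 := aeS2 (fun x => @conj _ _) (cutoff_projE a f) (cutoff_projE a g).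
have h3 := L2_fun_lin c (cutoff_proj a f) (cutoff_proj a g).
apply: aeS2 (aeS2 (fun x => @conj _ _) h1 h2) h3 => x [[e1 e2] [e3 e4]] ->.
by rewrite e1 e2 e3 e4; ring.
Qed.

Lemma cutoff_proj_selfadjoint a : adjoint (cutoff_proj a) (cutoff_proj a : H -> H).
Proof.
move=> f g; apply: ae_eq_cintegral.
- by apply: cmeasurableM; [|apply: cmeasurable_conj]; exact: L2_fun_cmeasurable.
- by apply: cmeasurableM; [|apply: cmeasurable_conj]; exact: L2_fun_cmeasurable.
- apply: aeS2 (cutoff_projE a f) (cutoff_projE a g) => x -> ->.
  by rewrite conjcM cutoff_conj; ring.
Qed.

Lemma cutoff_projK a f : cutoff_proj a (cutoff_proj a f) = cutoff_proj a f.
Proof.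
apply/L2_funP; apply: aeS2 (cutoff_projE a (cutoff_proj a f)) (cutoff_projE a f) => x -> ->.
by case: (cutoff01 a x) => ->; rewrite ?mul0r ?mul1r.
Qed.

Lemma cutoff_proj_opbound a : opbound 1 (cutoff_proj a : H -> H).
Proof.
split => //; first exact: cutoff_proj_linear.
move=> f; rewrite mul1r; have [->|n0] := eqVneq (rnorm (cutoff_proj a f)) 0.
  exact: rnorm_ge0.
have p0 : 0 < rnorm (cutoff_proj a f) by rewrite lt0r n0 rnorm_ge0.
rewrite -(ler_pM2l p0) -expr2.
have -> : rnorm (cutoff_proj a f) ^+ 2 = Normc.normc (L2_inner (cutoff_proj a f) f).
  rewrite -{2}cutoff_projK cutoff_proj_selfadjoint inner_norm /= expr0n addr0.
  by rewrite sqrtr_sqr ger0_norm// sqr_ge0.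
exact: cauchy_schwarz.
Qed.

(** Dominated convergence: the integrand is at most |f|^2 and vanishes at x as soon
    as tau n exceeds |x|. *)
Lemma cutoff_proj_cvg (tau : nat -> R) f : tau n @[n --> \oo] --> +oo ->
  cutoff_proj (tau n) f @[n --> \oo] --> f.
Proof.
move=> tauy; apply/rcvg0P.
have sq0 : rnorm (cutoff_proj (tau n) f - f) ^+ 2 @[n --> \oo] --> (0 : R).
  pose F n x := (Normc.normc (cutoff (tau n) x * L2_fun f x - L2_fun f x) ^+ 2)%:E.
  have [mf iF] := (square_integrableP mu _).1 (L2_fun_sq f).
  have mF n : measurable_fun setT (F n).
    have := cmeasurableD (cutoff_cmeasurableM (tau n) (L2_fun_cmeasurable f))
      (cmeasurableZ (-1) (L2_fun_cmeasurable f)) => m.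
    apply/measurable_EFinP/measurable_funX; have := cmeasurable_normc m.
    by congr measurable_fun; apply/funext => x; rewrite fctE/= scaleN1r.
  have F_le n x : (`|F n x| <= (Normc.normc (L2_fun f x) ^+ 2)%:E)%E.
    rewrite abse_EFin lee_fin ger0_norm ?sqr_ge0//.
    case: (cutoff01 (tau n) x) => ->; first by rewrite mul0r sub0r normcN.
    by rewrite mul1r subrr Normc.normc0 expr0n sqr_ge0.
  have F_cvg x : F n x @[n --> \oo] --> 0%E.
    apply: cvg_near_cst; have /cvgryPgt/(_ `|x|) := tauy.
    apply: filterS => n xn; rewrite /F cutoff_in// mul1r subrr Normc.normc0.
    by rewrite expr0n.
  have := @dominated_cvg _ _ _ mu setT measurableT F (cst 0%E)
    (fun x => (Normc.normc (L2_fun f x) ^+ 2)%:E) mF (fun x _ => F_cvg x)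
    (fun x _ => erefl) iF (fun n x _ => F_le n x).
  rewrite integral0 => /fine_cvg.
  rewrite (_ : (fun n => rnorm (cutoff_proj (tau n) f - f) ^+ 2) =
    (fine \o (fun n => \int[mu]_x F n x)%E))//.
  by apply/funext => n; rewrite cutoff_proj_sqr.
apply/cvgrPdist_lt => e e0.
have /cvgrPdist_lt/(_ _ (exprn_gt0 2 e0)) := sq0.
apply: filterS => n; rewrite !sub0r !normrN !ger0_norm ?sqr_ge0 ?rnorm_ge0//.
by rewrite ltr_sqr ?nnegrE ?rnorm_ge0// ltW.
Qed.

End Cutoff.

(** * Suprema, and nabla_s through inverses *)

Section Esup.
Context (R : realType) (X : Type).
Implicit Types (A : set X) (g : X -> R).

Lemma esup_ge0 A g : (0 <= esup A g)%E.
Proof. by apply: ereal_sup_ubound; left. Qed.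

Lemma esup_le A g (b : R) : 0 <= b -> (forall x, A x -> g x <= b) -> (esup A g <= b%:E)%E.
Proof.
move=> b0 gb; apply: ge_ereal_sup => _ [->|[x Ax <-]]; rewrite lee_fin//.
exact: gb.
Qed.

Lemma le_esup A g x : A x -> ((g x)%:E <= esup A g)%E.
Proof. by move=> Ax; apply: ereal_sup_ubound; right; exists x. Qed.

Lemma esup_cvg0 A (g : nat -> X -> R) :
  (forall e, 0 < e -> \forall n \near \oo, forall x, A x -> g n x < e) ->
  esup A (g n) @[n --> \oo] --> 0%E.
Proof.
move=> h; apply/fine_cvgP; split.
  apply: filterS (h 1 ltr01) => n hn.
  rewrite ge0_fin_numE ?esup_ge0//; apply: le_lt_trans (esup_le ler01 _) (ltry 1).
  by move=> x /hn /ltW.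
apply/cvgrPdist_le => e e0; apply: filterS (h e e0) => n hn.
have le_e : (esup A (g n) <= e%:E)%E by apply: esup_le; [exact: ltW|move=> x /hn /ltW].
rewrite sub0r normrN ger0_norm /= ?fine_ge0 ?esup_ge0//.
by rewrite -lee_fin fineK// ge0_fin_numE ?esup_ge0// (le_lt_trans le_e) ?ltry.
Qed.

End Esup.

Section Nabla.
Context (R : realType).
Local Notation H := (L2R R).
Implicit Types (S Q : H -> H) (M : R) (l b : CC R).

Lemma opnorm_le S M : linear S -> 0 <= M ->
  (opnorm S <= M%:E)%E <-> (forall f, rnorm (S f) <= M * rnorm f).
Proof.
move=> lS M0; split => [SM f|SM]; last first.
  by apply: esup_le => // f /= f1; apply: le_trans (SM f) _; rewrite ler_piMr.
have [f0|fn0] := eqVneq (rnorm f) 0.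
  by rewrite (rnorm0_eq0 f0) (lin0 lS) rnorm0 mulr0.
have f0 : 0 < rnorm f by rewrite lt0r fn0 rnorm_ge0.
pose c : CC R := ((rnorm f)^-1)%:C.
have cE : rnorm c = (rnorm f)^-1.
  by rewrite rnormcE /= expr0n addr0 sqrtr_sqr ger0_norm// invr_ge0 ltW.
have := le_trans (le_esup (fun f => rnorm (S f)) (_ : [set f | rnorm f <= 1] (c *: f))) SM.
rewrite /= (linZ lS) !rnormZ cE mulVf// lexx lee_fin => /(_ isT).
by rewrite mulrC ler_pdivrMr.
Qed.

(** This lemma and the next one rest on
    I - l (b I + S) = (1 - b l) (I - (l / (1 - b l)) S). *)
Lemma perturbed_inverse b S l Q M : 1 - b * l != 0 -> linear S ->
  bounded_inverse M (fun f => b *: f + S f) l Q ->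
  bounded_inverse (rnorm (1 - b * l : CC R) * M) S (l / (1 - b * l)) (fun f => (1 - b * l) *: Q f).
Proof.
move=> c0 lS [[lQ M0 hQ] iQ]; set c := 1 - b * l in c0 *.
have E f : f - l *: (b *: f + S f) = c *: (f - (l / c) *: S f).
  rewrite scalerBr scalerA mulrCA mulfV// mulr1 scalerDr opprD addrA /c scalerBl scale1r.
  by rewrite scalerA (mulrC l).
split; last first.
  move=> f; split; first by rewrite -(linZ lQ) -E (iQ f).1.
  by rewrite (linZ lS) !scalerA mulrC -scalerA -scalerBr -E (iQ f).2.
split.
- by move=> a u v; rewrite lQ scalerDr !scalerA mulrC.
- by rewrite mulr_ge0// rnorm_ge0.
- by move=> f; rewrite rnormZ -mulrA ler_wpM2l ?rnorm_ge0.
Qed.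

Lemma inverse_perturbed b S l Q M : 1 - b * l != 0 -> linear S ->
  bounded_inverse M S (l / (1 - b * l)) Q ->
  bounded_inverse (rnorm ((1 - b * l)^-1 : CC R) * M) (fun f => b *: f + S f) l
    (fun f => (1 - b * l)^-1 *: Q f).
Proof.
move=> c0 lS [[lQ M0 hQ] iQ]; set c := 1 - b * l in c0 *.
have E f : f - l *: (b *: f + S f) = c *: (f - (l / c) *: S f).
  rewrite scalerBr scalerA mulrCA mulfV// mulr1 scalerDr opprD addrA /c scalerBl scale1r.
  by rewrite scalerA (mulrC l).
split; last first.
  move=> f; split; first by rewrite E (linZ lQ) (iQ f).1 scalerA mulVf// scale1r.
  rewrite E (linZ lS) [_ *: (c^-1 *: S _)]scalerA mulrC -scalerA -scalerBr (iQ f).2.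
  by rewrite scalerA mulfV// scale1r.
split.
- by move=> a u v; rewrite lQ scalerDr !scalerA mulrC.
- by rewrite mulr_ge0// rnorm_ge0.
- by move=> f; rewrite rnormZ -mulrA ler_wpM2l ?rnorm_ge0.
Qed.

Variables (beta : nat -> CC R).
Hypothesis beta0 : beta n @[n --> \oo] --> (0 : CC R).

(** Here and below the index n and the parameter l vary together along a filter:
    this is what makes the limits uniform in l on compact sets. *)
Lemma lambda_denom_cvg (I : Type) (F : set_system I) {FF : Filter F}
    (n_ : I -> nat) (l_ : I -> CC R) l : n_ i @[i --> F] --> \oo -> l_ i @[i --> F] --> l ->
  (1 - beta (n_ i) * l_ i : CC R) @[i --> F] --> (1 : CC R).
Proof.
move=> n_y l_l.
have bn : beta (n_ i) @[i --> F] --> (0 : CC R) by exact: (cvg_comp n_ beta n_y beta0).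
have h : (beta (n_ i) * l_ i : CC R) @[i --> F] --> (0 * l : CC R).
  exact: rcvgM.
apply: (rcvg_squeeze (g := fun i => rnorm (beta (n_ i) * l_ i : CC R))).
  by apply: nearW => i; rewrite addrC addrA addNr add0r rnormN.
by move/rcvg0P : h; rewrite mul0r; under eq_fun do rewrite subr0.
Qed.

Lemma lambda_denom_neq0 (I : Type) (F : set_system I) {FF : Filter F}
    (n_ : I -> nat) (l_ : I -> CC R) l : n_ i @[i --> F] --> \oo -> l_ i @[i --> F] --> l ->
  \forall i \near F, 1 - beta (n_ i) * l_ i != 0.
Proof.
move=> n_y l_l.
have h : (1 - beta (n_ i) * l_ i : CC R) @[i --> F] --> (1 : CC R).
  exact: (lambda_denom_cvg n_y l_l).
apply: filterS ((rcvgP _ _).1 h 1 ltr01) => i; apply: contraTneq => ->.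
by rewrite sub0r rnormN rnormcE Normc.normc1 ltxx.
Qed.

Lemma lambda_cvg (I : Type) (F : set_system I) {FF : Filter F}
    (n_ : I -> nat) (l_ : I -> CC R) l : n_ i @[i --> F] --> \oo -> l_ i @[i --> F] --> l ->
  (lambda_ beta (n_ i) (l_ i) : CC R) @[i --> F] --> (l : CC R).
Proof.
move=> n_y l_l; have d1 := lambda_denom_cvg n_y l_l.
have h : ((1 - beta (n_ i) * l_ i)^-1 : CC R) @[i --> F] --> (1 : CC R).
  exact: (rcvgV1 (d1 _)).
have : (l_ i * (1 - beta (n_ i) * l_ i)^-1 : CC R) @[i --> F] --> (l * 1 : CC R).
  exact: (rcvgM l_l h).
by rewrite mulr1.
Qed.

Lemma resolventP S l : regular_values S l -> inverse_of_id_sub S l (resolvent S l).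
Proof. by move=> [Q hQ]; rewrite (resolventE hQ). Qed.

Lemma bounded_inverse_le M M' S l Q : M <= M' -> bounded_inverse M S l Q -> bounded_inverse M' S l Q.
Proof.
move=> MM' [[lQ M0 hQ] iQ]; split=> //; split=> //; first exact: le_trans MM'.
by move=> f; apply: le_trans (hQ f) _; rewrite ler_wpM2r ?rnorm_ge0.
Qed.

(** Used to pass between Q and the Fredholm resolvent S Q. *)
Lemma inverseE S l Q f : inverse_of_id_sub S l Q -> Q f = f + l *: S (Q f).
Proof. by move=> [_ /(_ f)[_ h]]; rewrite -{2}h subrK. Qed.

(** As 1 - beta_n l tends to 1 and is not 0 for large n, bounds and limits pass between
    the inverses of I - l (beta_n I + S_n) and those of I - lambda_n S_n; as l is
    not 0, they pass between the inverses and the Fredholm resolvents. *)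
Lemma nabla_sP (S_ : nat -> H -> H) l : (forall n, linear (S_ n)) ->
  nabla_s (perturbed beta S_) l <-> l != 0 /\ exists (Q_ : nat -> H -> H) M,
    (\forall n \near \oo, 1 - beta n * l != 0 /\
       bounded_inverse M (S_ n) (lambda_ beta n l) (Q_ n)) /\
    forall f, cvg (Q_ n f @[n --> \oo]).
Proof.
move=> lS; pose P n := perturbed beta S_ n.
have lP n : linear (P n).
  by move=> a u v; rewrite /P /perturbed lS !scalerDr !scalerA (mulrC a) addrACA.
have c1 : (1 - beta n * l : CC R) @[n --> \oo] --> (1 : CC R).
  exact: (lambda_denom_cvg (n_ := id) cvg_id (cvg_cst l)).
have cn0 : \forall n \near \oo, 1 - beta n * l != 0.
  exact: (lambda_denom_neq0 (n_ := id) cvg_id (cvg_cst l)).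
split.
- move=> [[l0 [M [N [M0 N0 hN]]]] cv]; split=> //.
  exists (fun n f => (1 - beta n * l) *: resolvent (P n) l f), (2 * (1 + rnorm l * M)).
  have reg : \forall n \near \oo, bounded_inverse (1 + rnorm l * M) (P n) l (resolvent (P n) l).
    apply: filterS (nbhs_infty_gtr N) => n /hN[/resolventP rn opn].
    have [M' [[lQ M'0 hQ] iQ]] := (bounded_inverseP _ _ _).1 rn.
    have hS : forall f, rnorm (P n (resolvent (P n) l f)) <= M * rnorm f.
      by apply/(opnorm_le _ (ltW M0)) => // a u v /=; rewrite lQ lP.
    split=> //; split=> //; first by rewrite addr_ge0// mulr_ge0 ?rnorm_ge0// ltW.
    move=> f; rewrite (inverseE f rn) mulrDl mul1r; apply: le_trans (rnormD _ _) _.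
    by rewrite lerD2l rnormZ -mulrA ler_wpM2l ?rnorm_ge0.
  split.
    have hc : \forall n \near \oo, rnorm (1 - beta n * l - 1 : CC R) < 1.
      exact: (rcvgP _ _).1 c1 1 ltr01.
    apply: filterS3 cn0 reg hc => n n0 rn cn.
    split=> //; apply: bounded_inverse_le (perturbed_inverse n0 (lS n) rn).
    rewrite ler_wpM2r//; first by rewrite addr_ge0// mulr_ge0 ?rnorm_ge0// ltW.
    have := rnormD (1 - beta n * l - 1 : CC R) 1; rewrite subrK (_ : rnorm (1 : CC R) = 1).
      by lra.
    by rewrite rnormcE Normc.normc1.
  move=> f; apply/cvg_ex; have /cvg_ex[v hv] := cv f; exists (1 *: (f + l *: v)).
  apply: (rcvgZ c1).
  have h : f + l *: fredholm_resolvent (P n) l f @[n --> \oo] --> f + l *: v.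
    have hl := rcvgZ (cvg_cst l) hv.
    by apply: cvgD; [exact: cvg_cst|exact: hl].
  apply: cvg_trans h; apply: near_eq_cvg; apply: filterS reg => n rn.
  by rewrite /fredholm_resolvent/= -inverseE//; apply/bounded_inverseP; eexists; exact: rn.
- move=> [l0 [Q_ [M [hQ cv]]]].
  have c2 : ((1 - beta n * l)^-1 : CC R) @[n --> \oo] --> (1 : CC R).
    exact: rcvgV1.
  have reg : \forall n \near \oo, bounded_inverse (2 * M) (P n) l (fun f => (1 - beta n * l)^-1 *: Q_ n f).
    have hc : \forall n \near \oo, rnorm ((1 - beta n * l)^-1 - 1 : CC R) < 1.
      exact: (rcvgP _ _).1 c2 1 ltr01.
    apply: filterS2 hQ hc => n [n0 rn] cn.
    apply: bounded_inverse_le (inverse_perturbed n0 (lS n) rn).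
    rewrite ler_wpM2r//; first by case: rn => -[].
    have := rnormD ((1 - beta n * l)^-1 - 1 : CC R) 1; rewrite subrK (_ : rnorm (1 : CC R) = 1).
      by lra.
    by rewrite rnormcE Normc.normc1.
  have frE n f : bounded_inverse (2 * M) (P n) l (fun f => (1 - beta n * l)^-1 *: Q_ n f) ->
      fredholm_resolvent (P n) l f = l^-1 *: ((1 - beta n * l)^-1 *: Q_ n f - f).
    move=> rn; have rn' : inverse_of_id_sub (P n) l (fun f => (1 - beta n * l)^-1 *: Q_ n f).
      by apply/bounded_inverseP; eexists; exact: rn.
    rewrite /fredholm_resolvent/= (resolventE rn') {2}(inverseE f rn').
    by rewrite addrAC subrr add0r scalerA mulVf// scale1r.
  split.
    split=> //.
    have [N _ hN] := reg.
    exists (rnorm (l^-1 : CC R) * (2 * M + 1) + 1), N.+1%:R.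
    have M0 : 0 <= M by have [[_ M2 _] _] := hN N (leqnn N); lra.
    have B0 : 0 <= rnorm (l^-1 : CC R) * (2 * M + 1).
      by rewrite mulr_ge0 ?rnorm_ge0// addr_ge0// mulr_ge0.
    split; rewrite ?ltr0n//; first lra.
    move=> n; rewrite ltr_nat => /ltnW/ltnW/hN rn; split.
      by exists (fun f => (1 - beta n * l)^-1 *: Q_ n f); apply/bounded_inverseP; eexists; exact: rn.
    have [[lQ _ bQ] _] := rn.
    apply/opnorm_le; [|by lra|].
      have rn' : inverse_of_id_sub (P n) l (fun f => (1 - beta n * l)^-1 *: Q_ n f).
        by apply/bounded_inverseP; eexists; exact: rn.
      move=> a u v; rewrite /fredholm_resolvent (resolventE rn').
      by have := congr1 (P n) (lQ a u v); rewrite lP.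
    move=> f; rewrite (frE n f rn) rnormZ.
    apply: (@le_trans _ _ (rnorm (l^-1 : CC R) * (2 * M + 1) * rnorm f)); last first.
      by rewrite ler_wpM2r ?rnorm_ge0// lerDl.
    rewrite -mulrA ler_wpM2l ?rnorm_ge0//; apply: le_trans (rnorm_sub _ _) _.
    by rewrite mulrDl mul1r lerD2r; exact: bQ.
  move=> f; apply/cvg_ex; have /cvg_ex[v hv] := cv f; exists (l^-1 *: (1 *: v - f)).
  have h : l^-1 *: ((1 - beta n * l)^-1 *: Q_ n f - f) @[n --> \oo] --> l^-1 *: (1 *: v - f).
    have h1 := rcvgZ c2 hv.
    have h2 : (1 - beta n * l)^-1 *: Q_ n f - f @[n --> \oo] --> 1 *: v - f.
      by apply: cvgB; [exact: h1|exact: cvg_cst].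
    exact: (rcvgZ (cvg_cst l^-1) h2).
  apply: cvg_trans h; apply: near_eq_cvg; apply: filterS reg => n rn.
  by rewrite -frE.
Qed.

End Nabla.

(** * Exchanging factors, and uniform convergence *)

Section Swap.
Context (R : realType).
Local Notation H := (L2R R).
Implicit Types (S Q : H -> H) (M : R) (l b : CC R).

Lemma equibounded_cvg (I : Type) (F : set_system I) {FF : Filter F} M
    (Q_ : I -> H -> H) (y_ : I -> H) (y z : H) :
  (\forall i \near F, opbound M (Q_ i)) -> Q_ i y @[i --> F] --> z ->
  y_ i @[i --> F] --> y -> Q_ i (y_ i) @[i --> F] --> z.
Proof.
move=> bQ /rcvg0P Qy /rcvg0P yy.
apply: (rcvg_squeeze (g := fun i => M * rnorm (y_ i - y) + rnorm (Q_ i y - z))).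
  apply: filterS bQ => i [lQ _ hQ]; apply: le_trans (rnorm_dist _ _ (Q_ i y)) _.
  by rewrite lerD2r -(linB lQ).
rewrite (_ : 0 = M * 0 + 0); last by rewrite mulr0 addr0.
by apply: cvgD => //; apply: cvgM => //; exact: cvg_cst.
Qed.

Variables (beta : nat -> CC R).
Hypothesis beta0 : beta n @[n --> \oo] --> (0 : CC R).

(** The inverses for B_n A_n are I + l_n B_n Q_n A_n, where Q_n are those for A_n B_n;
    a product of uniformly bounded, strongly convergent operators converges
    strongly. *)
Lemma nabla_s_swap (A_ B_ : nat -> H -> H) (A B : H -> H) (a b : R) l :
  (forall n, opbound a (A_ n)) -> (forall n, opbound b (B_ n)) ->
  (forall f, A_ n f @[n --> \oo] --> A f) -> (forall f, B_ n f @[n --> \oo] --> B f) ->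
  nabla_s (perturbed beta (fun n => A_ n \o B_ n)) l ->
  nabla_s (perturbed beta (fun n => B_ n \o A_ n)) l.
Proof.
move=> bA bB cA cB.
have lin S1 S2 a1 a2 : opbound a1 S1 -> opbound a2 S2 -> linear (S1 \o S2 : H -> H).
  by move=> h1 h2; case: (opbound_comp h1 h2).
move/(nabla_sP beta0 l (fun n => lin _ _ _ _ (bA n) (bB n))) => [l0 [Q_ [M [hQ cQ]]]].
apply/(nabla_sP beta0 l (fun n => lin _ _ _ _ (bB n) (bA n))); split=> //.
have lam : (lambda_ beta n l : CC R) @[n --> \oo] --> (l : CC R).
  exact: (lambda_cvg beta0 (n_ := id) cvg_id (cvg_cst l)).
have laml : \forall n \near \oo, rnorm (lambda_ beta n l - l : CC R) < 1.
  exact: (rcvgP _ _).1 lam 1 ltr01.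
have [N _ hN] := hQ.
have M0 : 0 <= M by have [_ [[_ h _] _]] := hN N (leqnn N).
have a0 : 0 <= a by case: (bA 0%N).
have b0 : 0 <= b by case: (bB 0%N).
exists (fun n f => f + lambda_ beta n l *: B_ n (Q_ n (A_ n f))),
  (1 + (rnorm l + 1) * (b * M * a)).
split.
  apply: filterS2 hQ laml => n [n0 rn] hl; split=> //.
  apply: bounded_inverse_le (inverse_swap (bA n) (bB n) rn).
  rewrite lerD2l ler_wpM2r ?mulr_ge0//.
  by have := rnormD (lambda_ beta n l - l : CC R) l; rewrite subrK; lra.
move=> f; have /cvg_ex[q hq] := cQ (A f).
have h1 : Q_ n (A_ n f) @[n --> \oo] --> q.
  apply: (equibounded_cvg (M := M) _ hq (cA f)).
  by apply: filterS hQ => n [_ []].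
have h2 : B_ n (Q_ n (A_ n f)) @[n --> \oo] --> B q.
  apply: (equibounded_cvg (M := b) _ (cB q) h1).
  exact: nearW.
apply/cvg_ex; exists (f + l *: B q).
have h3 := rcvgZ lam h2.
by apply: cvgD; [exact: cvg_cst|exact: h3].
Qed.

End Swap.

Section Adj.
Context (R : realType).
Local Notation H := (L2R R).
Implicit Types (S Q : H -> H) (M : R) (l b : CC R).

(** The value is meaningful for a bounded S only. *)
Definition adj S : H -> H := xget (id : H -> H) [set S' | adjoint S S'].

(** The adjoint is unique, since an element is determined by its inner products. *)
Lemma adjP M S : opbound M S -> adjoint S (adj S) /\ opbound M (adj S).
Proof.
move=> bS; have [S' [aS bS']] := adjoint_exists bS.
rewrite /adj; case: xgetP => [S'' _ aS''|/(_ S')//].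
split=> //; rewrite (_ : S'' = S')//; apply/funext => g; apply: inner_ext => w.
by rewrite -aS -aS''.
Qed.

End Adj.

Section Uniformity.
Context (R : realType).

Lemma compact_uniform (X : topologicalType) (A : set X) (P : nat -> X -> Prop) :
  compact A ->
  (forall x, A x -> \forall p \near filter_prod (nbhs x) \oo, P p.2 p.1) ->
  \forall n \near \oo, forall x, A x -> P n x.
Proof. by move=> /compact_near_coveringP cA h; apply: (cA _ \oo P). Qed.

Lemma esup_compact_cvg0 (X : topologicalType) (A : set X) (g : nat -> X -> R) :
  compact A ->
  (forall x : X, A x -> g p.2 p.1 @[p --> filter_prod (nbhs x) \oo] --> (0 : R)) ->
  esup A (g n) @[n --> \oo] --> 0%E.
Proof.
move=> cA h; apply: esup_cvg0 => e e0.
apply: (@compact_uniform X A (fun n x => g n x < e)) => // x Ax.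
have /cvgrPdist_lt/(_ e e0) := h x Ax; apply: filterS => p.
by rewrite sub0r normrN; apply: le_lt_trans; exact: ler_norm.
Qed.

(** Uniform convergence on the whole space: locally uniform convergence and
    uniform smallness at infinity. *)
Lemma esup_space_cvg0 (V : normedModType R) (g : nat -> V -> R) :
  (forall A : R, exists2 B : set V, compact B & forall x : V, `|x| <= A -> B x) ->
  (forall x : V, g p.2 p.1 @[p --> filter_prod (nbhs x) \oo] --> (0 : R)) ->
  (forall e, 0 < e -> exists A, \forall n \near \oo, forall x : V, A < `|x| -> g n x < e) ->
  esup setT (g n) @[n --> \oo] --> 0%E.
Proof.
move=> cB h v; apply: esup_cvg0 => e e0.
have [A hA] := v e e0; have [B cptB AB] := cB A.
have hB : \forall n \near \oo, forall x, B x -> g n x < e.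
  apply: (@compact_uniform V B (fun n x => g n x < e)) => // x Bx.
  have /cvgrPdist_lt/(_ e e0) := h x; apply: filterS => p.
  by rewrite sub0r normrN; apply: le_lt_trans; exact: ler_norm.
apply: filterS2 hA hB => n h1 h2 x _.
by have [/h1//|/AB/h2] := ltP A `|x|.
Qed.

Lemma bounded_compact_R (A : R) : exists2 B : set R, compact B & forall x : _, `|x| <= A -> B x.
Proof.
exists `[- A, A]%classic; first exact: segment_compact.
by move=> x; rewrite /= in_itv/= -ler_norml.
Qed.

Lemma bounded_compact_R2 (A : R) :
  exists2 B : set (R * R), compact B & forall x : _, `|x| <= A -> B x.
Proof.
exists (`[- A, A]%classic `*` `[- A, A]%classic).
  by apply: compact_setX; exact: segment_compact.
move=> -[x y]; rewrite prod_normE/= ge_max => /andP[hx hy].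
by split; rewrite /= in_itv/= -ler_norml.
Qed.

End Uniformity.

(** * The truncated operators *)

Section ResolventFacts.
Context (R : realType).
Local Notation mu := (@lebesgue_measure R).
Local Notation H := (L2R R).

Lemma resolvent_facts (S : H -> H) (K : R * R -> CC R) (B M : R) (l : CC R) :
  opbound B S -> integral_operator S K -> K0_kernel K ->
  bounded_inverse M S l (resolvent S l) ->
  [/\ resolvent_kernel S l = Rkernel (resolvent S l) K l,
      forall t, carleman' (resolvent_kernel S l) t = resolvent S l (carleman' K t) &
      forall s, carleman (resolvent_kernel S l) s = adj (resolvent S l) (carleman K s)].
Proof.
move=> bS SK KK iQ; have [bQ _] := iQ.
have [aQ bQ'] := adjP bQ; have [aS _] := adjP bS.
have E := resolvent_kernelE SK KK iQ aS aQ bQ'.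
split=> // x; rewrite E.
- exact: (carleman'_Rkernel SK KK iQ).
- exact: (carleman_Rkernel SK KK iQ aS aQ bQ').
Qed.

End ResolventFacts.

Section Perturbation.
Context (R : realType).
Local Notation H := (L2R R).

Lemma bounded_inverse_resolvent M (S : H -> H) (l : CC R) Q :
  bounded_inverse M S l Q -> bounded_inverse M S l (resolvent S l).
Proof. by move=> iQ; rewrite (resolventE (Q := Q))//; apply/bounded_inverseP; exists M. Qed.

(** The inverses of I - l S stay bounded by 2 M for l near l0, where M bounds the
    inverse at l0 only; all local uniformity in l rests on this. *)
Lemma inverse_near C M (S : H -> H) (l0 l : CC R) Q : opbound C S -> bounded_inverse M S l0 Q ->
  rnorm (l - l0) * (C * M) <= 2^-1 -> bounded_inverse (2 * M) S l (resolvent S l).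
Proof.
move=> [lS C0 hS] iQ small.
have c0 : 0 <= rnorm (l - l0) * C by rewrite mulr_ge0 ?rnorm_ge0.
have hc x : rnorm (l *: S x - l0 *: S x) <= rnorm (l - l0) * C * rnorm x.
  by rewrite -scalerBl rnormZ -mulrA ler_wpM2l ?rnorm_ge0.
rewrite mulrA in small.
by have [Q' /bounded_inverse_resolvent] := inverse_perturb iQ lS lS c0 hc small.
Qed.

Lemma inverse_small C (S : H -> H) (l : CC R) : opbound C S ->
  rnorm l * C <= 2^-1 -> bounded_inverse (2 * 1) S l (resolvent S l).
Proof.
move=> bS small; apply: (@inverse_near C 1 S 0 l id) => //; last by rewrite subr0 mulr1.
split; first by split => // f; rewrite mul1r.
by move=> f; rewrite scale0r subr0.
Qed.

(** Products of uniformly bounded operators converge strongly with their factors, so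
    both equations between Q_n and I - l_n S_n pass to the limit. *)
Lemma inverse_limit C M (S_ : nat -> H -> H) (S : H -> H) (l_ : nat -> CC R) (l : CC R)
    (Q_ : nat -> H -> H) : (forall n, opbound C (S_ n)) -> (forall f, S_ n f @[n --> \oo] --> S f) ->
  linear S -> l_ n @[n --> \oo] --> l ->
  (\forall n \near \oo, bounded_inverse M (S_ n) (l_ n) (Q_ n)) ->
  (forall f, cvg (Q_ n f @[n --> \oo])) -> exists Q, bounded_inverse M S l Q.
Proof.
move=> bS cS lS ll hQ cQ.
have ex f : exists q : H, Q_ n f @[n --> \oo] --> q by apply/cvg_ex; exact: cQ.
have [q hq] := choice ex.
have uniq (u : nat -> H) (a b : H) : u n @[n --> \oo] --> a -> u n @[n --> \oo] --> b -> a = b.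
  by move=> h1 h2; exact: (rcvg_unique h1 h2).
have bQ : \forall n \near \oo, opbound M (Q_ n) by apply: filterS hQ => n [].
have [N [_ M0 _]] := filter_ex bQ.
exists q; split; first split => //.
- move=> a u v; apply: (uniq _ _ _ (hq _)).
  have h : a *: Q_ n u + Q_ n v @[n --> \oo] --> a *: q u + q v.
    by have h1 := rcvgZ (cvg_cst (a : CC R)) (hq u); apply: cvgD; [exact: h1|exact: hq].
  apply: cvg_trans h; apply: near_eq_cvg; apply: filterS bQ => n [lQ _ _].
  by rewrite lQ.
- move=> f; apply/ler_addgt0Pr => e e0.
  have hn : \forall n \near \oo, rnorm (Q_ n f - q f) < e by exact: (rcvgP _ _).1 (hq f) e e0.
  have [n [[_ _ bn] dn]] := filter_ex (filterI bQ hn).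
  have := rnormD (q f - Q_ n f) (Q_ n f); rewrite subrK (rnormB (q f)).
  by have := bn f; lra.
- move=> f; split.
  + have h1 : f - l_ n *: S_ n f @[n --> \oo] --> f - l *: S f.
      by have h2 := rcvgZ ll (cS f); apply: cvgB; [exact: cvg_cst|exact: h2].
    have h3 : Q_ n (f - l_ n *: S_ n f) @[n --> \oo] --> q (f - l *: S f).
      exact: (equibounded_cvg bQ (hq _) h1).
    apply: (uniq _ _ _ h3); apply: cvg_near_cst.
    by apply: filterS hQ => n [_ /(_ f)[->]].
  + have bS' : \forall n \near \oo, opbound C (S_ n) by apply: nearW.
    have h1 : S_ n (Q_ n f) @[n --> \oo] --> S (q f).
      exact: (equibounded_cvg bS' (cS (q f)) (hq f)).
    have h2 : Q_ n f - l_ n *: S_ n (Q_ n f) @[n --> \oo] --> q f - l *: S (q f).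
      by have h2 := rcvgZ ll h1; apply: cvgB; [exact: hq|exact: h2].
    apply: (uniq _ _ _ h2); apply: cvg_near_cst.
    by apply: filterS hQ => n [_ /(_ f)[_ ->]].
Qed.

End Perturbation.

Section Truncations.
Context (R : realType).
Local Notation mu := (@lebesgue_measure R).
Local Notation H := (L2R R).
Variables (T : H -> H) (K : R * R -> CC R) (tau : nat -> R) (beta : nat -> CC R) (C : R).
Hypotheses (T_bd : opbound C T) (T_int : integral_operator T K) (K_K0 : K0_kernel K).
Hypothesis tauy : tau n @[n --> \oo] --> +oo.
Hypothesis beta0 : beta n @[n --> \oo] --> (0 : CC R).

Let P n : H -> H := cutoff_proj (tau n).
Let Tn := T_trunc tau T.
Let Kt n : R * R -> CC R := fun p => cutoff (tau n) p.1 * K p.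
Hypothesis Kt_K0 : forall n, K0_kernel (Kt n).

Let P_bd n : opbound 1 (P n).
Proof. exact: cutoff_proj_opbound. Qed.

Lemma trunc_opbound n : opbound C (Tn n).
Proof. by have := opbound_comp (P_bd n) T_bd; rewrite mul1r. Qed.

Section Limits.
Variables (I : Type) (F : set_system I).
Context {FF : Filter F}.
Variable n_ : I -> nat.
Hypothesis n_y : n_ i @[i --> F] --> \oo.

Lemma proj_cvg (y_ : I -> H) (y : H) : y_ i @[i --> F] --> y ->
  P (n_ i) (y_ i) @[i --> F] --> y.
Proof.
move=> yy.
have h1 : \forall i \near F, opbound 1 (P (n_ i)) by apply: nearW => i; exact: P_bd.
have h2 : P (n_ i) y @[i --> F] --> y.
  have hP : P n y @[n --> \oo] --> y by exact: cutoff_proj_cvg.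
  by apply: (cvg_comp _ _ n_y hP).
exact: (equibounded_cvg (Q_ := fun i => P (n_ i)) h1 h2 yy).
Qed.

Lemma trunc_cvg y : Tn (n_ i) y @[i --> F] --> T y.
Proof. by apply: proj_cvg; exact: cvg_cst. Qed.

Lemma trunc_adj_cvg y : adj T (P (n_ i) y) @[i --> F] --> adj T y.
Proof.
have [_ bT'] := adjP T_bd; apply: (opbound_cvg bT').
by apply: proj_cvg; exact: cvg_cst.
Qed.

Lemma cutoff_near1 (s_ : I -> R) (s : R) : s_ i @[i --> F] --> s ->
  \forall i \near F, cutoff (tau (n_ i)) (s_ i) = 1.
Proof.
move=> ss; have h1 : \forall i \near F, `|s| + 1 < tau (n_ i).
  have h : \forall n \near \oo, `|s| + 1 < tau n.
    by move/cvgryPgt : tauy => /(_ (`|s| + 1)).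
  exact: n_y h.
have h2 : \forall i \near F, `|s - s_ i| < 1 by move/cvgrPdist_lt : ss; apply.
apply: filterS2 h1 h2 => i h1 h2; apply: cutoff_in; apply: le_lt_trans h1.
have := ler_normD s (s_ i - s); rewrite addrC subrK (distrC (s_ i)); lra.
Qed.

End Limits.

Lemma trunc_integral n : integral_operator (Tn n) (Kt n).
Proof.
split.
  apply: cmeasurableM; last exact: T_int.1.
  have [h1 h2] := @cutoff_cmeasurable R (tau n).
  by split; [exact: (measurableT_comp h1)|exact: (measurableT_comp h2)].
move=> f; have := aeS2 (fun x => @conj _ _) (T_int.2 f) (cutoff_projE (tau n) (T f)).
apply: aeS => s [[i1 e1] e2].
have E : (fun t => Kt n (s, t) * L2_fun f t) =
    (fun t => cutoff (tau n) s * (K (s, t) * L2_fun f t)).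
  by apply/funext => t; rewrite /Kt/= mulrA.
rewrite E; split; first exact: cintegrableZ.
by rewrite cintegralZ// -e1; exact: e2.
Qed.

Lemma carleman_trunc n s : carleman (Kt n) s = cutoff (tau n) s *: carleman K s.
Proof.
apply: toL2P; first by apply: sq_conj; case: (Kt_K0 n) => + _ _ _ => /(_ s)[].
have := aeS2 (fun x => @conj _ _) (L2_funZ (cutoff (tau n) s) (carleman K s)) (carlemanE K_K0 s).
by apply: aeS => t [-> ->]; rewrite /Kt /= conjcM cutoff_conj.
Qed.

Lemma carleman'_trunc n t : carleman' (Kt n) t = P n (carleman' K t).
Proof.
apply: toL2P; first by case: (Kt_K0 n) => + _ _ _ => /(_ t)[].
have := aeS2 (fun x => @conj _ _) (cutoff_projE (tau n) (carleman' K t)) (carleman'E K_K0 t).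
by apply: aeS => s [-> ->].
Qed.

(** T_n = P_n T_n and T~_n = T_n P_n. *)
Lemma nabla_s_trunc2 : nabla_s (perturbed beta (T_trunc2 tau T)) = nabla_s (perturbed beta Tn).
Proof.
have TnE : Tn = (fun n => P n \o Tn n).
  by apply/funext => n; apply/funext => f; rewrite /Tn /T_trunc /P /= cutoff_projK.
have T2E : T_trunc2 tau T = (fun n => Tn n \o P n) by [].
have cT f : Tn n f @[n --> \oo] --> T f by exact: (trunc_cvg (n_ := id) cvg_id).
have cP f : P n f @[n --> \oo] --> (id : H -> H) f by exact: cutoff_proj_cvg.
apply/seteqP; split => l.
- rewrite T2E => h; rewrite {1}TnE.
  exact: (nabla_s_swap beta0 trunc_opbound P_bd cT cP h).
- rewrite {1}TnE T2E => h.
  exact: (nabla_s_swap beta0 P_bd trunc_opbound cP cT h).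
Qed.

Let Ds := nabla_s (perturbed beta Tn).

Let lin_trunc n : linear (Tn n).
Proof. by case: (trunc_opbound n). Qed.

Let lam_cvg l : (lambda_ beta n l : CC R) @[n --> \oo] --> (l : CC R).
Proof. exact: (lambda_cvg beta0 (n_ := id) cvg_id (cvg_cst l)). Qed.

Lemma nabla_s_nonempty : Ds !=set0.
Proof.
have C0 : 0 <= C by case: T_bd.
have [x x0 xC] : exists2 x : R, 0 < x & x * (C + 1) = 4^-1.
  exists (4 * (C + 1))^-1; first by rewrite invr_gt0; lra.
  by field; lra.
have [l l0 lx] : exists2 l : CC R, l != 0 & rnorm l = x.
  exists x%:C; last by rewrite rnormcE /= expr0n addr0 sqrtr_sqr ger0_norm// ltW.
  by apply/eqP => -[] h; move: x0; rewrite h ltxx.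
exists l; apply/(nabla_sP beta0 l lin_trunc); split=> //.
exists (fun n => resolvent (Tn n) (lambda_ beta n l)), (2 * 1).
have n0 : \forall n \near \oo, 1 - beta n * l != 0.
  exact: (lambda_denom_neq0 beta0 (n_ := id) cvg_id (cvg_cst l)).
have hl : \forall n \near \oo, rnorm (lambda_ beta n l - l : CC R) < x.
  exact: ((rcvgP _ _).1 (@lam_cvg l) x x0).
have hQ : \forall n \near \oo, bounded_inverse (2 * 1) (Tn n) (lambda_ beta n l)
    (resolvent (Tn n) (lambda_ beta n l)).
  apply: filterS hl => n hl; apply: (inverse_small (trunc_opbound n)).
  have := rnormD (lambda_ beta n l - l : CC R) l; rewrite subrK lx => h.
  have := rnorm_ge0 (lambda_ beta n l : CC R); nra.
split; first by apply: filterS2 n0 hQ.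
move=> f; apply/cvg_ex; exists (resolvent T l f).
have [_ /(_ f)[_ iT]] : bounded_inverse (2 * 1) T l (resolvent T l).
  by apply: (inverse_small T_bd); rewrite lx; nra.
have cT y : Tn n y @[n --> \oo] --> T y by exact: (trunc_cvg (n_ := id) cvg_id).
have h1 : lambda_ beta n l *: Tn n (resolvent T l f) @[n --> \oo] --> l *: T (resolvent T l f).
  exact: (rcvgZ (@lam_cvg l) (cT (resolvent T l f))).
exact: (inverse_cvg hQ iT h1 (cvg_cst f)).
Qed.

Lemma nabla_s_inverse l0 : Ds l0 -> exists M,
  bounded_inverse M T l0 (resolvent T l0) /\
  \forall n \near \oo, bounded_inverse M (Tn n) (lambda_ beta n l0) (resolvent (Tn n) (lambda_ beta n l0)).
Proof.
move/(nabla_sP beta0 l0 lin_trunc) => [_ [Q_ [M [hQ cQ]]]]; exists M.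
have hQ' : \forall n \near \oo, bounded_inverse M (Tn n) (lambda_ beta n l0) (Q_ n).
  by apply: filterS hQ => n [].
split; last by apply: filterS hQ' => n; exact: bounded_inverse_resolvent.
have cT f : Tn n f @[n --> \oo] --> T f by exact: (trunc_cvg (n_ := id) cvg_id).
have lT : linear T by case: T_bd.
by have [Q /bounded_inverse_resolvent] := inverse_limit trunc_opbound cT lT (@lam_cvg l0) hQ' cQ.
Qed.

Section LocalConvergence.
Variables (M : R) (l0 : CC R).
Hypothesis iT0 : bounded_inverse M T l0 (resolvent T l0).
Hypothesis iTn0 : \forall n \near \oo,
  bounded_inverse M (Tn n) (lambda_ beta n l0) (resolvent (Tn n) (lambda_ beta n l0)).
Variables (I : Type) (F : set_system I).
Context {FF : Filter F}.
Variables (n_ : I -> nat) (l_ : I -> CC R).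
Hypotheses (n_y : n_ i @[i --> F] --> \oo) (l_l : l_ i @[i --> F] --> l0).

Let lam i : CC R := lambda_ beta (n_ i) (l_ i).
Let Qn i := resolvent (Tn (n_ i)) (lam i).
Let Q i := resolvent T (l_ i).

Let lam_l : lam i @[i --> F] --> l0.
Proof. exact: (lambda_cvg beta0 n_y l_l). Qed.

Let lam0_l : (lambda_ beta (n_ i) l0 : CC R) @[i --> F] --> l0.
Proof. exact: (lambda_cvg beta0 n_y (cvg_cst l0)). Qed.

Let C_ge0 : 0 <= C. Proof. by case: T_bd. Qed.
Let M0 : 0 <= M. Proof. by case: iT0 => -[]. Qed.
(* At distance less than d from l0 both parameters of [inverse_near] are 2 d apart at
   most, and 2 d C M <= 1 / 2. *)
Let d : R := (4 * (C * M + 1))^-1.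
Let CM0 : 0 <= C * M. Proof. exact: mulr_ge0. Qed.
Let d0 : 0 < d.
Proof. by rewrite invr_gt0; have := CM0; lra. Qed.
Let dCM : d * (C * M) <= 4^-1.
Proof.
have h : d * (C * M + 1) = 4^-1 by rewrite /d; field; have := CM0; lra.
by rewrite -h ler_wpM2l ?(ltW d0)// lerDl.
Qed.

Lemma near_trunc_inverse : \forall i \near F, bounded_inverse (2 * M) (Tn (n_ i)) (lam i) (Qn i).
Proof.
have h1 : \forall i \near F, rnorm (lam i - l0) < d by exact: ((rcvgP _ _).1 lam_l d d0).
have h2 : \forall i \near F, rnorm (lambda_ beta (n_ i) l0 - l0 : CC R) < d.
  exact: ((rcvgP _ _).1 lam0_l d d0).
have h3 : \forall i \near F, bounded_inverse M (Tn (n_ i)) (lambda_ beta (n_ i) l0)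
  (resolvent (Tn (n_ i)) (lambda_ beta (n_ i) l0)) by exact: n_y iTn0.
apply: filterS3 h1 h2 h3 => i h1 h2 h3.
apply: (inverse_near (trunc_opbound (n_ i)) h3).
have h4 : rnorm (lam i - lambda_ beta (n_ i) l0 : CC R) <= 2 * d.
  by apply: le_trans (rnorm_dist _ _ l0) _; rewrite (rnormB l0); lra.
have := ler_wpM2r CM0 h4; have := dCM; lra.
Qed.

Lemma near_inverse : \forall i \near F, bounded_inverse (2 * M) T (l_ i) (Q i).
Proof.
have h1 : \forall i \near F, rnorm (l_ i - l0) < d by exact: ((rcvgP _ _).1 l_l d d0).
apply: filterS h1 => i h1; apply: (inverse_near T_bd iT0).
by have := ler_wpM2r CM0 (ltW h1); have := dCM; lra.
Qed.

Lemma trunc_resolvent_cvg (y_ : I -> H) (y : H) : y_ i @[i --> F] --> y ->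
  Qn i (y_ i) @[i --> F] --> resolvent T l0 y.
Proof.
move=> yy; have [_ /(_ y)[_ iT]] := iT0.
have h1 : Tn (n_ i) (resolvent T l0 y) @[i --> F] --> T (resolvent T l0 y).
  exact: trunc_cvg.
have h2 : lam i *: Tn (n_ i) (resolvent T l0 y) @[i --> F] --> l0 *: T (resolvent T l0 y).
  exact: (rcvgZ lam_l h1).
exact: (inverse_cvg near_trunc_inverse iT h2 yy).
Qed.

Lemma resolvent_cvg (y_ : I -> H) (y : H) : y_ i @[i --> F] --> y ->
  Q i (y_ i) @[i --> F] --> resolvent T l0 y.
Proof.
move=> yy; have [_ /(_ y)[_ iT]] := iT0.
have h2 : l_ i *: T (resolvent T l0 y) @[i --> F] --> l0 *: T (resolvent T l0 y).
  exact: (rcvgZ l_l (cvg_cst _)).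
exact: (inverse_cvg (S_ := fun=> T) near_inverse iT h2 yy).
Qed.

Let conj_cvg (z_ : I -> CC R) (z : CC R) : z_ i @[i --> F] --> z ->
  (conjc (z_ i) : CC R) @[i --> F] --> (conjc z : CC R).
Proof.
move=> /rcvg0P zz; apply: (rcvg_squeeze (g := fun i => rnorm (z_ i - z))) => //.
by apply: nearW => i; rewrite !rnormcE -conjcN -conjcD normc_conj.
Qed.

(* The adjoint of the resolvent solves the adjoint equation. *)
Let adj_iT (y : H) : adj (resolvent T l0) y - conjc l0 *: adj T (adj (resolvent T l0) y) = y.
Proof.
have [bQ0 _] := iT0; have [aQ0 bQ0'] := adjP bQ0; have [aT _] := adjP T_bd.
by have [_ /(_ y)[]] := adjoint_inverse iT0 aT aQ0 bQ0'.
Qed.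

(** The adjoint of T_n is T' P_n, which converges strongly to the adjoint T' of T; this
    is why the rows converge as well as the columns. *)
Lemma trunc_adj_resolvent_cvg (y_ : I -> H) (y : H) : y_ i @[i --> F] --> y ->
  adj (Qn i) (y_ i) @[i --> F] --> adj (resolvent T l0) y.
Proof.
move=> yy; set z := adj (resolvent T l0) y.
have [aT _] := adjP T_bd.
have h1 : adj T (P (n_ i) z) @[i --> F] --> adj T z by exact: trunc_adj_cvg.
have h2 : conjc (lam i) *: adj T (P (n_ i) z) @[i --> F] --> conjc l0 *: adj T z.
  exact: (rcvgZ (conj_cvg lam_l) h1).
have h3 : \forall i \near F, bounded_inverse (2 * M) (adj T \o P (n_ i)) (conjc (lam i)) (adj (Qn i)).
  apply: filterS near_trunc_inverse => i iQ; have [bQ _] := iQ; have [aQ bQ'] := adjP bQ.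
  apply: (adjoint_inverse iQ _ aQ bQ') => f g.
  by rewrite /Tn /T_trunc /= cutoff_proj_selfadjoint aT.
exact: (inverse_cvg (S_ := fun i => adj T \o P (n_ i)) h3 (adj_iT y) h2 yy).
Qed.

Lemma adj_resolvent_cvg (y_ : I -> H) (y : H) : y_ i @[i --> F] --> y ->
  adj (Q i) (y_ i) @[i --> F] --> adj (resolvent T l0) y.
Proof.
move=> yy; set z := adj (resolvent T l0) y.
have [aT _] := adjP T_bd.
have h2 : conjc (l_ i) *: adj T z @[i --> F] --> conjc l0 *: adj T z.
  exact: (rcvgZ (conj_cvg l_l) (cvg_cst _)).
have h3 : \forall i \near F, bounded_inverse (2 * M) (adj T) (conjc (l_ i)) (adj (Q i)).
  apply: filterS near_inverse => i iQ; have [bQ _] := iQ; have [aQ bQ'] := adjP bQ.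
  exact: (adjoint_inverse iQ aT aQ bQ').
exact: (inverse_cvg (S_ := fun=> adj T) h3 (adj_iT y) h2 yy).
Qed.

Let Kn i := resolvent_kernel (Tn (n_ i)) (lam i).
Let Kl i := resolvent_kernel T (l_ i).

Lemma near_trunc_facts : \forall i \near F,
  [/\ Kn i = Rkernel (Qn i) (Kt (n_ i)) (lam i),
      forall t, carleman' (Kn i) t = Qn i (P (n_ i) (carleman' K t)) &
      forall s, carleman (Kn i) s = adj (Qn i) (cutoff (tau (n_ i)) s *: carleman K s)].
Proof.
apply: filterS near_trunc_inverse => i iQ.
have [h1 h2 h3] := resolvent_facts (trunc_opbound (n_ i)) (trunc_integral (n_ i)) (Kt_K0 (n_ i)) iQ.
split=> // [t|s].
- by rewrite -carleman'_trunc; exact: h2.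
- by rewrite -carleman_trunc; exact: h3.
Qed.

Lemma near_facts : \forall i \near F,
  [/\ Kl i = Rkernel (Q i) K (l_ i),
      forall t, carleman' (Kl i) t = Q i (carleman' K t) &
      forall s, carleman (Kl i) s = adj (Q i) (carleman K s)].
Proof.
by apply: filterS near_inverse => i; exact: (resolvent_facts T_bd T_int K_K0).
Qed.

(** The points vary together with n and the spectral parameter, so that these limits
    yield both uniformity in the points and uniformity in the parameter. *)
Lemma carleman'_cvg0 (t_ : I -> R) (t : R) : t_ i @[i --> F] --> t ->
  rnorm (carleman' (Kn i) (t_ i) - carleman' (Kl i) (t_ i)) @[i --> F] --> (0 : R).
Proof.
move=> tt.
have kt : carleman' K (t_ i) @[i --> F] --> carleman' K t.
  by have ck := @carleman'_continuous _ _ K_K0 t; apply: (cvg_comp _ _ tt ck).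
apply: (dist_cvg0 (w := resolvent T l0 (carleman' K t))).
- have h1 : Qn i (P (n_ i) (carleman' K (t_ i))) @[i --> F] --> resolvent T l0 (carleman' K t).
    by apply: trunc_resolvent_cvg; exact: proj_cvg.
  by apply: (near_cvg h1); apply: filterS near_trunc_facts => i [_ h _]; rewrite h.
- have h1 : Q i (carleman' K (t_ i)) @[i --> F] --> resolvent T l0 (carleman' K t).
    exact: resolvent_cvg.
  by apply: (near_cvg h1); apply: filterS near_facts => i [_ h _]; rewrite h.
Qed.

Lemma carleman_cvg0 (s_ : I -> R) (s : R) : s_ i @[i --> F] --> s ->
  rnorm (carleman (Kn i) (s_ i) - carleman (Kl i) (s_ i)) @[i --> F] --> (0 : R).
Proof.
move=> ss.
have ks : carleman K (s_ i) @[i --> F] --> carleman K s.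
  by have ck := @carleman_continuous _ _ K_K0 s; apply: (cvg_comp _ _ ss ck).
apply: (dist_cvg0 (w := adj (resolvent T l0) (carleman K s))).
- have h1 : adj (Qn i) (carleman K (s_ i)) @[i --> F] --> adj (resolvent T l0) (carleman K s).
    exact: trunc_adj_resolvent_cvg.
  apply: (near_cvg h1).
  apply: filterS2 near_trunc_facts (cutoff_near1 n_y ss) => i [_ _ h] c1.
  by rewrite h c1 scale1r.
- have h1 : adj (Q i) (carleman K (s_ i)) @[i --> F] --> adj (resolvent T l0) (carleman K s).
    exact: adj_resolvent_cvg.
  by apply: (near_cvg h1); apply: filterS near_facts => i [_ _ h]; rewrite h.
Qed.

Lemma kernel_cvg0 (s_ t_ : I -> R) (s t : R) : s_ i @[i --> F] --> s -> t_ i @[i --> F] --> t ->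
  rnorm (Kn i (s_ i, t_ i) - Kl i (s_ i, t_ i)) @[i --> F] --> (0 : R).
Proof.
move=> ss tt.
have kt : carleman' K (t_ i) @[i --> F] --> carleman' K t.
  by have ck := @carleman'_continuous _ _ K_K0 t; apply: (cvg_comp _ _ tt ck).
have ks : carleman K (s_ i) @[i --> F] --> carleman K s.
  by have ck := @carleman_continuous _ _ K_K0 s; apply: (cvg_comp _ _ ss ck).
have Kst : K (s_ i, t_ i) @[i --> F] --> K (s, t).
  have [_ [cK _] _ _] := K_K0; have ck := cK (s, t).
  have hp : (s_ i, t_ i) @[i --> F] --> (s, t) by exact: (cvg_pair ss tt).
  by apply: (cvg_comp _ _ hp ck).
apply: (dist_cvg0 (w := (K (s, t) + l0 * L2_inner (resolvent T l0 (carleman' K t)) (carleman K s) : CC R))).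
- have h1 : Qn i (P (n_ i) (carleman' K (t_ i))) @[i --> F] --> resolvent T l0 (carleman' K t).
    by apply: trunc_resolvent_cvg; exact: proj_cvg.
  have h2 := rcvgM lam_l (inner_cvg h1 ks).
  apply: (near_cvg (cvgD Kst (h2 _ _))).
  apply: filterS2 near_trunc_facts (cutoff_near1 n_y ss) => i [h' _ _] c1.
  by rewrite h' /Rkernel carleman_trunc carleman'_trunc /Kt /= c1 scale1r mul1r.
- have h1 : Q i (carleman' K (t_ i)) @[i --> F] --> resolvent T l0 (carleman' K t).
    exact: resolvent_cvg.
  have h2 := rcvgM l_l (inner_cvg h1 ks).
  apply: (near_cvg (cvgD Kst (h2 _ _))).
  by apply: filterS near_facts => i [-> _ _].
Qed.

End LocalConvergence.

Let Kn n l := resolvent_kernel (Tn n) (lambda_ beta n l).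
Let Kl l := resolvent_kernel T l.

Section FixedParameter.
Variables (M : R) (l : CC R).
Hypothesis iT : bounded_inverse M T l (resolvent T l).
Hypothesis iTn : \forall n \near \oo,
  bounded_inverse M (Tn n) (lambda_ beta n l) (resolvent (Tn n) (lambda_ beta n l)).

Let M0 : 0 <= M. Proof. by case: iT => -[]. Qed.

Let trunc_facts : \forall n \near \oo,
  [/\ Kn n l = Rkernel (resolvent (Tn n) (lambda_ beta n l)) (Kt n) (lambda_ beta n l),
      forall t, carleman' (Kn n l) t = resolvent (Tn n) (lambda_ beta n l) (P n (carleman' K t)) &
      forall s, carleman (Kn n l) s =
        adj (resolvent (Tn n) (lambda_ beta n l)) (cutoff (tau n) s *: carleman K s)].
Proof. exact: (near_trunc_facts iT iTn (n_ := id) cvg_id (cvg_cst l)). Qed.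

Let facts := resolvent_facts T_bd T_int K_K0 iT.

Let cutoff_rnorm n s (u : H) : rnorm (cutoff (tau n) s *: u) <= rnorm u.
Proof. by rewrite rnormZ ler_piMl ?rnorm_ge0//; exact: cutoff_norm. Qed.

Let P_rnorm n (u : H) : rnorm (P n u) <= rnorm u.
Proof. by have [_ _ /(_ u)] := P_bd n; rewrite mul1r. Qed.

(** Far away both columns are small, since both resolvents are bounded by M and the
    projections by 1. *)
Lemma carleman'_uniform_cvg :
  C0norm (fun t => carleman' (Kn n l) t - carleman' (Kl l) t) @[n --> \oo] --> 0%E.
Proof.
apply: (@esup_space_cvg0 _ _ (fun n t => rnorm (carleman' (Kn n l) t - carleman' (Kl l) t))).
- exact: bounded_compact_R.
- move=> t.
  exact: (carleman'_cvg0 iT iTn (F := filter_prod (nbhs t) \oo) (n_ := snd) (l_ := fun=> l)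
    cvg_snd (cvg_cst l) (t_ := fst) cvg_fst).
- move=> e e0; have [_ _ _ [_ vk]] := K_K0.
  have M1 : 0 < 2 * M + 1 by have := M0; lra.
  have [A hA] := vk _ (divr_gt0 e0 M1); exists A.
  apply: filterS2 trunc_facts iTn => n [_ h _] [[_ _ bQ] _] t /hA.
  have [_ /(_ t) h' _] := facts; have [[_ _ bQ'] _] := iT.
  rewrite h /Kl h' ltr_pdivlMr// => small; apply: le_lt_trans small.
  apply: le_trans (rnorm_sub _ _) _.
  have := bQ (P n (carleman' K t)); have := bQ' (carleman' K t).
  have := ler_wpM2l M0 (P_rnorm n (carleman' K t)).
  have := rnorm_ge0 (carleman' K t); lra.
Qed.

Lemma carleman_uniform_cvg :
  C0norm (fun s => carleman (Kn n l) s - carleman (Kl l) s) @[n --> \oo] --> 0%E.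
Proof.
apply: (@esup_space_cvg0 _ _ (fun n s => rnorm (carleman (Kn n l) s - carleman (Kl l) s))).
- exact: bounded_compact_R.
- move=> s.
  exact: (carleman_cvg0 iT iTn (F := filter_prod (nbhs s) \oo) (n_ := snd) (l_ := fun=> l)
    cvg_snd (cvg_cst l) (s_ := fst) cvg_fst).
- move=> e e0; have [_ _ [_ vk] _] := K_K0.
  have M1 : 0 < 2 * M + 1 by have := M0; lra.
  have [A hA] := vk _ (divr_gt0 e0 M1); exists A.
  apply: filterS2 trunc_facts iTn => n [_ _ h] [bQ _] s /hA.
  have [_ _ /(_ s) h'] := facts; have [bQ' _] := iT.
  have [_ [_ _ aQ]] := adjP bQ; have [_ [_ _ aQ']] := adjP bQ'.
  rewrite h /Kl h' ltr_pdivlMr// => small; apply: le_lt_trans small.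
  apply: le_trans (rnorm_sub _ _) _.
  have := aQ (cutoff (tau n) s *: carleman K s); have := aQ' (carleman K s).
  have := ler_wpM2l M0 (cutoff_rnorm n s (carleman K s)).
  have := rnorm_ge0 (carleman K s); lra.
Qed.

(** Far away each of the three terms K_n, l_n <Q_n P_n k'(t), k_n(s)> and the limit
    kernel is less than e / 3. *)
Lemma kernel_uniform_cvg :
  C0norm (fun p => Kn n l p - Kl l p) @[n --> \oo] --> 0%E.
Proof.
apply: (@esup_space_cvg0 _ _ (fun n p => rnorm (Kn n l p - Kl l p))).
- exact: bounded_compact_R2.
- move=> [s t].
  have cs : p.1.1 @[p --> filter_prod (nbhs (s, t)) \oo] --> s.
    by apply: (cvg_comp _ _ cvg_fst); exact: cvg_fst.
  have ct : p.1.2 @[p --> filter_prod (nbhs (s, t)) \oo] --> t.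
    by apply: (cvg_comp _ _ cvg_fst); exact: cvg_snd.
  have h : rnorm (Kn p.2 l (p.1.1, p.1.2) - Kl l (p.1.1, p.1.2))
      @[p --> filter_prod (nbhs (s, t)) \oo] --> (0 : R).
    exact: (kernel_cvg0 iT iTn (F := filter_prod (nbhs (s, t)) \oo) (n_ := snd)
      (l_ := fun=> l) cvg_snd (cvg_cst l) cs ct).
  by apply: cvg_trans h; apply: near_eq_cvg; apply: nearW => -[[a b] n].
- move=> e e0.
  have [_ CK Ck Ck'] := K_K0.
  have L1 : 0 < (rnorm l + 1) * M + 1.
    by have := mulr_ge0 (rnorm_ge0 l) M0; have := M0; lra.
  have e3 : 0 < e / 3 by rewrite divr_gt0.
  have [A1 h1] := CK.2 _ e3.
  have [A2 h2] := C0_norm_prod Ck' Ck (divr_gt0 e3 L1).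
  have [bQ _] := iT; have [aQ bQ'] := adjP bQ; have [aT _] := adjP T_bd.
  have [A3 h3] := (Rkernel_C0 K_K0 iT).2 _ e3.
  exists (Num.max A1 (Num.max A2 A3)).
  have hl : \forall n \near \oo, rnorm (lambda_ beta n l - l : CC R) < 1.
    exact: ((rcvgP _ _).1 (@lam_cvg l) 1 ltr01).
  apply: filterS3 trunc_facts iTn hl => n [-> _ _] [[_ _ bQn] _] hl p.
  rewrite !gt_max => /andP[/h1 p1 /andP[/h2 p2 /h3 p3]].
  have [E _ _] := facts; rewrite /Kl E.
  apply: le_lt_trans (rnorm_sub _ _) _.
  rewrite /Rkernel carleman_trunc carleman'_trunc; rewrite /Rkernel in p3.
  set z := L2_inner (resolvent (Tn n) _ _) _.
  have k1 : rnorm (Kt n p) < e / 3.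
    apply: le_lt_trans p1; rewrite /Kt rnormM ler_piMl ?rnorm_ge0//.
    exact: cutoff_norm.
  have k2 : rnorm (lambda_ beta n l * z : CC R) < e / 3.
    move: p2; rewrite ltr_pdivlMr//; apply: le_lt_trans.
    have z1 : rnorm (z : CC R) <= M * (rnorm (carleman' K p.2) * rnorm (carleman K p.1)).
      rewrite rnormcE; apply: le_trans (cauchy_schwarz _ _) _.
      rewrite mulrA; apply: ler_pM; rewrite ?rnorm_ge0//.
      by apply: le_trans (bQn _) _; rewrite ler_wpM2l.
    have l1 : rnorm (lambda_ beta n l : CC R) <= rnorm l + 1.
      by have := rnormD (lambda_ beta n l - l : CC R) l; rewrite subrK; lra.
    rewrite rnormM; apply: (@le_trans _ _ ((rnorm l + 1) *
       (M * (rnorm (carleman' K p.2) * rnorm (carleman K p.1))))).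
      by apply: ler_pM; rewrite ?rnorm_ge0.
    rewrite mulrA [leLHS]mulrC ler_wpM2l ?mulr_ge0 ?rnorm_ge0//; lra.
  have := rnormD (Kt n p : CC R) (lambda_ beta n l * z); lra.
Qed.

End FixedParameter.

Section CompactParameters.
Variable A : set (CC R).
Hypotheses (cA : compact A) (A_Ds : A `<=` Ds).

Lemma regular_on_compact : \forall n \near \oo, forall l, A l ->
  1 - beta n * l != 0 /\ regular_values (Tn n) (lambda_ beta n l).
Proof.
apply: (@compact_uniform (CC R) A (fun n l =>
  1 - beta n * l != 0 /\ regular_values (Tn n) (lambda_ beta n l))) => // l /A_Ds.
move=> /nabla_s_inverse[M [iT iTn]].
have n0 := @lambda_denom_neq0 R beta beta0 _ (filter_prod (nbhs l) \oo) _ snd fst l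
  cvg_snd cvg_fst.
have h := near_trunc_inverse iT iTn (F := filter_prod (nbhs l) \oo) (n_ := snd) (l_ := fst)
  cvg_snd cvg_fst.
apply: (@filterS2 _ (filter_prod (nbhs l) \oo) _ _ _ _ _ (n0 _ _ _) (h _ _ _)) => -[l' n] /= h1 h2.
by split=> //; eexists; apply/bounded_inverseP; eexists; exact: h2.
Qed.

Lemma carleman'_compact_cvg (t : R) :
  esup A (fun l => rnorm (carleman' (Kn n l) t - carleman' (Kl l) t)) @[n --> \oo] --> 0%E.
Proof.
apply: (@esup_compact_cvg0 _ _ _ (fun n l => rnorm (carleman' (Kn n l) t - carleman' (Kl l) t))) => //.
move=> l /A_Ds/nabla_s_inverse[M [iT iTn]].
exact: (carleman'_cvg0 iT iTn (F := filter_prod (nbhs l) \oo) (n_ := snd) (l_ := fst)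
  cvg_snd cvg_fst (t_ := fun=> t) (cvg_cst t)).
Qed.

Lemma carleman_compact_cvg (s : R) :
  esup A (fun l => rnorm (carleman (Kn n l) s - carleman (Kl l) s)) @[n --> \oo] --> 0%E.
Proof.
apply: (@esup_compact_cvg0 _ _ _ (fun n l => rnorm (carleman (Kn n l) s - carleman (Kl l) s))) => //.
move=> l /A_Ds/nabla_s_inverse[M [iT iTn]].
exact: (carleman_cvg0 iT iTn (F := filter_prod (nbhs l) \oo) (n_ := snd) (l_ := fst)
  cvg_snd cvg_fst (s_ := fun=> s) (cvg_cst s)).
Qed.

Lemma kernel_compact_cvg (s t : R) :
  esup A (fun l => rnorm (Kn n l (s, t) - Kl l (s, t))) @[n --> \oo] --> 0%E.
Proof.
apply: (@esup_compact_cvg0 _ _ _ (fun n l => rnorm (Kn n l (s, t) - Kl l (s, t)))) => //.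
move=> l /A_Ds/nabla_s_inverse[M [iT iTn]].
exact: (kernel_cvg0 iT iTn (F := filter_prod (nbhs l) \oo) (n_ := snd) (l_ := fst)
  cvg_snd cvg_fst (s_ := fun=> s) (t_ := fun=> t) (cvg_cst s) (cvg_cst t)).
Qed.

End CompactParameters.

End Truncations.

Theorem theorem10 (R : realType) (T : L2R R -> L2R R) (K : R * R -> CC R)
    (tau : nat -> R) (beta : nat -> CC R)
    (T_bounded : bounded_operator T)
    (T_integral : integral_operator T K)
    (K_K0 : K0_kernel K)
    (T_trunc_nuclear : nuclear_truncations tau T K)
    (beta_to0 : beta n @[n --> \oo] --> (0 : CC R)) :
  let Tn := T_trunc tau T in
  let Ds := nabla_s (perturbed beta Tn) in
  let Ds2 := nabla_s (perturbed beta (T_trunc2 tau T)) in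
  let K_ l := resolvent_kernel T l in
  let Kn n l := resolvent_kernel (Tn n) (lambda_ beta n l) in
  [/\ Ds !=set0, Ds `<=` Ds2 & Ds2 `<=` regular_values T] /\
  (* the kernels Kn n l are defined for all large n, uniformly on compact sets *)
  (forall A : set (CC R), compact A -> A `<=` Ds2 ->
     \forall n \near \oo, forall l, A l ->
       1 - beta n * l != 0 /\ regular_values (Tn n) (lambda_ beta n l)) /\
  ((forall l, Ds2 l ->
      C0norm (fun t => carleman' (Kn n l) t - carleman' (K_ l) t)
        @[n --> \oo] --> 0%E) /\
   (forall A : set (CC R), compact A -> A `<=` Ds2 -> forall t : R,
      esup A (fun l => rnorm (carleman' (Kn n l) t - carleman' (K_ l) t))
        @[n --> \oo] --> 0%E)) /\
  ((forall l, Ds l ->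
      C0norm (fun s => carleman (Kn n l) s - carleman (K_ l) s)
        @[n --> \oo] --> 0%E) /\
   (forall A : set (CC R), compact A -> A `<=` Ds -> forall s : R,
      esup A (fun l => rnorm (carleman (Kn n l) s - carleman (K_ l) s))
        @[n --> \oo] --> 0%E)) /\
  ((forall l, Ds2 l ->
      C0norm (fun p => Kn n l p - K_ l p) @[n --> \oo] --> 0%E) /\
   (forall A : set (CC R), compact A -> A `<=` Ds2 -> forall s t : R,
      esup A (fun l => rnorm (Kn n l (s, t) - K_ l (s, t)))
        @[n --> \oo] --> 0%E)).
Proof.
move=> Tn Ds Ds2 K_ Kn.
have [C T_bd] := (bounded_operatorP T).1 T_bounded.
have [_ _ tauy trunc] := T_trunc_nuclear.
have Kt_K0 n : K0_kernel (fun p => cutoff (tau n) p.1 * K p) by case: (trunc n).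
have DsE : Ds2 = Ds by exact: (nabla_s_trunc2 T_bd tauy beta_to0).
rewrite DsE; split; last split; last split; last split.
- split; first exact: (nabla_s_nonempty T_bd tauy beta_to0).
    by move=> l.
  move=> l /(nabla_s_inverse T_bd tauy beta_to0)[M [iT _]].
  by exists (resolvent T l); apply/bounded_inverseP; exists M.
- move=> A cA A_Ds.
  exact: (regular_on_compact T_bd tauy beta_to0 cA A_Ds).
- split=> [l /(nabla_s_inverse T_bd tauy beta_to0)[M [iT iTn]]|A cA A_Ds t].
  + exact: (carleman'_uniform_cvg T_bd T_integral K_K0 tauy beta_to0 Kt_K0 iT iTn).
  + exact: (carleman'_compact_cvg T_bd T_integral K_K0 tauy beta_to0 Kt_K0 cA A_Ds).
- split=> [l /(nabla_s_inverse T_bd tauy beta_to0)[M [iT iTn]]|A cA A_Ds s].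
  + exact: (carleman_uniform_cvg T_bd T_integral K_K0 tauy beta_to0 Kt_K0 iT iTn).
  + exact: (carleman_compact_cvg T_bd T_integral K_K0 tauy beta_to0 Kt_K0 cA A_Ds).
- split=> [l /(nabla_s_inverse T_bd tauy beta_to0)[M [iT iTn]]|A cA A_Ds s t].
  + exact: (kernel_uniform_cvg T_bd T_integral K_K0 tauy beta_to0 Kt_K0 iT iTn).
  + exact: (kernel_compact_cvg T_bd T_integral K_K0 tauy beta_to0 Kt_K0 cA A_Ds).
Qed.
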